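(* Assume that $(L_\Lambda)_{\Lambda\subset\{1,\dots,N\}}$ is a collection of convex functions $L_\Lambda:\mathbb{R}^N\to[0,+\infty]$ satisfying the following three conditions. (A1) For any $\Lambda\subset\{1,\dots,N\}$ and $T>0$, and for any function $\phi:[0,T]\to\mathbb{R}_+^N$ with constant velocity $\dot\phi(t)=v$ and such that $\phi(t)\in B_\Lambda$ for $0<t<T$, $$\lim_{\delta\to0}\lim_{\varepsilon\to0}\liminf_{n\to\infty}\inf_{z\in\mathcal{E}_n:\,|z-\phi(0)|<\varepsilon}\frac1n\log\mathbb{P}_z(\|\phi-Z_n\|_\infty<\delta)\ge -T\,L_\Lambda(v).$$ (A2) The function $L_{\{1,\dots,N\}}$ is finite in a neighborhood of zero. (A3) For any $\Lambda\subset\{1,\dots,N\}$ and $T>0$, and for any $x,y\in B_\Lambda$, $$\lim_{\delta\to0}\limsup_{n\to\infty}\sup_{z\in\mathcal{E}_n:\,|z-x|<\delta}\frac1n\log\mathbb{P}_z\big(|Z_n(T)-y|<\delta\text{ and }\tau_{\Lambda,n}>T\big)\le -T\,L_\Lambda\Big(\frac{y-x}{T}\Big).$$ Then for any $T>0$ and any absolutely continuous function $\phi:[0,T]\to\mathbb{R}_+^N$, $$I_{[0,T]}(\phi)=\int_0^T L(\phi(t),\dot\phi(t))\,dt=-W_{[0,T]}(\phi)=-w_{[0,T]}(\phi).$$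
   Context: Let $N\ge1$, $\mathbb{R}_+=[0,\infty)$, $E\subset\mathbb{R}_+^N$, and let $(X(t,x))_{t\ge0}$ be a Markov process on $E$ with a given transition kernel and initial state $X(0,x)=x$, with paths that are right-continuous with left limits. For $n\ge1$ let $\mathcal{E}_n=\frac1nE$ and, for $z\in\mathcal{E}_n$, let $Z_n(t,z)=X(nt,nz)/n$, a rescaled Markov process on $\mathcal{E}_n$ with $Z_n(0,z)=z$. One writes $Z_n(t)$ for $Z_n(t,z)$, and $\mathbb{P}_z$ indicates that the initial state is $z$. It is assumed that for any $x\in\mathbb{R}_+^N$ there is a sequence $x_n\in\mathcal{E}_n$ converging to $x$. For $x\in\mathbb{R}_+^N$, $\Lambda(x)=\{i: x_i>0\}$. For $\Lambda\subset\{1,\dots,N\}$, $B_\Lambda=\{x\in\mathbb{R}_+^N:\Lambda(x)=\Lambda\}$, and $\tau_{\Lambda,n}$ is the hitting time of the set $\bigcup_{i\in\Lambda}\{x:x_i=0\}$ by the process $(Z_n(t))$. $\|\cdot\|_\infty$ is the supremum norm over $[0,T]$. Put $L(x,v)=L_{\Lambda(x)}(v)$ for $x\in\mathbb{R}_+^N$, $v\in\mathbb{R}^N$. $D([0,T],\mathbb{R}_+^N)$ is the set of functions $[0,T]\to\mathbb{R}_+^N$ that are right-continuous with left limits, with Skorohod metric $d_S$. For a continuous piecewise linear (finitely many pieces) $\psi:[0,T]\to\mathbb{R}_+^N$ put $J_{[0,T]}(\psi)=\int_0^TL(\psi(s),\dot\psi(s))\,ds$, and for $\phi\in D([0,T],\mathbb{R}_+^N)$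 put $$I_{[0,T]}(\phi)=\lim_{\delta\to0}\inf_\psi J_{[0,T]}(\psi),$$ the infimum being over all continuous piecewise linear $\psi:[0,T]\to\mathbb{R}_+^N$ with $d_S(\phi,\psi)<\delta$. Moreover $$w_{[0,T]}(\phi)=\lim_{\delta\to0}\lim_{\varepsilon\to0}\liminf_{n\to\infty}\inf_{z\in\mathcal{E}_n:|z-\phi(0)|<\varepsilon}\frac1n\log\mathbb{P}_z(\|\phi-Z_n\|_\infty<\delta),$$ $$W_{[0,T]}(\phi)=\lim_{\delta\to0}\limsup_{n\to\infty}\sup_{z\in\mathcal{E}_n:|z-\phi(0)|<\delta}\frac1n\log\mathbb{P}_z(\|\phi-Z_n\|_\infty<\delta).$$ *)

(* Defs.v *)
From HB Require Import structures.
From mathcomp Require Import all_boot all_order all_algebra.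
From mathcomp Require Import all_classical all_reals all_analysis.

Set Implicit Arguments.
Unset Strict Implicit.
Unset Printing Implicit Defensive.

Import Order.TTheory GRing.Theory Num.Theory.
Import numFieldNormedType.Exports.

Local Open Scope classical_set_scope.
Local Open Scope ring_scope.

(* Conventions.  A path on [0, T] (or on [0, +oo[) is a total function R -> V,
   of which only the restriction to the time interval matters.  The norm of
   'rV[R]_N is the library's one, max_i |x_i|; absolute continuity and the
   limits as radii tend to 0 taken below are the same for all norms. *)

Section Orthant.
Variables (R : realType) (N : nat).
Implicit Types (x : 'rV[R]_N) (Lambda : {set 'I_N}).

Definition orthant : set 'rV[R]_N := [set x | forall i, 0 <= x ord0 i].

Definition pos_coords x : {set 'I_N} := finset (fun i => 0 < x ord0 i).

Definition face Lambda : set 'rV[R]_N :=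
  [set x | orthant x /\ pos_coords x = Lambda].

Definition hitting_time Lambda (z : R -> 'rV[R]_N) : \bar R :=
  ereal_inf [set t%:E | t in [set t | 0 <= t /\
    (\bigcup_(i in [set i | i \in Lambda]) [set x | x ord0 i = 0]) (z t)]].

(* In \bar R, 0 * +oo = 0: the cases a = 0 and a = 1 are trivial. *)
Definition convex_ereal (f : 'rV[R]_N -> \bar R) :=
  forall (u v : 'rV[R]_N) (a : R), 0 <= a -> a <= 1 ->
    (f (a *: u + (1 - a) *: v)%R <= a%:E * f u + (1 - a)%:E * f v)%E.

End Orthant.

Section Paths.
Variables (R : realType) (N : nat).
Implicit Types (T : R) (phi psi : R -> 'rV[R]_N).

Definition in_orthant T phi := forall t, 0 <= t <= T -> orthant (phi t).

Definition cadlag phi :=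
  (forall t, 0 <= t -> phi s @[s --> t^'+] --> phi t) /\
  (forall t, 0 < t -> cvg (phi s @[s --> t^'-])).

Definition sup_dist (V : normedZmodType R) T (f g : R -> V) : \bar R :=
  ereal_sup [set `|f t - g t|%:E | t in `[0, T]].

Definition time_change T (lambda : R -> R) :=
  [/\ lambda 0 = 0, lambda T = T,
      {in `[0, T] &, {homo lambda : s t / s < t}} &
      {within `[0, T], continuous lambda}].

Definition skorohod_dist T phi psi : \bar R :=
  ereal_inf [set maxe (sup_dist T lambda id) (sup_dist T phi (psi \o lambda))
            | lambda in time_change T].

Definition piecewise_linear T psi :=
  {within `[0, T], continuous psi} /\
  exists (m : nat) (s : nat -> R),
    [/\ s 0%N = 0, s m = T, (forall k, (k < m)%N -> s k < s k.+1) &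
        forall k, (k < m)%N -> exists a v : 'rV[R]_N,
          forall t, s k < t < s k.+1 -> psi t = a + t *: v].

Definition absolutely_continuous T phi :=
  forall eps : R, 0 < eps -> exists2 delta : R, 0 < delta &
    forall (m : nat) (a b : 'I_m -> R),
      (forall i, 0 <= a i /\ a i <= b i /\ b i <= T) ->
      (forall i j, i != j -> b i <= a j \/ b j <= a i) ->
      \sum_(i < m) (b i - a i) < delta ->
      \sum_(i < m) `|phi (b i) - phi (a i)| < eps.

Variable L : {set 'I_N} -> 'rV[R]_N -> \bar R.

(* The library's derivative has an arbitrary value at the points where the
   path is not differentiable; for the absolutely continuous (in particular,
   continuous piecewise linear) paths considered here these points are
   Lebesgue-negligible. *)
Definition action T phi : \bar R :=
  (\int[lebesgue_measure]_(t in `[0%R, T]) L (pos_coords (phi t)) (derive1 phi t))%E.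

Definition rate_fun T phi : \bar R :=
  lim (ereal_inf [set action T psi | psi in [set psi |
         [/\ in_orthant T psi, piecewise_linear T psi &
             (skorohod_dist T phi psi < delta%:E)%E]]] @[delta --> 0^'+]).

End Paths.

(* R^N with its Borel sigma-algebra *)
Notation borel_rV R N := (g_sigma_algebraType (@open 'rV[R]_N)).

Section Process.
Variables (R : realType) (N : nat) (d : measure_display).
Variables (Omega : measurableType d) (E : set 'rV[R]_N).
Variables (P : 'rV[R]_N -> probability Omega R).
Variables (k : R -> R.-pker (borel_rV R N) ~> (borel_rV R N)).
Variables (X : 'rV[R]_N -> R -> Omega -> 'rV[R]_N).

Definition past (Y : R -> Omega -> 'rV[R]_N) (s : R) : set (set Omega) :=
  <<s \bigcup_(u in `[0, s]) preimage_set_system [set: Omega]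
        (Y u : Omega -> borel_rV R N) measurable >>.

(* X x is the process started at x and P x the probability governing it;
   x ranges over E, and the values of P, X and k off E play no role.  A Markov
   kernel on E (with the trace sigma-algebra) always extends to one on R^N, so
   that taking k on R^N is no restriction on E or on the kernel. *)
Record markov_process : Prop := {
  mp_sub : E `<=` @orthant R N ;
  mp_state : forall x, E x -> forall t, 0 <= t -> forall w, E (X x t w) ;
  mp_meas : forall x, E x -> forall t, 0 <= t ->
    measurable_fun [set: Omega] (X x t : Omega -> borel_rV R N) ;
  mp_init : forall x, E x -> forall w, X x 0 w = x ;
  mp_cadlag : forall x, E x -> forall w, cadlag (X x ^~ w) ;
  mp_markov : forall x, E x -> forall s t, 0 <= s -> 0 <= t ->
    forall G : set Omega, past (X x) s G ->
    forall A : set (borel_rV R N), measurable A ->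
      P x (G `&` X x (s + t) @^-1` A) =
      (\int[P x]_(w in G) k t (X x s w) A)%E }.

Definition scaled_space (n : nat) : set 'rV[R]_N :=
  [set n%:R^-1 *: x | x in E].

Definition scaled_process (n : nat) (z : 'rV[R]_N) (t : R) (w : Omega) :
    'rV[R]_N :=
  n%:R^-1 *: X (n%:R *: z) (n%:R * t) w.

(* (1/n) log P_z(A).  The hitting-time events of right-continuous processes
   belong to the P_z-completion of the sigma-algebra of Omega, not to the
   sigma-algebra itself in general; the outer measure is the extension of P_z
   to the completion, and agrees with P_z on measurable events. *)
Definition log_prob (n : nat) (z : 'rV[R]_N) (A : set Omega) : \bar R :=
  (n%:R^-1%:E * lne (mu_ext (P (n%:R *: z)) A))%E.

Definition tube (T : R) (phi : R -> 'rV[R]_N) (delta : R) (n : nat)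
    (z : 'rV[R]_N) : set Omega :=
  [set w | (sup_dist T phi (fun t => scaled_process n z t w) < delta%:E)%E].

Definition scaled_ball (n : nat) (c : 'rV[R]_N) (r : R) : set 'rV[R]_N :=
  [set z | scaled_space n z /\ `|z - c| < r].

(* n = 0 contributes a meaningless term to the sequences below, which their
   inferior and superior limits ignore. *)
Definition lower_fun (T : R) (phi : R -> 'rV[R]_N) : \bar R :=
  lim (lim (limn_einf (fun n =>
    ereal_inf [set log_prob n z (tube T phi delta n z)
              | z in scaled_ball n (phi 0) eps])
    @[eps --> 0^'+]) @[delta --> 0^'+]).

Definition upper_fun (T : R) (phi : R -> 'rV[R]_N) : \bar R :=
  lim (limn_esup (fun n =>
    ereal_sup [set log_prob n z (tube T phi delta n z)
              | z in scaled_ball n (phi 0) delta])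
    @[delta --> 0^'+]).

Definition upper_transition (Lambda : {set 'I_N}) (T : R) (x y : 'rV[R]_N) :
    \bar R :=
  lim (limn_esup (fun n =>
    ereal_sup [set log_prob n z [set w |
                  `|scaled_process n z T w - y| < delta /\
                  (T%:E < hitting_time Lambda
                            (fun t => scaled_process n z t w))%E]
              | z in scaled_ball n x delta])
    @[delta --> 0^'+]).

End Process.

(* Main.v *)
(* With [I] the rate function, [A] the action, and [W], [w] the upper and lower
   exponential rates, one shows [I <= A <= - W <= - w <= I].

   The path is absolutely continuous, hence has an integrable derivative, which
   vanishes at almost every time spent on a coordinate hyperplane in the
   corresponding coordinate.  The path may leave and enter the faces of the
   orthant infinitely often; Lusin-type compact sets [S] replace the intervals
   of time spent on a face: up to a small integral, [0, T] is covered by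
   finitely many cells, each containing a compact set [S] on which the face is
   fixed and the velocity nearly constant.

   - [I <= A]: a piecewise linear path follows the given one by spending in
     each cell the time [|S|] in the face, at a velocity of [S], and by going
     from one end to the other through the interior of the orthant, where
     convexity and (A2) make short moves cheap.  The delays add up to little.
   - [A <= - W]: with [s] and [s'] the least and greatest elements of [S], the
     positive coordinates stay positive on [[s, s']], so that (A3) applies
     there, and the Markov property multiplies the bounds.  The slope between
     [s] and [s'] is close to the velocity, and (A1) and (A3) together make
     [L] lower semicontinuous along the face.
   - [- w <= I]: (A1) on each piece of a nearby piecewise linear path, glued by
     the Markov property, after a cheap move to its starting point. *)

(* Neither measurability nor semicontinuity of [L] is assumed. For [A <= - W], a simple function
   below the integrand takes its place, since the integral of a nonnegative function is a supremum
   over such functions. For [I <= A] integrals must be added, and measurability along the path is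
   derived from the semicontinuity that (A1) and (A3) force on each face.

   A set [S] enters the two bounds differently. The upper bound uses its extreme points, whose
   distance is at least [|S|]. The construction of a path uses its least point and [|S|]: the
   displacement over the cell is close to [|S|] times a velocity of [S].

   A route following the path is never early: detours make it spend in each cell at least the length
   of the cell. It can thus be cut at time [T], and uniform continuity absorbs the delay.

   [P y] is not assumed measurable in [y] either. The probability of a tube is measurable in the
   state as a limit of probabilities of events at dyadic times, which the kernel expresses. *)
Require Import Defs.
From HB Require Import structures.
From mathcomp Require Import all_boot all_order all_algebra.
From mathcomp Require Import all_classical all_reals all_analysis.
From mathcomp Require Import measurable_realfun ring lra.

Import Order.TTheory GRing.Theory Num.Theory.
Import numFieldNormedType.Exports.

Set Implicit Arguments.
Unset Strict Implicit.
Unset Printing Implicit Defensive.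

Local Open Scope classical_set_scope.
Local Open Scope ring_scope.

(** * Absolutely continuous functions *)

Section AC.
Variable R : realType.
Notation mu := (@lebesgue_measure R).
Notation TV := total_variation.

(** Stated on the whole line, since paths are extended by clamping time, and for families indexed by
    any finite type, since [ac_variation] uses a dependent sum. *)
Definition ac (f : R -> R) := forall eps : R, 0 < eps -> exists2 delta : R, 0 < delta &
  forall (I : finType) (a b : I -> R), (forall i, a i <= b i) ->
    (forall i j, i != j -> b i <= a j \/ b j <= a i) ->
    \sum_i (b i - a i) < delta -> \sum_i `|f (b i) - f (a i)| < eps.

Lemma path_lt_nth (a : R) s k : path <%R a s -> (k < size s)%N ->
  nth a (a :: s) k < nth a (a :: s) k.+1.
Proof. by move=> /(pathP a) /(_ k). Qed.

Lemma path_le_nth (a : R) s i j : path <%R a s -> (i <= j)%N -> (j <= size s)%N ->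
  nth a (a :: s) i <= nth a (a :: s) j.
Proof.
move=> p; elim: j => [|j IH] ij js; first by move: ij; rewrite leqn0 => /eqP ->.
move: ij; rewrite leq_eqVlt => /predU1P[->//|]; rewrite ltnS => ij.
by rewrite (le_trans (IH ij (ltnW js)))// ltW// path_lt_nth.
Qed.

Lemma variationE a b (f : R -> R) s : itv_partition a b s ->
  variation a b f s =
  \sum_(i < size s) `|f (nth a (a :: s) i.+1) - f (nth a (a :: s) i)|.
Proof.
move=> _; rewrite /variation big_mkord; apply: eq_bigr => i _ /=.
by congr (`| f _ - f _ |); apply: set_nth_default => /=; rewrite ?ltnS ?ltn_ord// ltnW ?ltnS ?ltn_ord.
Qed.

(** The pieces of all the partitions form one family of nonoverlapping intervals, indexed by pairs
    (interval, piece), whose total length telescopes to that of the original intervals. *)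
Lemma ac_variation f : ac f -> forall eps : R, 0 < eps -> exists2 delta : R, 0 < delta &
  forall (I : finType) (a b : I -> R) (s : I -> seq R),
    (forall i, itv_partition (a i) (b i) (s i)) ->
    (forall i j, i != j -> b i <= a j \/ b j <= a i) ->
    \sum_i (b i - a i) < delta -> \sum_i variation (a i) (b i) f (s i) < eps.
Proof.
move=> acf eps /acf[delta d0 H]; exists delta => // I a b s ps dis lt.
pose J := {i : I & 'I_(size (s i))}.
pose x (j : J) := nth (a (tag j)) (a (tag j) :: s (tag j)) (tagged j).
pose y (j : J) := nth (a (tag j)) (a (tag j) :: s (tag j)) (tagged j).+1.
have pth i : path <%R (a i) (s i) by case: (ps i).
have lst i : nth (a i) (a i :: s i) (size (s i)) = b i.
  by case: (ps i) => _ /eqP <-; rewrite (last_nth (a i)).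
have := H J x y.
have -> : \sum_j `|f (y j) - f (x j)| = \sum_i variation (a i) (b i) f (s i).
  under [RHS]eq_bigr do rewrite variationE//.
  by rewrite sig_big_dep.
apply.
- by move=> [i k]; apply: ltW; exact: path_lt_nth.
- move=> [i k] [i' k']; have [ii'|ii' _] := eqVneq i i'.
    subst i' => kk'; have {kk'} : k != k' by apply: contra kk' => /eqP ->.
    rewrite neq_ltn => /orP[] kk; [left|right].
      exact: (@path_le_nth (a i) (s i) k.+1 k' (pth i) kk (ltnW (ltn_ord k'))).
    exact: (@path_le_nth (a i) (s i) k'.+1 k (pth i) kk (ltnW (ltn_ord k))).
  have bx (j : J) : y j <= b (tag j).
    by rewrite -lst; exact: (@path_le_nth _ (s (tag j)) (tagged j).+1 _ (pth _) (ltn_ord _)).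
  have ax (j : J) : a (tag j) <= x j.
    exact: (@path_le_nth _ _ 0%N _ (pth _) (leq0n _) (ltnW (ltn_ord (tagged j)))).
  have [h|h] := dis _ _ ii'; [left|right].
    by apply: (le_trans (bx (existT _ i k))); apply: (le_trans h); exact: (ax (existT _ i' k')).
  by apply: (le_trans (bx (existT _ i' k'))); apply: (le_trans h); exact: (ax (existT _ i k)).
- apply: le_lt_trans lt; rewrite le_eqVlt; apply/orP; left; apply/eqP.
  transitivity (\sum_i \sum_(k < size (s i))
      (nth (a i) (a i :: s i) k.+1 - nth (a i) (a i :: s i) k)).
    by rewrite sig_big_dep.
  apply: eq_bigr => i _.
  rewrite -(big_mkord xpredT (fun k => nth (a i) (a i :: s i) k.+1 - nth (a i) (a i :: s i) k)).
  by rewrite telescope_sumr// lst.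
Qed.

Lemma ac_continuous f : ac f -> continuous f.
Proof.
move=> acf x; apply/cvgrPdist_lt => e e0; have [d d0 H] := acf e e0.
near=> y.
have xy : `|x - y| < d by near: y; apply: cvgr_dist_lt.
have := H 'I_1 (fun=> Num.min x y) (fun=> Num.max x y).
rewrite !big_ord1; have [le|le] := leP x y.
  rewrite distrC => H'; apply: H' => //.
    by move=> i j; rewrite !ord1.
  by apply: le_lt_trans xy; rewrite distrC ler_norm.
move=> H'; apply: H' => //; first by move=> _; rewrite ltW.
  by move=> i j; rewrite !ord1.
by apply: le_lt_trans xy; rewrite ler_norm.
Unshelve. all: by end_near. Qed.

(** With [eps = 1] the variation over an interval shorter than [d] is at most 1; bounded variation
    then propagates by steps of length [d / 2]. *)
Lemma ac_bv f a b : ac f -> a <= b -> bounded_variation a b f.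
Proof.
move=> acf ab; have [d d0 H] := ac_variation acf ltr01.
have loc x y : x <= y -> y - x < d -> bounded_variation x y f.
  move=> xy yxd; exists 1 => _ [s ps <-]; apply: ltW.
  have := H 'I_1 (fun=> x) (fun=> y) (fun=> s); rewrite !big_ord1; apply => //.
  by move=> i j; rewrite !ord1.
have [n nP] : exists n : nat, b - a <= n%:R * (d / 2).
  exists (Num.truncn ((b - a) / (d/2))).+1; rewrite -ler_pdivrMr ?divr_gt0//.
  by apply: ltW; rewrite truncnS_gt.
elim: n a ab nP => [|n IH] a ab nP.
  by apply: loc => //; apply: (le_lt_trans nP); rewrite mul0r.
have [h|h] := leP b (a + d / 2).
  by apply: loc => //; lra.
apply/bounded_variationP => //.
have aad : a <= a + d/2 by lra.
rewrite (total_variationD _ aad (ltW h)) fin_numD; apply/andP; split.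
  by apply/bounded_variationP => //; apply: loc; lra.
apply/(bounded_variationP _ (ltW h)); apply: IH; first exact: ltW.
by move: nP; rewrite -natr1; lra.
Qed.

(** An increment of the variation function is the variation over the subinterval, a supremum of sums
    that [ac_variation] bounds. *)
Lemma ac_total_variation f : ac f ->
  ac (fun t => fine (TV 0 (Num.max t 0) f)).
Proof.
move=> acf eps e0.
have e20 : 0 < eps / 2 by lra.
have [d d0 H] := ac_variation acf e20; exists d => // I a b ab dis lt.
pose a' i := Num.max (a i) 0; pose b' i := Num.max (b i) 0.
have ab' i : a' i <= b' i by rewrite /a' /b' ge_max !le_max ab lexx orbT.
have a'0 i : 0 <= a' i by rewrite /a' le_max lexx orbT.
have tvfin x y : x <= y -> TV x y f \is a fin_num.
  by move=> xy; apply/bounded_variationP => //; exact: ac_bv.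
have E i : `|fine (TV 0 (b' i) f) - fine (TV 0 (a' i) f)| = fine (TV (a' i) (b' i) f).
  rewrite (total_variationD _ (a'0 i) (ab' i)) fineD ?tvfin//.
  rewrite addrAC subrr add0r ger0_norm// fine_ge0// total_variation_ge0//.
under eq_bigr do rewrite E.
suff : \sum_i fine (TV (a' i) (b' i) f) <= eps / 2 by lra.
apply/ler_addgt0Pr => e1 e10.
(* A loss of [c] per interval amounts to at most [e1] in all; the successor covers an empty
   family. *)
pose c := e1 / (#|I|.+1)%:R.
have c0 : 0 < c by rewrite divr_gt0.
have {}E i : exists s, itv_partition (a' i) (b' i) s /\
    fine (TV (a' i) (b' i) f) - c <= variation (a' i) (b' i) f s.
  have := ub_ereal_sup_adherent c0 (tvfin _ _ (ab' i)).
  move=> [_ [_ [s ps <-] <-]]; rewrite -/(TV _ _ _).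
  rewrite -(fineK (tvfin _ _ (ab' i))) -EFinB lte_fin => /ltW ?.
  by exists s.
have [s sP] := choice E.
have : \sum_i variation (a' i) (b' i) f (s i) < eps / 2.
  apply: H.
  - by move=> i; case: (sP i).
  - move=> i j ij; rewrite /a' /b'.
    by have [h|h] := dis _ _ ij; [left|right]; rewrite ge_max !le_max h lexx orbT.
  - apply: le_lt_trans lt; apply: ler_sum => i _; rewrite /a' /b'.
    have := ab i; have [] := leP (a i) 0; have [] := leP (b i) 0; lra.
have : \sum_i (fine (TV (a' i) (b' i) f) - c) <= \sum_i variation (a' i) (b' i) f (s i).
  by apply: ler_sum => i _; case: (sP i).
rewrite big_split/= sumr_const.
have : c *+ #|I| <= e1.
  rewrite -mulr_natr /c mulrAC ler_pdivrMr// ler_pM2l// ler_nat//.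
by rewrite mulNrn; lra.
Qed.

(* Degenerate intervals may lie inside other intervals of the family. *)
Lemma ac_strict (f : R -> R) : ac f -> forall eps : R, 0 < eps -> exists2 delta : R, 0 < delta &
  forall (I : finType) (a b : I -> R), (forall i, a i <= b i) ->
    (forall i j, i != j -> a i < b i -> a j < b j -> b i <= a j \/ b j <= a i) ->
    \sum_i (b i - a i) < delta -> \sum_i `|f (b i) - f (a i)| < eps.
Proof.
move=> acf e /acf[d d0 H]; exists d => // I a b ab dis lt.
pose P : pred I := fun i => a i < b i.
have sumP (F : I -> R) : (forall i, a i = b i -> F i = 0) ->
    \sum_i F i = \sum_(j : {i : I | P i}) F (val j).
  move=> F0; rewrite (bigID P)/= [X in _ + X]big1 ?addr0; last first.
    by move=> i; rewrite /P -leNgt => ba; apply: F0; apply/le_anti; rewrite ab.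
  by rewrite (big_sub P).
rewrite sumP; last by move=> i ->; rewrite subrr normr0.
apply: H => [[i Pi]|[i Pi] [j Pj] ij|]; first exact: ltW.
  by apply: dis.
by rewrite -(sumP (fun i => b i - a i))// => i ->; rewrite subrr.
Qed.

Lemma lebesgue_measure_oo (a b : R) : a <= b -> mu `]a, b[%classic = (b - a)%:E.
Proof.
move=> ab; rewrite lebesgue_measure_itv/= lte_fin -EFinB.
by case: ltP => // ba; congr (_%:E); lra.
Qed.

(** Two points of an interval are at distance at most its measure, so that a finite measure bounds
    it. *)
Lemma open_interval_oo (I : set R) : open I -> is_interval I ->
  (mu I < +oo)%E -> exists a b, a <= b /\ I = `]a, b[%classic.
Proof.
move=> oI iI Ifin; have [->|/set0P[x0 Ix0]] := eqVneq I set0.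
  by exists 0, 0; rewrite lexx set_itvoo0.
have mI : measurable I by exact: open_measurable.
have dist x y : I x -> I y -> y - x <= fine (mu I).
  move=> Ix Iy; have [xy|yx] := ltP x y; last first.
    by rewrite (@le_trans _ _ 0) ?subr_le0// fine_ge0.
  have sub : `]x, y[%classic `<=` I.
    by move=> z /=; rewrite in_itv/= => /andP[xz zy]; apply: (iI x y) => //; rewrite !ltW.
  have h : (mu `]x, y[%classic <= mu I)%E by apply: le_measure; rewrite ?inE.
  move: h; rewrite (lebesgue_measure_oo (ltW xy)) => h.
  by rewrite -lee_fin fineK// ge0_fin_numE.
have ub : has_ubound I.
  by exists (x0 + fine (mu I)) => y Iy; have := dist _ _ Ix0 Iy; lra.
have lb : has_lbound I.
  by exists (x0 - fine (mu I)) => y Iy; have := dist _ _ Iy Ix0; lra.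
exists (inf I), (sup I); split.
  by rewrite (@le_trans _ _ x0)//; [exact: ge_inf|exact: ub_le_sup].
have := interval_bounded_interior iI lb ub.
by rewrite (interior_id _).1// set_itvoo.
Qed.

Lemma stieltjes_itv_oc (F : cumulative R R) a b : a <= b ->
  lebesgue_stieltjes_measure F `]a, b]%classic = (F b - F a)%:E.
Proof.
move=> ab; rewrite /lebesgue_stieltjes_measure /measure_extension/=.
by rewrite measurable_mu_extE//= ?wlength_itv_bnd//; exact: is_ocitv.
Qed.

(** Outer regularity encloses the null set in an open set of small Lebesgue measure. Its components
    are disjoint intervals, and absolute continuity bounds the Stieltjes measure of finitely many of
    them by [e]. Components may be empty, hence [ac_strict]. *)
Lemma ac_null_measure (F : cumulative R R) (N : set R) : ac F ->
  measurable N -> mu N = 0%E -> lebesgue_stieltjes_measure F N = 0%E.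
Proof.
move=> acF mN N0; apply/eqP; rewrite eq_le measure_ge0 andbT.
apply/lee_addgt0Pr => e e0; rewrite add0e.
have [d d0 H] := ac_strict acF e0.
have Nfin : (mu N < +oo)%E by rewrite N0.
have [U [oU NU UN]] := lebesgue_regularity_outer mN Nfin d0.
have mU : measurable U by exact: open_measurable.
have muU : (mu U < d%:E)%E.
  rewrite -(setDUK NU) setUC measureU0//; exact: measurableD.
clear N0; set I := open_disjoint_itv oU.
have mI q : measurable (I q).
  by apply: open_measurable; exact: open_disjoint_itv_open.
have IU q : I q `<=` U.
  by move=> x Ix; rewrite (open_disjoint_itv_bigcup oU); exists q.
have tI : trivIset setT I by exact: open_disjoint_itv_trivIset.
have Ifin q : (mu (I q) < +oo)%E.
  apply: le_lt_trans (lt_trans muU (ltry _)).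
  by apply: le_measure; rewrite ?inE; [exact: mI|exact: mU|exact: IU].
have /choice[ab abP] q : exists ab : R * R, ab.1 <= ab.2 /\ I q = `]ab.1, ab.2[%classic.
  have [a [b [ab E]]] := open_interval_oo (@open_disjoint_itv_open _ _ oU q)
    (@open_disjoint_itv_is_interval _ _ oU q) (Ifin q).
  by exists (a, b).
have muI q : mu (I q) = ((ab q).2 - (ab q).1)%:E.
  by have [le ->] := abP q; rewrite lebesgue_measure_oo.
apply: (@le_trans _ _ (lebesgue_stieltjes_measure F U)).
  by apply: le_measure; rewrite ?inE.
have UI : U = \bigcup_q I q := open_disjoint_itv_bigcup oU.
rewrite UI measure_bigcup//; last by move=> q _; exact: mI.
apply: lime_le; first exact: is_cvg_nneseries.
near=> n.
apply: (@le_trans _ _ (\sum_(i < n) (F (ab i).2 - F (ab i).1)%:E)%E).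
  rewrite big_mkcond big_mkord; apply: lee_sum => i _.
  rewrite in_setT -stieltjes_itv_oc; last by case: (abP i).
  apply: le_measure; rewrite ?inE//; first exact: mI.
  by have [_ ->] := abP i; exact: subset_itv_oo_oc.
rewrite sumEFin lee_fin; apply: ltW.
apply: (@le_lt_trans _ _ (\sum_(i < n) `|F (ab i).2 - F (ab i).1|)).
  by apply: ler_sum => i _; exact: ler_norm.
apply: H => [i|i j ij ai aj|]; first by case: (abP i).
- have [_ ei] := abP i; have [_ ej] := abP j.
  have [?|h1] := leP (ab i).2 (ab j).1; first by left.
  have [?|h2] := leP (ab j).2 (ab i).1; first by right.
  exfalso; have /trivIsetP/(_ i j Logic.I Logic.I ij) := tI; rewrite ei ej.
  move=> /seteqP[+ _].
  set c := Num.max (ab i).1 (ab j).1; set c' := Num.min (ab i).2 (ab j).2.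
  have cc' : c < c' by rewrite /c /c' gt_max !lt_min ai aj h1 h2.
  move=> /(_ ((c + c') / 2)); case; split; rewrite /= in_itv/=.
    have : (ab i).1 <= c by rewrite le_max lexx.
    have : c' <= (ab i).2 by rewrite ge_min lexx.
    by lra.
  have : (ab j).1 <= c by rewrite le_max lexx orbT.
  have : c' <= (ab j).2 by rewrite ge_min lexx orbT.
  by lra.
- rewrite -lte_fin -sumEFin; under eq_bigr do rewrite -muI.
  apply: le_lt_trans muU.
  suff : (\sum_(i < n) mu (I i) <= mu U)%E by [].
  rewrite -(measure_bigsetU mu mI tI).
  have mJ : measurable (\big[setU/set0]_(i < n) I i).
    by apply: bigsetU_measurable => i _; exact: mI.
  apply: le_measure; rewrite ?inE; [exact: mJ|exact: mU|].
  by rewrite -bigcup_mkord; apply: bigcup_sub => q _; exact: IU.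
Unshelve. all: by end_near. Qed.

(** Radon-Nikodym for the Stieltjes measure of [F], restricted to []0, T]] to make it finite. *)
Lemma ac_nondecreasing_density (F : R -> R) (T : R) : 0 <= T -> ac F -> nondecreasing F ->
  exists g : R -> \bar R, [/\ forall x, (0 <= g x)%E, forall x, g x \is a fin_num,
    mu.-integrable setT g &
    forall a b, 0 <= a -> a <= b -> b <= T ->
      (F b - F a)%:E = (\int[mu]_(x in `]a, b]) g x)%E].
Proof.
move=> T0 acF ndF.
have rcF : right_continuous F by apply: right_continuousW; exact: ac_continuous.
pose H := isCumulative.Build R _ R F ndF rcF.
pose G : cumulative R R := HB.pack F H.
pose nu0 : {measure set (measurableTypeR R) -> \bar R} := lebesgue_stieltjes_measure G.
have mT : measurable (`]0, T]%classic : set (measurableTypeR R)) by exact: measurable_itv.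
have finT : (nu0 `]0%R, T]%classic < +oo)%E.
  by have -> : nu0 `]0, T]%classic = (G T - G 0)%:E; [exact: stieltjes_itv_oc|exact: ltry].
pose nu : {finite_measure set _ -> \bar R} := mfrestr mT finT.
have ac_nu : nu `<< mu.
  apply/null_content_dominatesP => A mA A0.
  rewrite /nu /mfrestr /mrestr/=; apply/eqP; rewrite eq_le measure_ge0 andbT.
  rewrite -[leRHS](@ac_null_measure G A acF mA A0).
  by apply: le_measure; rewrite ?inE//; exact: measurableI.
have [g [g0 gfin gint gE]] := radon_nikodym_sigma_finite ac_nu.
exists g; split => // a b a0 ab bT.
rewrite -gE//= /mfrestr /mrestr/= setIidl; last first.
  by move=> x /=; rewrite !in_itv/= => /andP[ax xb]; apply/andP; split; lra.
by rewrite -[LHS](@stieltjes_itv_oc G).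
Qed.

Lemma acB (f g : R -> R) : ac f -> ac g -> ac (fun t => f t - g t).
Proof.
move=> acf acg e e0; have e2 : 0 < e / 2 by lra.
have [d1 d10 H1] := acf _ e2; have [d2 d20 H2] := acg _ e2.
exists (Num.min d1 d2); first by rewrite lt_min d10.
move=> I a b ab dis; rewrite lt_min => /andP[lt1 lt2].
have := H1 I a b ab dis lt1; have := H2 I a b ab dis lt2.
suff : \sum_i `|f (b i) - g (b i) - (f (a i) - g (a i))| <=
   \sum_i `|f (b i) - f (a i)| + \sum_i `|g (b i) - g (a i)| by lra.
rewrite -big_split/=; apply: ler_sum => i _.
rewrite -[`|g _ - _|]normrN (le_trans _ (ler_normD _ _))//.
by rewrite le_eqVlt; apply/orP; left; apply/eqP; congr (`| _ |); ring.
Qed.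

Lemma ac_comp (f h : R -> R) : ac f -> nondecreasing h ->
  (forall x y, x <= y -> h y - h x <= y - x) -> ac (f \o h).
Proof.
move=> acf ndh hh e /acf[d d0 H]; exists d => // I a b ab dis lt.
apply: H => [i|i j ij|]; first exact: ndh.
  by have [?|?] := dis _ _ ij; [left|right]; exact: ndh.
by apply: le_lt_trans lt; apply: ler_sum => i _; exact: hh.
Qed.

(** Jordan decomposition: [f] is the difference of its variation function [V] and of [V - f], both
    nondecreasing and absolutely continuous, so that each has a density. Lebesgue differentiation
    then identifies the derivative. *)
Theorem ac_fundamental (f : R -> R) (T : R) : 0 < T -> ac f ->
  exists g : R -> R, [/\ mu.-integrable setT (EFin \o g),
    forall a b, 0 <= a -> a <= b -> b <= T ->
      (f b - f a)%:E = (\int[mu]_(x in `[a, b]) (g x)%:E)%E &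
    {ae mu, forall t, 0 < t < T -> derivable f t 1 /\ derive1 f t = g t}].
Proof.
move=> T0 acf.
(* Freezing time at 0 makes [V] and [f \o m] constant on the negative half-line: monotonicity then
   holds on the whole line, as Stieltjes measures require. *)
pose m (t : R) := Num.max t 0.
have ndm : nondecreasing m.
  by move=> x y xy; rewrite /m ge_max !le_max xy lexx orbT.
have mm (x y : R) : x <= y -> m y - m x <= y - x.
  by move=> xy; rewrite /m; have [] := leP x 0; have [] := leP y 0; lra.
have m0 t : 0 <= m t by rewrite le_max lexx orbT.
have mid t : 0 <= t -> m t = t by move=> t0; exact: max_l.
have tvfin x y : x <= y -> TV x y f \is a fin_num.
  by move=> xy; apply/bounded_variationP => //; exact: ac_bv.
pose V t := fine (TV 0 (m t) f).
have Vd x y : x <= y -> V y - V x = fine (TV (m x) (m y) f).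
  move=> xy; rewrite /V (total_variationD _ (m0 x) (ndm _ _ xy)) fineD ?tvfin ?ndm//.
  by rewrite addrAC subrr add0r.
have ndV : nondecreasing V.
  by move=> x y xy; rewrite -subr_ge0 Vd// fine_ge0// total_variation_ge0// ndm.
have ndW : nondecreasing (fun t => V t - (f \o m) t).
  move=> x y xy; rewrite -subr_ge0.
  suff : f (m y) - f (m x) <= V y - V x by rewrite /=; lra.
  rewrite Vd// (le_trans (ler_norm _))// -lee_fin fineK ?tvfin ?ndm//.
  by apply: total_variation_ge; exact: ndm.
have acW := acB (ac_total_variation acf) (ac_comp acf ndm mm).
have [g1 [g10 g1fin intg1 E1]] :=
  ac_nondecreasing_density (ltW T0) (ac_total_variation acf) ndV.
have [g2 [g20 g2fin intg2 E2]] := ac_nondecreasing_density (ltW T0) acW ndW.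
pose g x := fine (g1 x) - fine (g2 x).
have gE : EFin \o g = (g1 \- g2)%E.
  by apply/funext => x; rewrite /= /g EFinB !fineK.
have intg : mu.-integrable setT (EFin \o g) by rewrite gE; exact: integrableB.
have mg : measurable_fun setT g by apply/measurable_EFinP; exact: measurable_int intg.
have ftc a b : 0 <= a -> a <= b -> b <= T ->
      (f b - f a)%:E = (\int[mu]_(x in `[a, b]) (g x)%:E)%E.
  move=> a0 ab bT.
  rewrite -integral_itv_obnd_cbnd; last first.
    by apply/measurable_EFinP; apply: measurable_funS mg.
  transitivity (\int[mu]_(x in `]a, b]) (g1 x - g2 x))%E; last first.
    by apply: eq_integral => x _; rewrite -[RHS]/((EFin \o g) x) gE.
  rewrite integralB//; [|exact: integrableS intg1|exact: integrableS intg2].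
  rewrite -E1// -E2// -EFinB; congr (_%:E).
  by rewrite /= !mid//; [ring|exact: le_trans ab].
exists g; split => //.
have H1 y : mu.-integrable [set` Interval (BLeft 0) (BRight y)] (EFin \o g).
  exact: integrableS intg.
have H2 : locally_integrable [set: R] g.
  by have := integrable_locally measurableT intg; rewrite patch_setT.
have := FTC1 H1 H2; apply: filterS; first exact: (ae_filter_ringOfSetsType mu).
move=> t Ht /andP[t0 tT].
have [|dF dE] := Ht; first by rewrite /= lte_fin.
set G := (fun x : R => _) in dF dE.
have near_eq : \near t, G t + f 0 = f t.
  near=> x.
  have x0 : 0 <= x.
    by rewrite ltW//; near: x; exact: lt_nbhsr.
  have xT : x <= T.
    by rewrite ltW//; near: x; exact: lt_nbhsl.
  rewrite /G /Rintegral -ftc//=; ring.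
have H : is_derive t 1 (fun x => G x + f 0) (g t).
  rewrite -dE derive1E -[X in is_derive _ _ _ X]addr0.
  by apply: is_deriveD; apply/derivableP.
have near_eq' : {near t, (fun x => G x + f 0) =1 f} by exact: near_eq.
split; first by apply: (near_eq_derivable near_eq'); exact: ex_derive.
by rewrite derive1E -(@near_eq_derive _ _ _ (fun x => G x + f 0) f)// derive_val.
Unshelve. all: by end_near. Qed.
End AC.

From mathcomp Require Import finmap.

(** * Tubes around a path and the Markov property *)

Section induction.
Context d (Z : measurableType d) (R : realType).
Import HBNNSimple.

(** A nonnegative measurable function is an increasing limit of simple functions, themselves finite
    sums of scaled indicators. *)
Lemma ge0_measurable_fun_ind (Q : (Z -> \bar R) -> Prop) :
  (forall A, measurable A -> Q (fun z => (\1_A z)%:E)) ->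
  (forall f g, (forall z, (0 <= f z)%E) -> (forall z, (0 <= g z)%E) ->
     measurable_fun setT f -> measurable_fun setT g ->
     Q f -> Q g -> Q (fun z => f z + g z)%E) ->
  (forall (r : R) f, 0 <= r -> (forall z, (0 <= f z)%E) -> measurable_fun setT f ->
     Q f -> Q (fun z => r%:E * f z)%E) ->
  (forall (f : nat -> Z -> \bar R), (forall n z, (0 <= f n z)%E) ->
     (forall n, measurable_fun setT (f n)) ->
     (forall z, nondecreasing_seq (f ^~ z)) ->
     (forall n, Q (f n)) -> Q (fun z => limn (f ^~ z))) ->
  forall f, (forall z, (0 <= f z)%E) -> measurable_fun setT f -> Q f.
Proof.
move=> Qi QD Qm Ql f f0 mf; pose f_ := nnsfun_approx measurableT mf.
have -> : f = fun z => limn (fun n => (f_ n z)%:E).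
  by apply/funext => z; apply/esym/cvg_lim => //; exact: cvg_nnsfun_approx.
apply: Ql => [n z|n|z a b ab|n].
- by rewrite lee_fin.
- exact/measurable_EFinP.
- by rewrite lee_fin; exact/lefP/nd_nnsfun_approx.
move: (f_ n) => h {f_ n}.
have -> : (fun z => (h z)%:E) =
    (fun z => \sum_(y <- fset_set (range h)) (y * \1_(h @^-1` [set y]) z)%:E)%E.
  by apply/funext => z; rewrite fimfunE -fsumEFin// fsbig_finite.
have : forall y, y \in finmap.enum_fset (fset_set (range h)) -> 0 <= y.
  move=> y; rewrite -[_ \in _]/(y \in fset_set (range h)); rewrite in_fset_set// => /set_mem[z _ <-]; exact: fun_ge0.
elim: (finmap.enum_fset _) => [_|y s IH s0].
  rewrite (_ : (fun z => _) = (fun z => (\1_(@set0 Z) z)%:E)); last first.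
    by apply/funext => z; rewrite big_nil indic0.
  exact: Qi.
rewrite (_ : (fun z => _) = fun z => (y%:E * (\1_(h @^-1` [set y]) z)%:E +
    \sum_(y <- s) (y * \1_(h @^-1` [set y]) z)%:E)%E); last first.
  by apply/funext => z; rewrite big_cons EFinM.
have y0 : 0 <= y by apply: s0; rewrite mem_head.
have s0' : forall y, y \in s -> 0 <= y by move=> x xs; apply: s0; rewrite in_cons xs orbT.
have mi (x : R) : measurable_fun setT (fun z => (\1_(h @^-1` [set x]) z)%:E : \bar R).
  by apply/measurable_EFinP; exact: measurable_indic.
apply: QD.
- by move=> z; rewrite -EFinM lee_fin mulr_ge0.
- by move=> z; rewrite big_seq; apply: sume_ge0 => x xs; rewrite lee_fin mulr_ge0// s0'.
- exact: measurable_funeM.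
- apply: emeasurable_sum => x; under eq_fun do rewrite EFinM.
  exact: measurable_funeM.
- by apply: Qm => //; exact: Qi.
- exact: IH.
Qed.
End induction.

(** Extends the kernel identity from indicators to nonnegative functions by the preceding induction;
    it turns the Markov property for events into one for integrals. *)
Lemma integral_mixture d1 d2 (W : measurableType d1) (Z : measurableType d2)
  (R : realType) (m : {measure set W -> \bar R}) (G : set W) (Y : W -> Z)
  (K : W -> {measure set Z -> \bar R}) (f : Z -> \bar R) :
  measurable G -> measurable_fun setT Y ->
  (forall U, measurable U -> measurable_fun setT (K ^~ U)) ->
  (forall A, measurable A -> m (G `&` Y @^-1` A) = (\int[m]_(w in G) K w A)%E) ->
  (forall z, (0 <= f z)%E) -> measurable_fun setT f ->
  (\int[m]_(w in G) f (Y w) = \int[m]_(w in G) \int[K w]_z f z)%E.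
Proof.
move=> mG mY mK HK.
have mi (g : Z -> \bar R) : (forall z, (0 <= g z)%E) -> measurable_fun setT g ->
    measurable_fun G (fun w => \int[K w]_z g z)%E.
  by move=> g0 mg; apply: measurable_funTS; exact: measurable_fun_integral_kernel.
have mX (g : Z -> \bar R) : measurable_fun setT g -> measurable_fun G (fun w => g (Y w)).
  by move=> mg; apply: measurable_funTS; exact: (measurableT_comp mg mY).
move: f; apply: ge0_measurable_fun_ind => [A mA|f g f0 g0 mf mg Ef Eg|r f r0 f0 mf Ef|f f0 mf ndf Ef].
- transitivity (m (G `&` Y @^-1` A)).
    rewrite (_ : (fun w => _) = (fun w => (\1_(Y @^-1` A) w)%:E)) //.
    by rewrite integral_indic// 1?setIC// -[X in measurable X]setTI; exact: mY.
  rewrite HK//.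
  by apply: eq_integral => w _; rewrite integral_indic// setIT.
- rewrite (ge0_integralD m mG (fun w _ => f0 (Y w)) (mX _ mf) (fun w _ => g0 (Y w)) (mX _ mg)).
  rewrite Ef Eg -(ge0_integralD m mG _ (mi _ f0 mf) _ (mi _ g0 mg)); last 2 first.
    by move=> w _; exact: integral_ge0.
    by move=> w _; exact: integral_ge0.
  by apply: eq_integral => w _; rewrite ge0_integralD.
- rewrite (ge0_integralZl m mG (mX _ mf) (fun w _ => f0 (Y w)))//.
  rewrite Ef -ge0_integralZl//; last 2 first.
  + exact: mi.
  + by move=> w _; exact: integral_ge0.
  by apply: eq_integral => w _; rewrite ge0_integralZl.
- rewrite monotone_convergence//; last by move=> n; exact: mX.
  under eq_fun do rewrite Ef.
  rewrite -monotone_convergence//; last 3 first.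
  + by move=> n; exact: mi.
  + by move=> n w _; exact: integral_ge0.
  + by move=> w _ a b ab; apply: ge0_le_integral => // z _; exact: ndf.
  by apply: eq_integral => w _; rewrite -monotone_convergence.
Qed.

Section Markov.
Variables (R : realType) (N : nat) (d : measure_display).
Variables (Omega : measurableType d) (E : set 'rV[R]_N).
Variables (P : 'rV[R]_N -> probability Omega R).
Variables (k : R -> R.-pker (borel_rV R N) ~> (borel_rV R N)).
Variables (X : 'rV[R]_N -> R -> Omega -> 'rV[R]_N).
Hypothesis mp : markov_process E P k X.

Lemma measurable_closed_ball (c : 'rV[R]_N) (r : R) : 0 < r ->
  measurable ([set y | `|y - c| <= r] : set (borel_rV R N)).
Proof.
move=> r0; rewrite -[X in measurable X]setCK; apply: measurableC.
apply: sub_sigma_algebra; rewrite openC.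
rewrite (_ : [set _ | _] = closed_ball c r); first exact: closed_ball_closed.
by rewrite closed_ballE//; apply/seteqP; split => y; rewrite /closed_ball_/= distrC.
Qed.

Lemma past_measurable x s G : E x -> past (X x) s G -> measurable G.
Proof.
move=> Ex; apply: smallest_sub; first exact: sigma_algebra_measurable.
move=> A [u]; rewrite /= in_itv/= => /andP[u0 _] [B mB <-].
exact: (mp_meas mp Ex u0).
Qed.

Lemma past_sub (x : 'rV[R]_N) s s' : s <= s' -> past (X x) s `<=` past (X x) s'.
Proof.
move=> ss'; apply: sub_smallest2r; first exact: smallest_sigma_algebra.
move=> A [u us Au]; exists u => //; move: us; rewrite /= !in_itv/= => /andP[-> us].
exact: le_trans ss'.
Qed.

Lemma past_preimage (x : 'rV[R]_N) s u (A : set (borel_rV R N)) : 0 <= u <= s ->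
  measurable A -> past (X x) s (X x u @^-1` A).
Proof.
move=> us mA; apply: sub_sigma_algebra; exists u; first by rewrite /= in_itv/=.
by exists A => //; rewrite setTI.
Qed.

Lemma past_setI (x : 'rV[R]_N) s A B :
  past (X x) s A -> past (X x) s B -> past (X x) s (A `&` B).
Proof.
rewrite /past; set gen := (X in <<s X >>).
exact: (@measurableI _ (g_sigma_algebraType gen) A B).
Qed.

Lemma past_bigcap (x : 'rV[R]_N) s (A : nat -> set Omega) :
  (forall n, past (X x) s (A n)) -> past (X x) s (\bigcap_n A n).
Proof.
rewrite /past; set gen := (X in <<s X >>).
exact: (@bigcapT_measurable _ (g_sigma_algebraType gen) A).
Qed.

Lemma markov_integral x s t G (f : borel_rV R N -> \bar R) :
  E x -> 0 <= s -> 0 <= t -> past (X x) s G ->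
  (forall z, (0 <= f z)%E) -> measurable_fun setT f ->
  (\int[P x]_(w in G) f (X x (s + t) w) =
   \int[P x]_(w in G) \int[k t (X x s w)]_z f z)%E.
Proof.
move=> Ex s0 t0 pG f0 mf.
apply: (@integral_mixture _ _ _ _ _ (P x) G (X x (s + t) : Omega -> borel_rV R N)
  (fun w => k t (X x s w)) f) => //.
- exact: past_measurable pG.
- by apply: (mp_meas mp Ex); rewrite addr_ge0.
- move=> U mU; apply: (measurableT_comp (measurable_kernel (k t) U mU)).
  exact: (mp_meas mp Ex s0).
- by move=> A mA; exact: (mp_markov mp Ex s0 t0 pG mA).
Qed.

(** The first time is split off and the path shifted, so that each unfolding is one use of the
    Markov property. *)
Fixpoint grid_tube (n : nat) (h r : R) (c : nat -> 'rV[R]_N) (u : R -> 'rV[R]_N) : Prop :=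
  `|u 0 - c 0%N| <= r /\
  if n is n'.+1 then grid_tube n' h r (c \o succn) (fun t => u (h + t)) else True.

Lemma grid_tubeP n h r c u :
  grid_tube n h r c u <-> (forall j, (j <= n)%N -> `|u (j%:R * h) - c j| <= r).
Proof.
elim: n c u => [|n IH] c u /=.
  split=> [[H _] j|H]; last by split=> //; have := H 0%N isT; rewrite mul0r.
  by rewrite leqn0 => /eqP ->; rewrite mul0r.
split=> [[H0 /IH H] [_|j jn]|H]; first by rewrite mul0r.
  by rewrite (_ : j.+1%:R * h = h + j%:R * h); [exact: H|rewrite -natr1; ring].
split; first by have := H 0%N isT; rewrite mul0r.
by apply/IH => j jn /=; have := H j.+1 jn; rewrite -natr1 mulrDl mul1r [h + _]addrC.
Qed.

Lemma past_grid_tube n h r c x s s' : 0 <= h -> 0 < r -> 0 <= s ->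
  s + n%:R * h <= s' ->
  past (X x) s' [set w | grid_tube n h r c (fun t => X x (s + t) w)].
Proof.
move=> h0 r0 s0 hs.
rewrite (_ : [set _ | _] = \bigcap_(j in [set j | (j <= n)%N])
   (X x (s + j%:R * h) @^-1` [set y | `|y - c j| <= r])); last first.
  apply/seteqP; split => w /=; first by move=> /grid_tubeP H j; exact: H.
  by move=> H; apply/grid_tubeP => j; exact: H.
rewrite bigcap_mkcond; apply: past_bigcap => j; case: ifPn => jn; last first.
  rewrite /past; set gen := (X in <<s X >>).
  exact: (@measurableT _ (g_sigma_algebraType gen)).
apply: past_preimage; last exact: measurable_closed_ball.
move: jn => /set_mem/= jn; apply/andP; split; first by rewrite addr_ge0// mulr_ge0.
by apply: le_trans hs; rewrite lerD2l ler_wpM2r// ler_nat.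
Qed.

(** [Q] is built by backward recursion: the indicator of the current ball times the average of the
    next [Q] under [k h]. Coming from the kernel, it is measurable in the state, which is not known
    of [P] itself. *)
Lemma markov_grid_tube n h r c : 0 <= h -> 0 < r ->
  exists Q : borel_rV R N -> \bar R,
    [/\ measurable_fun setT Q, forall y, (0 <= Q y)%E &
    forall x s, E x -> 0 <= s -> forall G, past (X x) s G ->
      P x (G `&` [set w | grid_tube n h r c (fun t => X x (s + t) w)]) =
      (\int[P x]_(w in G) Q (X x s w))%E].
Proof.
move=> h0 r0; elim: n c => [|n IH] c.
  pose B : set (borel_rV R N) := [set y | `|y - c 0%N| <= r].
  have mB : measurable B by exact: measurable_closed_ball.
  exists (fun y => (\1_B y)%:E); split => [|y|x s Ex s0 G pG].
  - by apply/measurable_EFinP; exact: measurable_indic.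
  - by rewrite lee_fin.
  have mG := past_measurable Ex pG.
  rewrite (_ : (fun w => _) = (fun w => (\1_(X x s @^-1` B) w)%:E)) //.
  rewrite integral_indic//; last first.
    by rewrite -[X in measurable X]setTI; exact: (mp_meas mp Ex s0).
  rewrite setIC; congr (P x (_ `&` _)).
  by apply/seteqP; split => w /=; rewrite addr0 => // -[].
have [Q [mQ Q0 HQ]] := IH (c \o succn).
pose B : set (borel_rV R N) := [set y | `|y - c 0%N| <= r].
have mB : measurable B by exact: measurable_closed_ball.
pose K y := (\int[k h y]_z Q z)%E.
have mK : measurable_fun setT K.
  by apply: measurable_fun_integral_kernel => // U mU; exact: measurable_kernel.
have K0 y : (0 <= K y)%E by exact: integral_ge0.
exists (K \_ B); split => [|y|x s Ex s0 G pG].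
- exact/(measurable_restrictT _ mB)/measurable_funTS.
- exact: erestrict_ge0.
have mG := past_measurable Ex pG.
have pB : past (X x) s (X x s @^-1` B).
  by apply: past_preimage; rewrite ?s0/=.
have sh : 0 <= s + h by rewrite addr_ge0.
have pGB := past_setI pG pB.
have ssh : s <= s + h by rewrite lerDl.
transitivity (P x (G `&` X x s @^-1` B `&`
   [set w | grid_tube n h r (c \o succn) (fun t => X x (s + h + t) w)])).
  congr (P x _); rewrite -setIA; congr (_ `&` _).
  apply/seteqP; split => w /=; rewrite addr0 => -[H1 H2]; split => //.
    by move: H2; under eq_fun do rewrite addrA.
  by under eq_fun do rewrite addrA.
rewrite HQ//; last exact: past_sub pGB.
rewrite (markov_integral Ex s0 h0 pGB Q0 mQ).
by rewrite -/K integral_mkcondr; apply: eq_integral => w _; rewrite /patch; case: ifP.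
Qed.

(** Closed, unlike [tube]: a weak inequality at dyadic times passes to all times by
    right-continuity. *)
Definition ctube (S r : R) (f u : R -> 'rV[R]_N) : Prop :=
  forall t, 0 <= t <= S -> `|u t - f t| <= r.

(** The final time is left out: it belongs to every dyadic grid. *)
Definition rcont (S : R) (f : R -> 'rV[R]_N) : Prop :=
  forall t, 0 <= t < S -> f s @[s --> t^'+] --> f t.

Definition dyadic_tube S r (f u : R -> 'rV[R]_N) (m : nat) : Prop :=
  grid_tube (2 ^ m) (S / (2 ^ m)%:R) r (fun j => f (j%:R * (S / (2 ^ m)%:R))) u.

(** A violation at a time before [S] persists on an interval to the right of it, which contains a
    dyadic time. *)
Lemma ctube_dyadic S r f u : 0 <= S -> rcont S f -> rcont S u ->
  ctube S r f u <-> forall m, dyadic_tube S r f u m.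
Proof.
move=> S0 rf ru; split=> [H m|H t].
  apply/grid_tubeP => j jm; apply: H.
  have m0 : 0 < (2 ^ m)%:R :> R by rewrite ltr0n expn_gt0.
  apply/andP; split; first by rewrite mulr_ge0// divr_ge0.
  by rewrite mulrCA ler_piMr// ler_pdivrMr// mul1r ler_nat.
have {}H m j : (j <= 2 ^ m)%N ->
    `|u (j%:R * (S / (2 ^ m)%:R)) - f (j%:R * (S / (2 ^ m)%:R))| <= r.
  by move: j; apply/grid_tubeP; exact: H.
move=> /andP[t0]; rewrite le_eqVlt => /predU1P[->|tS].
  by have := H 0%N 1%N isT; rewrite expn0 divr1 mul1r.
rewrite leNgt; apply/negP => rt.
have cg : `|u s - f s| @[s --> t^'+] --> `|u t - f t|.
  by apply: cvg_norm; apply: cvgB; [apply: ru|apply: rf]; rewrite t0.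
have : \forall s \near t^'+, r < `|u s - f s|.
  exact: (cvgr_gt _ cg).
move=> [e /= e0 He].
pose a := Num.min e (S - t).
have a0 : 0 < a by rewrite lt_min e0 subr_gt0.
have S0' : 0 < S by lra.
have [m mP] : exists m : nat, S / (2 ^ m)%:R < a.
  exists (Num.truncn (S / a)).+1; rewrite ltr_pdivrMr ?ltr0n ?expn_gt0//.
  rewrite mulrC -ltr_pdivrMr// (lt_le_trans (truncnS_gt _))// ler_nat.
  exact/ltnW/ltn_expl.
pose h := S / (2 ^ m)%:R.
have m0 : 0 < (2 ^ m)%:R :> R by rewrite ltr0n expn_gt0.
have h0 : 0 < h by rewrite divr_gt0.
(* [j * h] is the first grid time after [t], at most [h] later. *)
pose j := (Num.truncn (t / h)).+1.
have jt : t < j%:R * h by rewrite -ltr_pdivrMr// truncnS_gt.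
have jt' : j%:R * h <= t + h.
  rewrite /j -natr1 mulrDl mul1r lerD2r -ler_pdivlMr//.
  by rewrite truncn_le// divr_ge0// ltW.
have ha : h < S - t /\ h < e by move: mP; rewrite -/h /a lt_min => /andP[].
have jm : (j <= 2 ^ m)%N.
  rewrite -(ler_nat R) -(ler_pM2r h0).
  by rewrite [X in _ <= X]mulrC /h divfK ?gt_eqF// -/h; lra.
have := He (j%:R * h); rewrite /= => /(_ _ jt).
have := H m j jm; rewrite -/h leNgt => /negP K1 K2; apply: K1; apply: K2.
by rewrite ltr_norml; apply/andP; split; lra.
Qed.

Lemma dyadic_tubeS S r f u m : dyadic_tube S r f u m.+1 -> dyadic_tube S r f u m.
Proof.
move=> /grid_tubeP H; apply/grid_tubeP => j jm.
have m0 : (2 ^ m)%:R != 0 :> R by rewrite pnatr_eq0 expn_eq0.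
have := H (2 * j)%N; rewrite expnS leq_mul2l/= => /(_ jm).
suff -> : (2 * j)%:R * (S / (2 * 2 ^ m)%:R) = j%:R * (S / (2 ^ m)%:R) by [].
by rewrite !natrM; field.
Qed.

Lemma rcontX x s S w : E x -> 0 <= s -> rcont S (fun t => X x (s + t) w).
Proof.
move=> Ex s0 t /andP[t0 _].
have [H _] := mp_cadlag mp Ex w.
have st : 0 <= s + t by rewrite addr_ge0.
apply: (@cvg_comp _ _ _ (fun t => s + t) (X x ^~ w) _ (s + t)^'+); last exact: H.
move=> A [e e0 He]; exists e => //= y ye ty; apply: He; last by rewrite ltrD2l.
by rewrite /= opprD addrACA subrr add0r.
Qed.

Section tube.
Variables (S r : R) (f : R -> 'rV[R]_N).
Hypotheses (S0 : 0 <= S) (r0 : 0 < r) (rf : rcont S f).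

Let tube_set x s := [set w | ctube S r f (fun t => X x (s + t) w)].
Let dset x s m := [set w | dyadic_tube S r f (fun t => X x (s + t) w) m].

Let tube_setE x s : E x -> 0 <= s -> tube_set x s = \bigcap_m dset x s m.
Proof.
move=> Ex s0; apply/seteqP; split => w /=.
  by move=> /(ctube_dyadic _ S0 rf (@rcontX x s S w Ex s0)) H m _; exact: H.
by move=> H; apply/(ctube_dyadic _ S0 rf (@rcontX x s S w Ex s0)) => m; exact: H.
Qed.

Let past_dset x s m : 0 <= s -> past (X x) (s + S) (dset x s m).
Proof.
move=> s0; have m0 : (2 ^ m)%:R != 0 :> R by rewrite pnatr_eq0 expn_eq0.
apply: past_grid_tube => //; first by rewrite divr_ge0.
by rewrite mulrC divfK.
Qed.

Lemma past_ctube x s : E x -> 0 <= s ->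
  past (X x) (s + S) [set w | ctube S r f (fun t => X x (s + t) w)].
Proof.
move=> Ex s0; rewrite -[X in past _ _ X]/(tube_set x s) tube_setE//.
by apply: past_bigcap => m; exact: past_dset.
Qed.

Lemma measurable_ctube x s : E x -> 0 <= s ->
  measurable [set w | ctube S r f (fun t => X x (s + t) w)].
Proof. by move=> Ex s0; apply: past_measurable (past_ctube Ex s0). Qed.

Let cvg_dset x s G : E x -> 0 <= s -> measurable G ->
  P x (G `&` dset x s m) @[m --> \oo] --> P x (G `&` tube_set x s).
Proof.
move=> Ex s0 mG; rewrite tube_setE//.
rewrite (_ : G `&` _ = \bigcap_m (G `&` dset x s m)); last first.
  by apply/seteqP; split => [w [Gw H] m _|w H]; split=> //; [exact: H|have [] := H 0%N I|move=> m _; have [] := H m I].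
have md m : measurable (dset x s m) by apply: (past_measurable Ex); exact: past_dset.
apply: nonincreasing_cvg_mu.
- by rewrite (le_lt_trans (probability_le1 _ _))// ?ltry//; exact: measurableI.
- by move=> m; exact: measurableI.
- by apply: bigcapT_measurable => m; exact: measurableI.
- apply/nonincreasing_seqP => m; apply/subsetPset; apply: setIS => w.
  exact: dyadic_tubeS.
Qed.

(** Limit of the identity for grids. The tube is the decreasing intersection of the dyadic tubes:
    one side converges by continuity of the measure from above, the other by dominated convergence.
    Measurability of the integrand is obtained along the way, as a limit. *)
Lemma markov_ctube x s G : E x -> 0 <= s -> past (X x) s G ->
  measurable_fun G (fun w => P (X x s w) [set w' | ctube S r f (X (X x s w) ^~ w')]) /\
  P x (G `&` [set w | ctube S r f (fun t => X x (s + t) w)]) =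
  (\int[P x]_(w in G) P (X x s w) [set w' | ctube S r f (X (X x s w) ^~ w')])%E.
Proof.
move=> Ex s0 pG; have mG := past_measurable Ex pG.
have /choice[Q QP] m := markov_grid_tube (2 ^ m) (fun j => f (j%:R * (S / (2 ^ m)%:R)))
  (divr_ge0 S0 (ler0n R (2 ^ m))) r0.
have QE y m : E y -> Q m y = P y (dset y 0 m).
  move=> Ey; have [_ Q0 /(_ y 0 Ey (lexx _) setT)] := QP m.
  rewrite setTI => ->; last first.
    rewrite /past; set gen := (X in <<s X >>).
    exact: (@measurableT _ (g_sigma_algebraType gen)).
  rewrite (eq_integral (fun=> Q m y)); last by move=> w _; rewrite (mp_init mp).
  by rewrite integral_cst// [X in (_ * X)%E]probability_setT mule1.
have EX w : E (X x s w) := mp_state mp Ex s0 w.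
have tE y : E y -> [set w' | ctube S r f (X y ^~ w')] = tube_set y 0.
  move=> _; rewrite /tube_set; apply/eq_set => w.
  suff -> : (fun t => X y (0 + t) w) = X y ^~ w by [].
  by apply/funext => t; rewrite add0r.
have mQ m : measurable_fun G (fun w => Q m (X x s w)).
  have [mq _ _] := QP m; apply: measurable_funTS.
  exact: (measurableT_comp mq (mp_meas mp Ex s0)).
have cQ w : G w -> Q m (X x s w) @[m --> \oo] -->
    P (X x s w) [set w' | ctube S r f (X (X x s w) ^~ w')].
  move=> _; rewrite tE//; under eq_fun do rewrite QE// -[dset _ _ _]setTI.
  by rewrite -[tube_set _ _]setTI; exact: cvg_dset.
have mF : measurable_fun G
    (fun w => P (X x s w) [set w' | ctube S r f (X (X x s w) ^~ w')]).
  exact: (emeasurable_fun_cvg _ _ mQ cQ).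
split => //.
have c1 := cvg_dset Ex s0 mG.
have ig : (P x).-integrable G (cst 1%E) by exact: finite_measure_integrable_cst.
have bnd : {ae P x, forall w m, G w -> (`|Q m (X x s w)| <= cst 1%E w)%E}.
  apply: aeW => w m Gw; have [_ Q0 _] := QP m; rewrite gee0_abs// QE//.
  by apply: probability_le1; apply: (past_measurable (EX w)); exact: past_dset.
have [_ _ c2] := dominated_convergence mG mQ mF (aeW _ cQ) ig bnd.
apply: (cvg_unique _ c1); first exact: ereal_hausdorff.
apply: cvg_trans c2; apply: near_eq_cvg; near=> m.
by have [_ _ HQ] := QP m; exact: esym (HQ x s Ex s0 G pG).
Unshelve. all: by end_near. Qed.

Lemma markov_ctube_le x s G (a : R) : E x -> 0 <= s -> past (X x) s G -> 0 <= a ->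
  (forall w, G w -> (P (X x s w) [set w' | ctube S r f (X (X x s w) ^~ w')] <= a%:E)%E) ->
  (P x (G `&` [set w | ctube S r f (fun t => X x (s + t) w)]) <= a%:E * P x G)%E.
Proof.
move=> Ex s0 pG a0 H; have [mF ->] := markov_ctube Ex s0 pG.
rewrite -integral_cst; last exact: past_measurable pG.
by apply: ge0_le_integral => //; exact: past_measurable pG.
Qed.

Lemma markov_ctube_ge x s G (a : R) : E x -> 0 <= s -> past (X x) s G -> 0 <= a ->
  (forall w, G w -> (a%:E <= P (X x s w) [set w' | ctube S r f (X (X x s w) ^~ w')])%E) ->
  (a%:E * P x G <= P x (G `&` [set w | ctube S r f (fun t => X x (s + t) w)]))%E.
Proof.
move=> Ex s0 pG a0 H; have [mF ->] := markov_ctube Ex s0 pG.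
rewrite -integral_cst; last exact: past_measurable pG.
by apply: ge0_le_integral => //; exact: past_measurable pG.
Qed.
End tube.

Lemma ctube_scale n S r f (u : R -> 'rV[R]_N) : (0 < n)%N ->
  ctube S r f (fun t => n%:R^-1 *: u (n%:R * t)) <->
  ctube (n%:R * S) (n%:R * r) (fun t => n%:R *: f (n%:R^-1 * t)) u.
Proof.
move=> n0; have n0' : 0 < n%:R :> R by rewrite ltr0n.
have nn : n%:R != 0 :> R by rewrite gt_eqF.
have eq (t : R) : `|u (n%:R * t) - n%:R *: f t| = n%:R * `|n%:R^-1 *: u (n%:R * t) - f t|.
  transitivity `|n%:R *: (n%:R^-1 *: u (n%:R * t) - f t)|.
    by rewrite scalerBr scalerA mulfV// scale1r.
  by rewrite normrZ ger0_norm.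
split=> H t /andP[t0 tS].
  have := H (n%:R^-1 * t); rewrite mulrA mulfV// mul1r => H'.
  have := eq (n%:R^-1 * t); rewrite mulrA mulfV// mul1r => ->.
  by rewrite ler_pM2l//; apply: H'; rewrite mulr_ge0 ?invr_ge0//= mulrC ler_pdivrMr// mulrC.
rewrite -(ler_pM2l n0') -eq.
have := H (n%:R * t); rewrite mulrA mulVf// mul1r; apply.
by rewrite mulr_ge0//= ler_pM2l.
Qed.

Lemma rcont_scale n S f : (0 < n)%N -> rcont S f ->
  rcont (n%:R * S) (fun t => n%:R *: f (n%:R^-1 * t) : 'rV[R]_N).
Proof.
move=> n0 rf t /andP[t0 tS]; have n0' : 0 < n%:R :> R by rewrite ltr0n.
apply: cvgZl_tmp.
apply: (@cvg_comp _ _ _ (fun t => n%:R^-1 * t) f _ (n%:R^-1 * t)^'+).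
  move=> A [e /= e0 He]; exists (n%:R * e) => /=; first by rewrite mulr_gt0.
  move=> y /= ye ty; apply: He => /=; last by rewrite ltr_pM2l// invr_gt0.
  by rewrite -mulrBr normrM gtr0_norm ?invr_gt0// mulrC ltr_pdivrMr// mulrC.
by apply: rf; rewrite mulr_ge0 ?invr_ge0//= mulrC ltr_pdivrMr// mulrC.
Qed.

Definition stube (T : R) (phi : R -> 'rV[R]_N) (delta : R) (n : nat) (z : 'rV[R]_N) :=
  [set w | ctube T delta phi (fun t => scaled_process X n z t w)].

Lemma scaled_spaceP n z : (0 < n)%N -> scaled_space E n z -> E (n%:R *: z).
Proof.
move=> n0 [x Ex <-]; rewrite scalerA mulfV ?scale1r//.
by rewrite pnatr_eq0 -lt0n.
Qed.

Lemma stubeE n T phi delta z : (0 < n)%N ->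
  stube T phi delta n z = [set w | ctube (n%:R * T) (n%:R * delta)
     (fun t => n%:R *: phi (n%:R^-1 * t)) (X (n%:R *: z) ^~ w)].
Proof.
move=> n0; apply/seteqP; split => w /=.
  by move/(ctube_scale T delta phi (X (n%:R *: z) ^~ w) n0).1.
by move/(ctube_scale T delta phi (X (n%:R *: z) ^~ w) n0).2.
Qed.

Section step.
Variables (n : nat) (n0 : (0 < n)%N) (S S' d1 d2 : R) (phi : R -> 'rV[R]_N).
Hypotheses (S0 : 0 <= S) (S0' : 0 <= S') (d10 : 0 < d1) (d20 : 0 < d2).
Hypotheses (r1 : rcont S phi) (r2 : rcont S' (fun t => phi (S + t))).
Variable (z : 'rV[R]_N).
Hypothesis Ez : scaled_space E n z.

Let step_set := stube S phi d1 n z `&`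
  [set w | ctube S' d2 (fun t => phi (S + t)) (fun t => scaled_process X n z (S + t) w)].

Let n0' : 0 < n%:R :> R. Proof. by rewrite ltr0n. Qed.
Let Ex : E (n%:R *: z). Proof. exact: scaled_spaceP. Qed.
Let nS : 0 <= n%:R * S. Proof. by rewrite mulr_ge0. Qed.

Lemma past_stube : past (X (n%:R *: z)) (n%:R * S) (stube S phi d1 n z).
Proof.
rewrite stubeE//.
have := @past_ctube (n%:R * S) (n%:R * d1) _ nS _ (rcont_scale n0 r1) _ 0 Ex (lexx 0).
rewrite add0r => /(_ (mulr_gt0 n0' d10)).
suff -> : (fun w => ctube (n%:R * S) (n%:R * d1) (fun t => n%:R *: phi (n%:R^-1 * t))
   (fun t => X (n%:R *: z) (0 + t) w)) = (fun w => ctube (n%:R * S) (n%:R * d1) (fun t => n%:R *: phi (n%:R^-1 * t))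
   (X (n%:R *: z) ^~ w)) by [].
by apply/funext => w; congr ctube; apply/funext => t; rewrite add0r.
Qed.

Lemma measurable_stube : measurable (stube S phi d1 n z).
Proof. exact: past_measurable past_stube. Qed.

Let tube2E : [set w | ctube S' d2 (fun t => phi (S + t)) (fun t => scaled_process X n z (S + t) w)]
  = [set w | ctube (n%:R * S') (n%:R * d2) (fun t => n%:R *: phi (S + n%:R^-1 * t))
       (fun t => X (n%:R *: z) (n%:R * S + t) w)].
Proof.
apply/eq_set => w.
have -> : (fun t => scaled_process X n z (S + t) w) =
  (fun t => n%:R^-1 *: (fun t => X (n%:R *: z) (n%:R * S + t) w) (n%:R * t)).
  by apply/funext => t; rewrite /scaled_process mulrDr.
apply/propext.
exact: (ctube_scale S' d2 (fun t => phi (S + t)) (fun t => X (n%:R *: z) (n%:R * S + t) w) n0).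
Qed.

Let after w : stube S phi d1 n z w ->
  let z' := n%:R^-1 *: X (n%:R *: z) (n%:R * S) w in
  [/\ scaled_space E n z', `|z' - phi S| <= d1 &
   P (n%:R *: z') (stube S' (fun t => phi (S + t)) d2 n z') =
   P (X (n%:R *: z) (n%:R * S) w) [set w' | ctube (n%:R * S') (n%:R * d2)
     (fun t => n%:R *: phi (S + n%:R^-1 * t)) (X (X (n%:R *: z) (n%:R * S) w) ^~ w')]].
Proof.
move=> Gw z'; split.
- by exists (X (n%:R *: z) (n%:R * S) w) => //; exact: (mp_state mp).
- by apply: Gw; rewrite S0 lexx.
- rewrite stubeE//; rewrite /z' scalerA mulfV ?scale1r//.
  by rewrite gt_eqF.
Qed.

(** At the junction the state lies within [d1] of [phi S], so that a bound uniform over this ball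
    factors out. *)
Lemma stube_step_ge (a : R) : 0 <= a ->
  (forall z', scaled_space E n z' -> `|z' - phi S| <= d1 ->
     (a%:E <= P (n%:R *: z') (stube S' (fun t => phi (S + t)) d2 n z'))%E) ->
  (a%:E * P (n%:R *: z) (stube S phi d1 n z) <= P (n%:R *: z) step_set)%E.
Proof.
move=> a0 H; rewrite /step_set tube2E.
apply: (markov_ctube_ge (mulr_ge0 (ltW n0') S0') (mulr_gt0 n0' d20) (rcont_scale n0 r2) Ex nS past_stube a0).
by move=> w /after[h1 h2 <-]; exact: H.
Qed.

Lemma stube_step_le (a : R) : 0 <= a ->
  (forall z', scaled_space E n z' -> `|z' - phi S| <= d1 ->
     (P (n%:R *: z') (stube S' (fun t => phi (S + t)) d2 n z') <= a%:E)%E) ->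
  (P (n%:R *: z) step_set <= a%:E * P (n%:R *: z) (stube S phi d1 n z))%E.
Proof.
move=> a0 H; rewrite /step_set tube2E.
apply: (markov_ctube_le (mulr_ge0 (ltW n0') S0') (mulr_gt0 n0' d20) (rcont_scale n0 r2) Ex nS past_stube a0).
by move=> w /after[h1 h2 <-]; exact: H.
Qed.

Lemma measurable_step_set : measurable step_set.
Proof.
apply: measurableI; first exact: measurable_stube.
rewrite tube2E; apply: (measurable_ctube (mulr_ge0 (ltW n0') S0') (mulr_gt0 n0' d20) (rcont_scale n0 r2) Ex nS).
Qed.

(** Upper bounds use this inclusion, with equal radii; lower bounds use the converse below, with a
    narrower first tube. *)
Lemma step_set_sub : d2 <= d1 ->
  stube (S + S') phi d2 n z `<=` step_set.
Proof.
move=> d21 w H; split=> t /andP[t0 tS].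
  by apply: le_trans d21; apply: H; rewrite t0 (le_trans tS)// lerDl.
by apply: H; rewrite addr_ge0//= lerD2l.
Qed.

Lemma sub_step_set : d1 <= d2 ->
  step_set `<=` stube (S + S') phi d2 n z.
Proof.
move=> d12 w [H1 H2] t /andP[t0 tS]; have [tS'|St] := leP t S.
  by apply: (le_trans _ d12); apply: H1; rewrite t0.
have := H2 (t - S); rewrite (_ : S + (t - S) = t); last by ring.
apply.
by rewrite subr_ge0 ltW//= lerBlDl.
Qed.

End step.
End Markov.

(** * Exponential bounds *)

Section limits.
Variable R : realType.

Lemma lim_right0_nd (f : R -> \bar R) :
  (forall x y, 0 < x -> x <= y -> (f x <= f y)%E) ->
  lim (f x @[x --> 0^'+]) = ereal_inf [set f x | x in [set x | 0 < x]].
Proof.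
move=> ndf; apply/cvg_lim => //.
have := @nondecreasing_at_right_cvge R f 0 +oo%O isT.
rewrite (_ : [set f x | x in [set x | 0 < x]] = f @` [set` `]0, +oo[]); last first.
  by congr (_ @` _); apply/seteqP; split => x /=; rewrite in_itv/= andbT.
by apply => x y; rewrite !in_itv/= !andbT => x0 _; exact: ndf.
Qed.

Lemma lim_right0_ni (f : R -> \bar R) :
  (forall x y, 0 < x -> x <= y -> (f y <= f x)%E) ->
  lim (f x @[x --> 0^'+]) = ereal_sup [set f x | x in [set x | 0 < x]].
Proof.
move=> nif; apply/cvg_lim => //.
have := @nonincreasing_at_right_cvge R f 0 +oo%O isT.
rewrite (_ : [set f x | x in [set x | 0 < x]] = f @` [set` `]0, +oo[]); last first.
  by congr (_ @` _); apply/seteqP; split => x /=; rewrite in_itv/= andbT.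
by apply => x y; rewrite !in_itv/= !andbT => x0 _; exact: nif.
Qed.

Lemma limn_einf_gt (u : nat -> \bar R) a : (a < limn_einf u)%E ->
  \forall n \near \oo, (a < u n)%E.
Proof.
rewrite limn_einf_lim (cvg_lim (@ereal_hausdorff R) (@cvg_einfs_sup R u)) => /ereal_sup_gt[_ [m _ <-]] am.
exists m => // n /= mn; apply: (lt_le_trans am); apply: ereal_inf_lbound.
by exists n.
Qed.

Lemma limn_einf_ge (u : nat -> \bar R) a : (\forall n \near \oo, (a <= u n)%E) ->
  (a <= limn_einf u)%E.
Proof.
move=> [m _ H]; rewrite limn_einf_lim (cvg_lim (@ereal_hausdorff R) (@cvg_einfs_sup R u)).
apply: (@le_trans _ _ (einfs u m)); last by apply: ereal_sup_ubound; exists m.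
by apply: le_ereal_inf_tmp => _ [n /= mn <-]; exact: H.
Qed.

Lemma limn_esup_lt (u : nat -> \bar R) a : (limn_esup u < a)%E ->
  \forall n \near \oo, (u n < a)%E.
Proof.
rewrite limn_esup_lim (cvg_lim (@ereal_hausdorff R) (@cvg_esups_inf R u)) => /ereal_inf_lt[_ [m _ <-]] am.
exists m => // n /= mn; apply: le_lt_trans am; apply: ereal_sup_ubound.
by exists n.
Qed.

Lemma limn_esup_le (u : nat -> \bar R) a : (\forall n \near \oo, (u n <= a)%E) ->
  (limn_esup u <= a)%E.
Proof.
move=> [m _ H]; rewrite limn_esup_lim (cvg_lim (@ereal_hausdorff R) (@cvg_esups_inf R u)).
apply: (@le_trans _ _ (esups u m)); first by apply: ereal_inf_lbound; exists m.
by apply: ge_ereal_sup => _ [n /= mn <-]; exact: H.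
Qed.

(** Includes [p = 0], so that zero probabilities need no separate treatment. *)
Lemma scaled_lne_ge (n : nat) (p : \bar R) (a : R) : (0 < n)%N -> (0 <= p)%E ->
  (a%:E <= n%:R^-1%:E * lne p)%E = ((expR (n%:R * a))%:E <= p)%E.
Proof.
move=> n0 p0; have n0' : 0 < n%:R :> R by rewrite ltr0n.
rewrite muleC lee_pdivlMr// -EFinM mulrC.
rewrite -[in LHS](expeRK (n%:R * a)%:E) lee_lne ?in_itv//= ?leey ?andbT//.
Qed.

Lemma scaled_lne_le (n : nat) (p : \bar R) (a : R) : (0 < n)%N -> (0 <= p)%E ->
  (n%:R^-1%:E * lne p <= a%:E)%E = (p <= (expR (n%:R * a))%:E)%E.
Proof.
move=> n0 p0; have n0' : 0 < n%:R :> R by rewrite ltr0n.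
rewrite muleC lee_pdivrMr// -EFinM mulrC.
rewrite -[in LHS](expeRK (n%:R * a)%:E) lee_lne ?in_itv//= ?leey ?andbT//.
Qed.

End limits.

Section bounds.
Variables (R : realType) (N : nat) (d : measure_display).
Variables (Omega : measurableType d) (E : set 'rV[R]_N).
Variables (P : 'rV[R]_N -> probability Omega R).
Variables (X : 'rV[R]_N -> R -> Omega -> 'rV[R]_N).
Implicit Types (A : R -> nat -> 'rV[R]_N -> set Omega) (c : R) (x : 'rV[R]_N).

Notation PP n z A := (mu_ext (P (n%:R *: z)) A).

(** Common form of [upper_fun], where the events are tubes, and of [upper_transition], where they
    concern the final and the hitting times. *)
Definition upper_rate A x : \bar R :=
  lim (limn_esup (fun n =>
    ereal_sup [set log_prob P n z (A delta n z) | z in scaled_ball E n x delta])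
    @[delta --> 0^'+]).

Definition event_incr A := forall d1 d2 n z, 0 < d1 -> d1 <= d2 -> A d1 n z `<=` A d2 n z.

Lemma log_prob_le n z (A B : set Omega) : A `<=` B ->
  (log_prob P n z A <= log_prob P n z B)%E.
Proof.
move=> AB; rewrite /log_prob; apply: lee_wpmul2l; first by rewrite lee_fin invr_ge0.
rewrite lee_lne ?in_itv/= ?leey ?outer_measure_ge0//.
exact: le_outer_measure.
Qed.

Lemma scaled_ballS n x (r s : R) : r <= s -> scaled_ball E n x r `<=` scaled_ball E n x s.
Proof. by move=> rs z [Ez zr]; split => //; exact: lt_le_trans rs. Qed.

Lemma upper_rateE A x : event_incr A -> upper_rate A x =
  ereal_inf [set limn_esup (fun n =>
    ereal_sup [set log_prob P n z (A delta n z) | z in scaled_ball E n x delta])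
    | delta in [set delta | 0 < delta]].
Proof.
move=> iA; apply: lim_right0_nd => r s r0 rs.
rewrite !limn_esup_lim; apply: lee_lim; [exact: is_cvg_esups|exact: is_cvg_esups|].
apply: nearW => m; apply: ge_ereal_sup => _ [n /= mn <-].
apply: (@le_trans _ _ (ereal_sup [set log_prob P n z (A s n z) | z in scaled_ball E n x s])); last first.
  by apply: ereal_sup_ubound; exists n.
apply: ge_ereal_sup => _ [z Bz <-].
apply: (@le_trans _ _ (log_prob P n z (A s n z))); first by apply: log_prob_le; exact: iA.
by apply: ereal_sup_ubound; exists z => //; exact: scaled_ballS Bz.
Qed.

(** An upper rate [- c] without limits ([upper_rate_le], [upper_bound_rate]). The slack [c' < c]
    absorbs errors; as [c] is real, an infinite rate is expressed by the bound for every [c]. *)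
Definition upper_bound A x c := forall c', c' < c -> exists2 delta, 0 < delta &
  \forall n \near \oo, forall z, scaled_ball E n x delta z ->
    (PP n z (A delta n z) <= (expR (- (n%:R * c')))%:E)%E.

Lemma upper_rate_le A x c : event_incr A -> upper_bound A x c ->
  (upper_rate A x <= - c%:E)%E.
Proof.
move=> iA H; apply/lee_addgt0Pr => e e0.
have [|delta d0 Hd] := H (c - e); first by lra.
rewrite upper_rateE//.
apply: (@le_trans _ _ (limn_esup (fun n => ereal_sup [set log_prob P n z (A delta n z) | z in scaled_ball E n x delta]))).
  by apply: ereal_inf_lbound; exists delta.
apply: limn_esup_le; near=> n; apply: ge_ereal_sup => _ [z Bz <-].
have n0 : (0 < n)%N by near: n; exact: nbhs_infty_gt.
rewrite -EFinN -EFinD scaled_lne_le ?outer_measure_ge0//.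
rewrite (_ : n%:R * (- c + e) = - (n%:R * (c - e))); last by ring.
by move: z Bz; near: n.
Unshelve. all: by end_near. Qed.

Lemma upper_bound_rate A x c : event_incr A -> (upper_rate A x <= - c%:E)%E ->
  upper_bound A x c.
Proof.
move=> iA; rewrite upper_rateE// => H c' c'c.
have : (ereal_inf [set limn_esup (fun n =>
    ereal_sup [set log_prob P n z (A delta n z) | z in scaled_ball E n x delta])
    | delta in [set delta | (0 < delta)%R]] < - c'%:E)%E.
  by apply: (le_lt_trans H); rewrite -!EFinN lte_fin ltrN2.
move=> /ereal_inf_lt[_ [delta /= d0 <-]] /limn_esup_lt lt; exists delta => //.
near=> n; move=> z Bz.
have n0 : (0 < n)%N by near: n; exact: nbhs_infty_gt.
rewrite -mulrN -scaled_lne_le ?outer_measure_ge0// EFinN.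
apply: (@le_trans _ _ (ereal_sup [set log_prob P n z (A delta n z) | z in scaled_ball E n x delta])).
  by apply: ereal_sup_ubound; exists z.
by apply: ltW; near: n.
Unshelve. all: by end_near. Qed.

(** The quantifiers come in the order of the limits in [lower_fun]: the initial radius [eps] may
    depend on [delta]. *)
Definition lower_bound T (phi : R -> 'rV[R]_N) c := forall c', c < c' -> forall delta, 0 < delta ->
  exists2 eps, 0 < eps & \forall n \near \oo, forall z, scaled_ball E n (phi 0) eps z ->
    ((expR (- (n%:R * c')))%:E <= PP n z (stube X T phi delta n z))%E.

Lemma stube_incr T phi : event_incr (stube X T phi).
Proof. by move=> d1 d2 n z _ d12 w H t tT; apply: le_trans d12; exact: H. Qed.

Lemma tube_stube T phi delta n z : tube X T phi delta n z `<=` stube X T phi delta n z.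
Proof.
move=> w /= H t tT; rewrite -lee_fin; apply: ltW; apply: le_lt_trans H.
by rewrite distrC; apply: ereal_sup_ubound; exists t => //; rewrite /= in_itv.
Qed.

Lemma stube_tube T phi delta eps n z : delta < eps ->
  stube X T phi delta n z `<=` tube X T phi eps n z.
Proof.
move=> de w /= H; apply: (@le_lt_trans _ _ delta%:E); last by rewrite lte_fin.
apply: ge_ereal_sup => _ [t + <-]; rewrite /= in_itv/= => tT.
by rewrite lee_fin distrC; exact: H.
Qed.

Lemma tube_incr T phi : event_incr (tube X T phi).
Proof. by move=> d1 d2 n z _ d12 w /= H; apply: lt_le_trans H _; rewrite lee_fin. Qed.

Lemma upper_fun_le T phi c : upper_bound (stube X T phi) (phi 0) c ->
  (upper_fun E P X T phi <= - c%:E)%E.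
Proof.
move=> H; apply: (@upper_rate_le (tube X T phi)); first exact: tube_incr.
move=> c' /H[delta d0 Hd]; exists delta => //; near=> n; move=> z Bz.
apply: (@le_trans _ _ (PP n z (stube X T phi delta n z))).
  by apply: le_outer_measure; exact: tube_stube.
by move: z Bz; near: n.
Unshelve. all: by end_near. Qed.

Let lower_in T phi delta eps := limn_einf (fun n =>
        ereal_inf [set log_prob P n z (tube X T phi delta n z)
              | z in scaled_ball E n (phi 0) eps]).

Let lower_in_incr T phi d1 d2 e1 e2 : 0 < d1 -> d1 <= d2 -> e2 <= e1 ->
  (lower_in T phi d1 e1 <= lower_in T phi d2 e2)%E.
Proof.
move=> d0 d12 e12; rewrite /lower_in !limn_einf_lim.
apply: lee_lim; [exact: is_cvg_einfs|exact: is_cvg_einfs|].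
apply: nearW => m; apply: le_ereal_inf_tmp => _ [n /= mn <-].
apply: (@le_trans _ _ (ereal_inf [set log_prob P n z (tube X T phi d1 n z) | z in scaled_ball E n (phi 0) e1])).
  by apply: ereal_inf_lbound; exists n.
apply: le_ereal_inf_tmp => _ [z Bz <-].
apply: (@le_trans _ _ (log_prob P n z (tube X T phi d1 n z))).
  by apply: ereal_inf_lbound; exists z => //; exact: scaled_ballS Bz.
by apply: log_prob_le; exact: tube_incr.
Qed.

Lemma lower_funE T phi : lower_fun E P X T phi =
  ereal_inf [set ereal_sup [set lower_in T phi delta eps | eps in [set eps | 0 < eps]]
    | delta in [set delta | 0 < delta]].
Proof.
suff main (g : R -> \bar R) : (forall delta, 0 < delta -> g delta =
    ereal_sup [set lower_in T phi delta eps | eps in [set eps | 0 < eps]]) ->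
  lim (g delta @[delta --> 0^'+]) = ereal_inf [set
    ereal_sup [set lower_in T phi delta eps | eps in [set eps | 0 < eps]]
    | delta in [set delta | 0 < delta]].
  apply: main => delta d0.
  by apply: lim_right0_ni => e1 e2 e0 e12; exact: lower_in_incr.
move=> E1; rewrite lim_right0_nd.
  by congr ereal_inf; apply: eq_imagel => delta /= d0; exact: E1.
move=> d1 d2 d0 d12; rewrite (E1 _ d0) (E1 _ (lt_le_trans d0 d12)).
apply: ge_ereal_sup => _ [eps /= e0 <-].
apply: (@le_trans _ _ (lower_in T phi d2 eps)); first exact: lower_in_incr.
by apply: ereal_sup_ubound; exists eps.
Qed.

Lemma lower_bound_fun T phi c : (- c%:E <= lower_fun E P X T phi)%E -> lower_bound T phi c.
Proof.
rewrite lower_funE => H c' cc' delta d0.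
have : (- c'%:E < ereal_sup [set lower_in T phi delta eps | eps in [set eps | (0 < eps)%R]])%E.
  apply: (@lt_le_trans _ _ (- c%:E)%E); first by rewrite -!EFinN lte_fin ltrN2.
  by apply: (le_trans H); apply: ereal_inf_lbound; exists delta.
move=> /ereal_sup_gt[_ [eps /= e0 <-]] /limn_einf_gt lt; exists eps => //.
near=> n; move=> z Bz.
have n0 : (0 < n)%N by near: n; exact: nbhs_infty_gt.
apply: (@le_trans _ _ (PP n z (tube X T phi delta n z))); last first.
  by apply: le_outer_measure; exact: tube_stube.
rewrite -mulrN -scaled_lne_ge ?outer_measure_ge0// EFinN.
apply: (@le_trans _ _ (ereal_inf [set log_prob P n z (tube X T phi delta n z) | z in scaled_ball E n (phi 0) eps])).
  by apply: ltW; near: n.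
by apply: ereal_inf_lbound; exists z.
Unshelve. all: by end_near. Qed.

Lemma lower_fun_bound T phi c : lower_bound T phi c -> (- c%:E <= lower_fun E P X T phi)%E.
Proof.
move=> H; rewrite lower_funE; apply: le_ereal_inf_tmp => _ [delta /= d0 <-].
apply/lee_addgt0Pr => e e0; rewrite -leeBlDr//.
have d20 : 0 < delta / 2 by lra.
have [|eps eps0 He] := H (c + e) _ _ d20; first by lra.
apply: (@le_trans _ _ (lower_in T phi delta eps)); last by apply: ereal_sup_ubound; exists eps.
apply: limn_einf_ge; near=> n; apply: le_ereal_inf_tmp => _ [z Bz <-].
have n0 : (0 < n)%N by near: n; exact: nbhs_infty_gt.
apply: (@le_trans _ _ (log_prob P n z (stube X T phi (delta / 2) n z))); last first.
  by apply: log_prob_le; apply: stube_tube; lra.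
rewrite -EFinN -EFinB scaled_lne_ge ?outer_measure_ge0//.
rewrite (_ : n%:R * (- c - e) = - (n%:R * (c + e))); last by ring.
by move: z Bz; near: n.
Unshelve. all: by end_near. Qed.

(** The balls eventually contain the points [u n]; over an empty ball the infimum would be [+oo] and
    the supremum [-oo]. *)
Lemma lower_fun_le_upper_fun T (phi : R -> 'rV[R]_N) :
  (exists2 u : nat -> 'rV[R]_N, (forall n, (1 <= n)%N -> scaled_space E n (u n)) & u @ \oo --> phi 0) ->
  (lower_fun E P X T phi <= upper_fun E P X T phi)%E.
Proof.
move=> [u Eu cu]; rewrite lower_funE -[upper_fun _ _ _ _ _]/(upper_rate (tube X T phi) (phi 0)).
rewrite upper_rateE; last exact: tube_incr.
apply: le_ereal_inf_tmp => _ [delta /= d0 <-].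
apply: (@le_trans _ _ (ereal_sup [set lower_in T phi delta eps | eps in [set eps | 0 < eps]])).
  by apply: ereal_inf_lbound; exists delta.
apply: ge_ereal_sup => _ [eps /= e0 <-].
apply: (@le_trans _ _ (lower_in T phi delta (Num.min eps delta))).
  by apply: lower_in_incr; rewrite ?ge_min ?lexx.
apply: le_trans (limn_einf_sup _) _.
rewrite !limn_esup_lim; apply: lee_lim; [exact: is_cvg_esups|exact: is_cvg_esups|].
have m0 : 0 < Num.min eps delta by rewrite lt_min e0.
have [M _ HM] : \forall n \near \oo, `|u n - phi 0| < Num.min eps delta.
  by move/cvgrPdistC_lt: cu; apply.
(* The successor also excludes the index 0, at which [u n] need not be a rescaled state. *)
exists M.+1 => // m /= Mm; apply: ge_ereal_sup => _ [n /= mn <-].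
have un : scaled_ball E n (phi 0) (Num.min eps delta) (u n).
  split; first by apply: Eu; apply: leq_trans mn; apply: leq_trans Mm.
  by apply: HM; rewrite /=; apply: leq_trans mn; exact: ltnW.
apply: (@le_trans _ _ (log_prob P n (u n) (tube X T phi delta n (u n)))).
  by apply: ereal_inf_lbound; exists (u n).
apply: (@le_trans _ _ (ereal_sup [set log_prob P n z (tube X T phi delta n z) | z in scaled_ball E n (phi 0) delta])).
  apply: ereal_sup_ubound; exists (u n) => //; apply: scaled_ballS un.
  by rewrite ge_min lexx orbT.
by apply: ereal_sup_ubound; exists n.
Qed.

End bounds.

Section rownorm.
Variables (R : realType) (N : nat).
Implicit Types (x : 'rV[R]_N).

Lemma coord_le_norm x i : `|x ord0 i| <= `|x|.
Proof.
rewrite -[leRHS]/(mx_norm x) mx_normrE.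
by apply: (@le_bigmax _ _ _ 0 (fun ij : 'I_1 * 'I_N => `|x ij.1 ij.2|) (ord0, i)).
Qed.

Lemma norm_le_coord x r : 0 <= r -> (forall i, `|x ord0 i| <= r) -> `|x| <= r.
Proof.
move=> r0 H; rewrite -[leLHS]/(mx_norm x) mx_normrE.
apply: bigmax_le => // -[i j] _ /=.
by rewrite (ord1 i); exact: H.
Qed.

End rownorm.

(** * Concatenation of exponential bounds *)

Section concat.
Variables (R : realType) (N : nat) (d : measure_display).
Variables (Omega : measurableType d) (E : set 'rV[R]_N).
Variables (P : 'rV[R]_N -> probability Omega R).
Variables (k : R -> R.-pker (borel_rV R N) ~> (borel_rV R N)).
Variables (X : 'rV[R]_N -> R -> Omega -> 'rV[R]_N).
Hypothesis mp : markov_process E P k X.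
Notation LB := (lower_bound E P X).
Notation UB := (upper_bound E P).
Implicit Types (phi chi : R -> 'rV[R]_N) (S T c : R).

Lemma mu_ext_le1 (x : 'rV[R]_N) (A : set Omega) : (mu_ext (P x) A <= 1)%E.
Proof.
rewrite -(@probability_setT _ _ _ (P x)) -(measurable_mu_extE (P x) measurableT).
exact: le_outer_measure.
Qed.

Lemma lower_bound_le T phi c c' : c <= c' -> LB T phi c -> LB T phi c'.
Proof. by move=> cc H c'' cc'; apply: H; exact: le_lt_trans cc'. Qed.

Lemma lower_bound_sub T T' phi c : T' <= T -> LB T phi c -> LB T' phi c.
Proof.
move=> TT H c' cc' e e0; have [eps eps0 He] := H c' cc' e e0.
exists eps => //; near=> n; move=> z Bz.
apply: (@le_trans _ _ (mu_ext (P (n%:R *: z)) (stube X T phi e n z))).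
  by move: z Bz; near: n.
apply: le_outer_measure => w Hw t /andP[t0 tT].
by apply: Hw; rewrite t0 (le_trans tT).
Unshelve. all: by end_near. Qed.

(** A tube of half the radius around a close path lies in the tube around [phi]; only the rate [c]
    has to be common to the approximations. *)
Lemma lower_bound_close T phi c :
  (forall e, 0 < e -> exists chi, [/\ chi 0 = phi 0, LB T chi c &
     forall t, 0 <= t <= T -> `|chi t - phi t| <= e]) -> LB T phi c.
Proof.
move=> H c' cc' e e0; have e20 : 0 < e / 2 by lra.
have [chi [chi0 Hchi close]] := H _ e20.
have [eps eps0 He] := Hchi c' cc' _ e20.
exists eps => //; near=> n; move=> z; rewrite -chi0 => Bz.
apply: (@le_trans _ _ (mu_ext (P (n%:R *: z)) (stube X T chi (e / 2) n z))).
  by move: z Bz; near: n.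
apply: le_outer_measure => w Hw t tT.
rewrite -(subrKA (chi t)) (le_trans (ler_normD _ _))//.
by have := Hw t tT; have := close t tT; lra.
Unshelve. all: by end_near. Qed.

Lemma lower_bound_eq T phi chi c : 0 <= T -> (forall t, 0 <= t <= T -> chi t = phi t) ->
  LB T chi c -> LB T phi c.
Proof.
move=> T0 H Hc; apply: lower_bound_close => e e0; exists chi; split => //.
  by apply: H; rewrite lexx.
by move=> t /H ->; rewrite subrr normr0 ltW.
Qed.

(** The radius [e1] of the first tube is below [eps2], so that at time [S] the process is in the
    ball where the second bound holds. Each bound spends half of the slack. *)
Lemma lower_bound_concat S S' phi c1 c2 : 0 <= S -> 0 <= S' ->
  rcont S phi -> rcont S' (fun t => phi (S + t)) ->
  LB S phi c1 -> LB S' (fun t => phi (S + t)) c2 -> LB (S + S') phi (c1 + c2).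
Proof.
move=> S0 S0' r1 r2 H1 H2 c' cc' e e0.
pose eta := (c' - (c1 + c2)) / 2.
have eta0 : 0 < eta by rewrite /eta; lra.
have [|eps2 eps20 He2] := H2 (c2 + eta) _ e e0; first by lra.
pose e1 := Num.min e (eps2 / 2).
have e10 : 0 < e1 by rewrite lt_min e0; lra.
have e1e : e1 <= e by rewrite ge_min lexx.
have e1eps : e1 < eps2.
  have : e1 <= eps2 / 2 by rewrite ge_min lexx orbT.
  by lra.
have [|eps1 eps10 He1] := H1 (c1 + eta) _ e1 e10; first by lra.
exists eps1 => //; near=> n.
have h1 : forall z, scaled_ball E n (phi 0) eps1 z ->
    ((expR (- (n%:R * (c1 + eta))))%:E <= mu_ext (P (n%:R *: z)) (stube X S phi e1 n z))%E.
  by near: n.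
have h2 : forall z, scaled_ball E n (phi (S + 0)) eps2 z ->
    ((expR (- (n%:R * (c2 + eta))))%:E <=
     mu_ext (P (n%:R *: z)) (stube X S' (fun t => phi (S + t)%R) e n z))%E.
  by near: n.
move=> z Bz; have n0 : (0 < n)%N by near: n; exact: nbhs_infty_gt.
have Ez : scaled_space E n z by case: Bz.
apply: (@le_trans _ _ (P (n%:R *: z) (stube X S phi e1 n z `&`
  [set w | ctube S' e (fun t => phi (S + t)) (fun t => scaled_process X n z (S + t) w)]))); last first.
  rewrite -(measurable_mu_extE (P (n%:R *: z)) (measurable_step_set mp n0 S0 S0' e10 e0 r1 r2 Ez)).
  by apply: le_outer_measure; exact: sub_step_set.
have ms := measurable_stube mp n0 S0 e10 r1 Ez.
apply: le_trans (stube_step_ge mp n0 S0 S0' e10 e0 r1 r2 Ez (expR_ge0 (- (n%:R * (c2 + eta)))) _); last first.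
  move=> z' Ez' zS.
  rewrite -measurable_mu_extE; last exact: (measurable_stube mp n0 S0' e0 r2 Ez').
  by apply: h2; split => //; rewrite addr0; exact: le_lt_trans e1eps.
have := h1 z Bz; rewrite measurable_mu_extE// => He.
apply: (@le_trans _ _ ((expR (- (n%:R * (c2 + eta))))%:E * (expR (- (n%:R * (c1 + eta))))%:E)%E).
  rewrite -EFinM -expRD lee_fin ler_expR -opprD -mulrDr lerN2.
  by rewrite ler_wpM2l// /eta; lra.
by apply: lee_wpmul2l; rewrite ?lee_fin ?expR_ge0.
Unshelve. all: by end_near. Qed.

Lemma upper_bound_le A x c c' : c' <= c -> UB A x c -> UB A x c'.
Proof. by move=> cc H c'' cc'; apply: H; exact: lt_le_trans cc' cc. Qed.

Lemma upper_bound0 A x : UB A x 0.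
Proof.
move=> c' c0; exists 1 => //; near=> n; move=> z _.
apply: le_trans (mu_ext_le1 _ _) _; rewrite lee_fin -expR0 ler_expR.
by rewrite -mulrN mulr_ge0//; lra.
Unshelve. all: by end_near. Qed.

Lemma upper_bound_sub T T' phi x c : T <= T' ->
  UB (stube X T phi) x c -> UB (stube X T' phi) x c.
Proof.
move=> TT H c' cc'; have [e e0 He] := H c' cc'.
exists e => //; near=> n; move=> z Bz.
apply: (@le_trans _ _ (mu_ext (P (n%:R *: z)) (stube X T phi e n z))).
  apply: le_outer_measure => w Hw t /andP[t0 tT].
  by apply: Hw; rewrite t0 (le_trans tT).
by move: z Bz; near: n.
Unshelve. all: by end_near. Qed.

(** A single radius serves both pieces; being below [e2], it places the state at time [S] in the
    ball of the second bound. *)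
Lemma upper_bound_concat S S' phi c1 c2 : 0 <= S -> 0 <= S' ->
  rcont S phi -> rcont S' (fun t => phi (S + t)) ->
  UB (stube X S phi) (phi 0) c1 ->
  UB (stube X S' (fun t => phi (S + t))) (phi S) c2 ->
  UB (stube X (S + S') phi) (phi 0) (c1 + c2).
Proof.
move=> S0 S0' r1 r2 H1 H2 c' cc'.
pose eta := (c1 + c2 - c') / 2.
have eta0 : 0 < eta by rewrite /eta; lra.
have [|e1 e10 He1] := H1 (c1 - eta); first by lra.
have [|e2 e20 He2] := H2 (c2 - eta); first by lra.
pose e := Num.min e1 (e2 / 2).
have e0 : 0 < e by rewrite lt_min e10; lra.
have ee1 : e <= e1 by rewrite ge_min lexx.
have ee2 : e < e2.
  have : e <= e2 / 2 by rewrite ge_min lexx orbT.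
  by lra.
exists e => //; near=> n.
have h1 : forall z, scaled_ball E n (phi 0) e1 z ->
    (mu_ext (P (n%:R *: z)) (stube X S phi e1 n z) <= (expR (- (n%:R * (c1 - eta))))%:E)%E.
  by near: n.
have h2 : forall z, scaled_ball E n (phi S) e2 z ->
    (mu_ext (P (n%:R *: z)) (stube X S' (fun t => phi (S + t)%R) e2 n z) <=
     (expR (- (n%:R * (c2 - eta))))%:E)%E.
  by near: n.
move=> z Bz; have n0 : (0 < n)%N by near: n; exact: nbhs_infty_gt.
have Ez : scaled_space E n z by case: Bz.
have ms := measurable_stube mp n0 S0 e0 r1 Ez.
apply: (@le_trans _ _ (P (n%:R *: z) (stube X S phi e n z `&`
  [set w | ctube S' e (fun t => phi (S + t)) (fun t => scaled_process X n z (S + t) w)]))).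
  rewrite -(measurable_mu_extE (P (n%:R *: z)) (measurable_step_set mp n0 S0 S0' e0 e0 r1 r2 Ez)).
  by apply: le_outer_measure; exact: step_set_sub.
apply: le_trans (stube_step_le mp n0 S0 S0' e0 e0 r1 r2 Ez (expR_ge0 (- (n%:R * (c2 - eta)))) _) _.
  move=> z' Ez' zS.
  rewrite -measurable_mu_extE; last exact: (measurable_stube mp n0 S0' e0 r2 Ez').
  apply: le_trans (h2 z' _); last by split => //; exact: le_lt_trans ee2.
  by apply: le_outer_measure; apply: stube_incr => //; exact: ltW.
apply: (@le_trans _ _ ((expR (- (n%:R * (c2 - eta))))%:E * (expR (- (n%:R * (c1 - eta))))%:E)%E).
  apply: lee_wpmul2l; rewrite ?lee_fin ?expR_ge0// -measurable_mu_extE//.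
  apply: le_trans (h1 z _); last exact: scaled_ballS Bz.
  by apply: le_outer_measure; apply: stube_incr.
rewrite -EFinM -expRD lee_fin ler_expR -opprD -mulrDr lerN2.
by rewrite ler_wpM2l// /eta; lra.
Unshelve. all: by end_near. Qed.

End concat.

Section assumptions.
Variables (R : realType) (N : nat) (d : measure_display).
Variables (Omega : measurableType d) (E : set 'rV[R]_N).
Variables (P : 'rV[R]_N -> probability Omega R).
Variables (X : 'rV[R]_N -> R -> Omega -> 'rV[R]_N).
Variable (L : {set 'I_N} -> 'rV[R]_N -> \bar R).

Definition dense_states := forall x : 'rV[R]_N, orthant x ->
       exists2 u : nat -> 'rV[R]_N,
         (forall n, (1 <= n)%N -> scaled_space E n (u n)) & u @ \oo --> x.

Definition segment_lower_bound := forall (Lambda : {set 'I_N}) (T : R), 0 < T ->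
       forall (phi : R -> 'rV[R]_N) (v : 'rV[R]_N),
         in_orthant T phi ->
         (forall t, 0 <= t <= T -> phi t = phi 0 + t *: v) ->
         (forall t, 0 < t < T -> face Lambda (phi t)) ->
         (lower_fun E P X T phi >= - (T%:E * L Lambda v))%E.

Definition face_upper_bound := forall (Lambda : {set 'I_N}) (T : R), 0 < T ->
       forall x y : 'rV[R]_N, face Lambda x -> face Lambda y ->
         (upper_transition E P X Lambda T x y
            <= - (T%:E * L Lambda (T^-1 *: (y - x))))%E.

End assumptions.

(** * Consequences of (A1) and (A3) *)

Section hypotheses.
Variables (R : realType) (N : nat) (d : measure_display).
Variables (Omega : measurableType d) (E : set 'rV[R]_N).
Variables (P : 'rV[R]_N -> probability Omega R).
Variables (k : R -> R.-pker (borel_rV R N) ~> (borel_rV R N)).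
Variables (X : 'rV[R]_N -> R -> Omega -> 'rV[R]_N).
Hypothesis mp : markov_process E P k X.
Hypothesis E_dense : dense_states E.
Variable (L : {set 'I_N} -> 'rV[R]_N -> \bar R).
Hypothesis L_ge0 : forall (Lambda : {set 'I_N}) (v : 'rV[R]_N), (0 <= L Lambda v)%E.
Hypothesis A1 : segment_lower_bound E P X L.
Hypothesis A3 : face_upper_bound E P X L.
Notation LB := (lower_bound E P X).
Notation UB := (upper_bound E P).
Implicit Types (phi chi : R -> 'rV[R]_N) (S T c : R) (Lambda : {set 'I_N}) (x v : 'rV[R]_N).

Lemma lower_bound_linear Lambda T phi v c : 0 < T -> in_orthant T phi ->
  (forall t, 0 <= t <= T -> phi t = phi 0 + t *: v) ->
  (forall t, 0 < t < T -> face Lambda (phi t)) ->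
  (T%:E * L Lambda v <= c%:E)%E -> LB T phi c.
Proof.
move=> T0 oT lin fL cost; apply: lower_bound_fun.
by apply: le_trans (A1 T0 oT lin fL); rewrite leeN2.
Qed.

(** For the strict inequality, right-continuity keeps the coordinates nonzero for a while after [T],
    so that the infimum of the hitting times stays away from [T]. *)
Lemma hitting_time_gt Lambda T (u : R -> 'rV[R]_N) : 0 <= T -> cadlag u ->
  (forall i t, i \in Lambda -> 0 <= t <= T -> u t ord0 i != 0) ->
  (T%:E < hitting_time Lambda u)%E.
Proof.
move=> T0 [ru _] H.
have cu := ru T T0.
have [e e0 He] : exists2 e, 0 < e & forall i t, i \in Lambda -> 0 <= t <= T + e -> u t ord0 i != 0.
  have near_i i : i \in Lambda -> \forall t \near T^'+, u t ord0 i != 0.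
    move=> iL; have uT : u T ord0 i != 0 by apply: H; rewrite ?T0/=.
    have m0 : 0 < `|u T ord0 i| by rewrite normr_gt0 uT.
    have /cvgrPdist_lt/(_ _ m0) := cu; apply: filterS => t ut.
    apply/eqP => u0; move: ut; rewrite ltNge; apply/negP; rewrite negbK.
    by have := coord_le_norm (u T - u t) i; rewrite !mxE u0 subr0.
  have : \forall t \near T^'+, forall i, i \in Lambda -> u t ord0 i != 0.
    apply: filter_forall => i; have [iL|iL] := boolP (i \in Lambda).
      by apply: filterS (near_i i iL).
    by apply: nearW.
  move=> [e /= e0 He]; exists (e / 2); first by lra.
  move=> i t iL /andP[t0 tTe]; have [tT|Tt] := leP t T; first by apply: H; rewrite ?t0.
  by apply: He => //=; rewrite ltr0_norm; lra.
apply: (@lt_le_trans _ _ (T + e)%:E); first by rewrite lte_fin ltrDl.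
apply: le_ereal_inf_tmp => _ [t [t0 [i /= iL ut]] <-]; rewrite lee_fin leNgt.
apply/negP => tTe; have := He i t iL; rewrite t0 (ltW tTe) ut => /(_ isT).
by rewrite eqxx.
Qed.

Lemma cadlag_scaled n z w : (0 < n)%N -> E (n%:R *: z) ->
  cadlag (fun t => scaled_process X n z t w).
Proof.
move=> n0 Ex; have n0' : 0 < n%:R :> R by rewrite ltr0n.
have [c1 c2] := mp_cadlag mp Ex w; split => t t0.
    apply: cvgZl_tmp.
  apply: (@cvg_comp _ _ _ (fun t => n%:R * t) (X (n%:R *: z) ^~ w) _ (n%:R * t)^'+); last first.
    by apply: c1; rewrite mulr_ge0.
  move=> B [a /= a0 HB]; exists (a / n%:R) => /=; first by rewrite divr_gt0.
  move=> y /= ya ty; apply: HB => /=; last by rewrite ltr_pM2l.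
  by rewrite -mulrBr normrM gtr0_norm// mulrC -ltr_pdivlMr.
apply/cvg_ex; have /cvg_ex[l cl] := c2 (n%:R * t) (mulr_gt0 n0' t0).
exists (n%:R^-1 *: l); apply: cvgZl_tmp.
apply: (@cvg_comp _ _ _ (fun t => n%:R * t) (X (n%:R *: z) ^~ w) _ (n%:R * t)^'-); last exact: cl.
move=> B [a /= a0 HB]; exists (a / n%:R) => /=; first by rewrite divr_gt0.
move=> y /= ya ty; apply: HB => /=; last by rewrite ltr_pM2l.
by rewrite -mulrBr normrM gtr0_norm// mulrC -ltr_pdivlMr.
Qed.

(** Within less than [kappa] of a path whose coordinates in [Lambda] are at least [kappa], none of
    these coordinates vanishes: the tube is contained in the event of (A3). *)
Lemma upper_bound_face Lambda T phi kappa c : 0 < T -> 0 < kappa ->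
  face Lambda (phi 0) -> face Lambda (phi T) ->
  (forall i t, i \in Lambda -> 0 <= t <= T -> kappa <= phi t ord0 i) ->
  (c%:E <= T%:E * L Lambda (T^-1 *: (phi T - phi 0))%R)%E ->
  UB (stube X T phi) (phi 0) c.
Proof.
move=> T0 k0 f0 fT pos cost.
pose A (delta : R) n z := [set w | `|scaled_process X n z T w - phi T| < delta /\
   (T%:E < hitting_time Lambda (fun t => scaled_process X n z t w))%E].
have iA : event_incr A.
  by move=> d1 d2 n z _ d12 w /= [h1 h2]; split => //; exact: lt_le_trans d12.
have UA : UB A (phi 0) c.
  apply: upper_bound_rate => //; apply: le_trans (A3 T0 f0 fT) _.
  by rewrite leeN2.
move=> c' cc'; have [e e0 He] := UA c' cc'.
pose e' := Num.min (e / 2) (kappa / 2).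
have e'0 : 0 < e' by rewrite lt_min; apply/andP; split; lra.
have e'e : e' < e by rewrite gt_min; apply/orP; left; lra.
have e'k : e' < kappa by rewrite gt_min; apply/orP; right; lra.
exists e' => //; near=> n.
have h : forall z, scaled_ball E n (phi 0) e z ->
  (mu_ext (P (n%:R *: z)) (A e n z) <= (expR (- (n%:R * c')))%:E)%E by near: n.
have n0 : (0 < n)%N by near: n; exact: nbhs_infty_gt.
move=> z Bz; apply: le_trans (h z (scaled_ballS (ltW e'e) Bz)).
apply: le_outer_measure => w Hw; split.
  by apply: le_lt_trans e'e; apply: Hw; rewrite (ltW T0) lexx.
have Ez : E (n%:R *: z) by apply: scaled_spaceP => //; case: Bz.
apply: hitting_time_gt; first exact: ltW.
  exact: cadlag_scaled.
move=> i t iL tT; apply: lt0r_neq0.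
have := Hw t tT; have := coord_le_norm (scaled_process X n z t w - phi t) i.
have := pos i t iL tT; rewrite !mxE ler_norml => h1 /andP[h2 _] h3; lra.
Unshelve. all: by end_near. Qed.

Lemma face_coord Lambda x i : face Lambda x -> (0 < x ord0 i) = (i \in Lambda).
Proof. by move=> [_ <-]; rewrite !finset.inE. Qed.

Lemma face_coord0 Lambda x i : face Lambda x -> i \notin Lambda -> x ord0 i = 0.
Proof.
move=> fx; rewrite -(face_coord i fx) -leNgt => x0; apply/le_anti; rewrite x0/=.
by case: fx => ox _; exact: ox.
Qed.

Lemma faceP Lambda x : (forall i, i \in Lambda -> 0 < x ord0 i) ->
  (forall i, i \notin Lambda -> x ord0 i = 0) -> face Lambda x.
Proof.
move=> H1 H2; split=> [i|].
  by have [iL|iL] := boolP (i \in Lambda); [rewrite ltW ?H1|rewrite H2].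
apply/setP => i; rewrite !finset.inE; have [iL|iL] := boolP (i \in Lambda); first exact: H1.
by rewrite H2// ltxx.
Qed.

(* Combining (A1) and (A3) along a short segment of the face shows that
   [L Lambda] is lower semicontinuous on the linear span of the face. *)
Lemma L_lsc Lambda v c : (forall i, i \notin Lambda -> v ord0 i = 0) ->
  (c%:E < L Lambda v)%E ->
  exists2 r, 0 < r & forall v' : 'rV[R]_N, (forall i, i \notin Lambda -> v' ord0 i = 0) ->
    `|v' - v| <= r -> (c%:E <= L Lambda v')%E.
Proof.
move=> v0 cL.
have [c1 cc1 c1L] : exists2 c1, c < c1 & (c1%:E < L Lambda v)%E.
  move: cL; case: (L Lambda v) => [l| |]//; rewrite ?lte_fin => cl.
    by exists ((c + l) / 2); rewrite ?lte_fin; lra.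
  by exists (c + 1); rewrite ?ltry//; lra.
(* From the point with coordinates [M], one unit of time at a velocity within 1 of [v] keeps the
   coordinates in [Lambda] at least 1, and a tube of radius 1/2 keeps them positive. *)
pose M := `|v| + 2.
have M0 : 0 < M by rewrite /M ltr_wpDl.
pose x : 'rV[R]_N := \row_i (if i \in Lambda then M else 0).
have fseg v' t : (forall i, i \notin Lambda -> v' ord0 i = 0) -> `|v' - v| <= 1 ->
    0 <= t <= 1 -> face Lambda (x + t *: v').
  move=> v'0 vv' /andP[t0 t1]; apply: faceP => i iL; rewrite !mxE.
    rewrite iL; have : `|t * v' ord0 i| <= `|v| + 1.
      rewrite normrM (ger0_norm t0) (@le_trans _ _ `|v' ord0 i|)//.
        by rewrite ler_piMl.
      rewrite (le_trans (coord_le_norm v' i))// -(subrK v v') addrC.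
      by rewrite (le_trans (ler_normD _ _))// lerD2l.
    by rewrite ler_norml /M => /andP[h _]; lra.
  by rewrite (negbTE iL) v'0// mulr0 addr0.
have vv : `|v - v| <= 1 by rewrite subrr normr0 ler01.
have fx : face Lambda x.
  by have := fseg v 0 v0 vv; rewrite scale0r addr0 lexx ler01; apply.
have fy : face Lambda (x + v).
  by have := fseg v 1 v0 vv; rewrite scale1r lexx ler01; apply.
pose A (delta : R) n z := [set w | `|scaled_process X n z 1 w - (x + v)| < delta /\
   (1%:E < hitting_time Lambda (fun t => scaled_process X n z t w))%E].
have iA : event_incr A.
  by move=> d1 d2 n z _ d12 w /= [h1 h2]; split => //; exact: lt_le_trans d12.
have : UB A x c1.
  apply: upper_bound_rate => //; apply: le_trans (A3 ltr01 fx fy) _.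
  by rewrite leeN2 mul1e invr1 scale1r addrAC subrr add0r ltW.
move=> /(_ ((c + c1) / 2)) [|e e0 He]; first by lra.
exists (Num.min 1 (e / 2)); first by rewrite lt_min ltr01; lra.
move=> v' v'0; rewrite le_min => /andP[vv1 vve].
rewrite leNgt; apply/negP => Lc.
have LBv' : LB 1 (fun t => x + t *: v') c.
  apply: (@lower_bound_linear Lambda _ _ v') => //.
  - by move=> t tT; have [] := fseg v' t v'0 vv1 tT.
  - by move=> t _; rewrite scale0r addr0.
  - by move=> t /andP[t0 t1]; apply: fseg; rewrite // !ltW.
  - by rewrite mul1e ltW.
pose e' := Num.min (e / 4) (1 / 2).
have e'0 : 0 < e' by rewrite lt_min; apply/andP; split; lra.
have e'e : e' <= e / 4 by rewrite ge_min lexx.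
have e'1 : e' <= 1 / 2 by rewrite ge_min lexx orbT.
(* This lower bound, at a rate strictly between [c] and [(c + c1) / 2], contradicts the upper bound
   at the rate [(c + c1) / 2]. *)
have [|eps eps0 Heps] := LBv' ((c + (c + c1) / 2) / 2) _ _ e'0; first by lra.
have [u Eu cu] := E_dense (proj1 fx).
have m0 : 0 < Num.min eps e by rewrite lt_min eps0.
have : \forall n \near \oo, False; last by case=> n0 _ /(_ n0); apply => /=.
near=> n.
have n0 : (0 < n)%N by near: n; exact: nbhs_infty_gt.
have un : `|u n - x| < Num.min eps e.
  by near: n; move/cvgrPdistC_lt: cu; apply.
have h1 : forall z, scaled_ball E n (x + 0 *: v') eps z ->
   ((expR (- (n%:R * ((c + (c + c1) / 2) / 2))))%:E <= mu_ext (P (n%:R *: z)) (stube X 1 (fun t => x + t *: v')%R e' n z))%E.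
  by near: n.
have h2 : forall z, scaled_ball E n x e z ->
  (mu_ext (P (n%:R *: z)) (A e n z) <= (expR (- (n%:R * ((c + c1) / 2))))%:E)%E by near: n.
have B1 : scaled_ball E n (x + 0 *: v') eps (u n).
  split; first exact: Eu.
  by rewrite scale0r addr0; apply: lt_le_trans un _; rewrite ge_min lexx.
have B2 : scaled_ball E n x e (u n).
  by split; [exact: Eu|apply: lt_le_trans un _; rewrite ge_min lexx orbT].
have : ((expR (- (n%:R * ((c + (c + c1) / 2) / 2))))%:E <= (expR (- (n%:R * ((c + c1) / 2))))%:E)%E.
  apply: le_trans (h1 _ B1) _; apply: le_trans _ (h2 _ B2).
  apply: le_outer_measure => w Hw; split.
    have := Hw 1; rewrite ler01 lexx scale1r => /(_ isT) H1.
    rewrite -(subrKA (x + v')) (le_lt_trans (ler_normD _ _))//.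
    have -> : x + v' - (x + v) = v' - v by rewrite opprD addrACA subrr add0r.
    by lra.
  have Ez : E (n%:R *: u n) by apply: scaled_spaceP => //; exact: Eu.
  apply: hitting_time_gt => //; first exact: cadlag_scaled.
  move=> i t iL tT; apply: lt0r_neq0.
  have := Hw t tT; have := coord_le_norm (scaled_process X n (u n) t w - (x + t *: v')) i.
  have [t0 t1] := andP tT.
  have : `|t * v' ord0 i| <= `|v| + 1.
    rewrite normrM (ger0_norm t0) (@le_trans _ _ `|v' ord0 i|)//.
      by rewrite ler_piMl.
    rewrite (le_trans (coord_le_norm v' i))// -(subrK v v') addrC.
    by rewrite (le_trans (ler_normD _ _))// lerD2l.
  by rewrite !mxE iL /M !ler_norml => /andP[h3 _] /andP[h4 _] h5; lra.
have n0' : 0 < n%:R :> R by rewrite ltr0n.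
by rewrite lee_fin ler_expR lerN2 ler_pM2l// ; lra.
Unshelve. all: by end_near. Qed.

End hypotheses.

(** * The velocity of an absolutely continuous path *)

(** Difference quotients at a minimum are nonpositive on the left and nonnegative on the right. *)
Lemma derive_at_zero_min (R : realType) (f : R -> R) (t : R) :
  derivable f t 1 -> f t = 0 -> (\forall s \near t, 0 <= f s) -> derive1 f t = 0.
Proof.
move=> df ft0 fpos.
have cf : h^-1 *: (f (h + t) - f t) @[h --> 0^'] --> derive1 f t.
  rewrite derive1E; have := df; rewrite /derivable => /cvg_ex[l cl].
  rewrite /derive (cvg_lim _ cl)//; move: cl.
  by under eq_fun do rewrite [_%:A]mulr1.
have near0 : \forall h \near (0 : R), 0 <= f (h + t).
  have : (h + t) @[h --> (0 : R)] --> t.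
    by rewrite -[X in _ --> X]add0r; apply: cvgD; [exact: cvg_id|exact: cvg_cst].
  by move=> /(_ _ fpos).
apply/le_anti/andP; split.
  apply: (cvgr_to_le (cvg_dnbhs_at_left cf)); near=> h.
  have h0 : h < 0 by [].
  rewrite ft0 subr0 /GRing.scale/= mulr_le0_ge0//; first by rewrite invr_le0 ltW.
  by near: h; apply: cvg_at_left_filter near0; exact: cvg_id.
apply: (cvgr_to_ge (cvg_dnbhs_at_right cf)); near=> h.
have h0 : 0 < h by [].
rewrite ft0 subr0 /GRing.scale/= mulr_ge0//; first by rewrite invr_ge0 ltW.
by near: h; apply: cvg_at_right_filter near0; exact: cvg_id.
Unshelve. all: by end_near. Qed.

Section clamp_section.
Variables (R : realType) (T : R).
Hypothesis T0 : 0 <= T.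

Definition clamp (t : R) := Num.max 0 (Num.min t T).

Lemma clamp_itv t : 0 <= clamp t <= T.
Proof. by rewrite /clamp le_max lexx/= ge_max T0/= ge_min lexx orbT. Qed.

Lemma clamp_id t : 0 <= t <= T -> clamp t = t.
Proof. by move=> /andP[t0 tT]; rewrite /clamp min_l// max_r. Qed.

Lemma clamp_nd : nondecreasing clamp.
Proof.
move=> x y xy; rewrite /clamp; have [] := leP x T; have [] := leP y T.
- by move=> _ _; have [] := leP 0 x; have [] := leP 0 y; lra.
- by move=> yT xT; have [] := leP 0 x; have [] := leP 0 T; lra.
- by move=> yT xT; lra.
- by [].
Qed.

Lemma clamp_lip x y : x <= y -> clamp y - clamp x <= y - x.
Proof.
move=> xy; rewrite /clamp; have [] := leP x T; have [] := leP y T.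
- by move=> _ _; have [] := leP 0 x; have [] := leP 0 y; lra.
- by move=> yT xT; have [] := leP 0 x; have [] := leP 0 T; lra.
- by move=> yT xT; lra.
- by rewrite subrr subr_ge0.
Qed.

End clamp_section.

Section path.
Variables (R : realType) (N : nat) (T : R) (phi : R -> 'rV[R]_N).
Hypotheses (T0 : 0 < T) (oT : in_orthant T phi) (acT : absolutely_continuous T phi).
Notation mu := (@lebesgue_measure R).

(** Constant continuation outside [[0, T]], to which results on the whole line apply. *)
Definition phic t := phi (clamp T t).

Lemma phicE t : 0 <= t <= T -> phic t = phi t.
Proof. by move=> tT; rewrite /phic clamp_id. Qed.

Lemma ac_coord i : ac (fun t => phic t ord0 i).
Proof.
move=> e e0; have [d d0 H] := acT e0; exists d => // I a b ab dis lt.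
pose a' (j : 'I_#|I|) := clamp T (a (enum_val j)).
pose b' (j : 'I_#|I|) := clamp T (b (enum_val j)).
have reI (F : I -> R) : \sum_i F i = \sum_(j < #|I|) F (enum_val j).
  by rewrite (reindex_onto enum_val enum_rank) /=; [apply: eq_bigl => j; rewrite enum_valK eqxx|move=> j _; rewrite enum_rankK].
rewrite reI; apply: (@le_lt_trans _ _ (\sum_j `|phi (b' j) - phi (a' j)|)).
  apply: ler_sum => j _; rewrite /phic -/(a' j) -/(b' j).
  by have := coord_le_norm (phi (b' j) - phi (a' j)) i; rewrite !mxE.
apply: H => [j|j1 j2 j12|].
- split; first by have /andP[] := (clamp_itv (ltW T0)) (a (enum_val j)).
  split; first exact: clamp_nd.
  by have /andP[] := (clamp_itv (ltW T0)) (b (enum_val j)).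
- have : enum_val j1 != enum_val j2 by apply: contra j12 => /eqP/enum_val_inj ->.
  by move=> /dis[h|h]; [left|right]; exact: clamp_nd.
- by apply: le_lt_trans lt; rewrite reI; apply: ler_sum => j _; exact: clamp_lip.
Qed.

Lemma phi_uniform e : 0 < e -> exists2 d, 0 < d & forall s t,
  0 <= s <= T -> 0 <= t <= T -> `|s - t| < d -> `|phi s - phi t| < e.
Proof.
move=> /acT[d d0 H]; exists d => //.
have main s t : 0 <= s <= T -> 0 <= t <= T -> s <= t -> t - s < d -> `|phi t - phi s| < e.
  move=> /andP[s0 sT] /andP[t0 tT] st lt.
  have := H 1%N (fun=> s) (fun=> t); rewrite !big_ord1; apply => //.
  by move=> i j; rewrite !ord1.
move=> s t sT tT; have [st|ts] := leP s t => lt.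
  by rewrite distrC; apply: main => //; move: lt; rewrite distrC ger0_norm ?subr_ge0.
by apply: main => //; [exact: ltW|move: lt; rewrite gtr0_norm ?subr_gt0].
Qed.

Lemma phic_continuous : continuous phic.
Proof.
move=> x; apply/cvgrPdist_lt => e e0; have [d d0 H] := phi_uniform e0.
near=> y; apply: H; [exact: (clamp_itv (ltW T0))|exact: (clamp_itv (ltW T0))|].
have xy : `|x - y| < d by near: y; apply: cvgr_dist_lt.
apply: le_lt_trans xy; have [h|h] := leP x y.
  rewrite distrC [in leRHS]distrC !ger0_norm ?subr_ge0 ?clamp_nd//.
  exact: clamp_lip.
rewrite !ger0_norm ?subr_ge0 ?clamp_nd// ?(ltW h)//.
by apply: clamp_lip; exact: ltW.
Unshelve. all: by end_near. Qed.

Lemma phic_coord_continuous i : continuous (fun t => phic t ord0 i).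
Proof. exact: ac_continuous (ac_coord i). Qed.

Lemma rcont_phi a S : 0 <= a -> a + S <= T -> rcont S (fun t => phi (a + t)).
Proof.
move=> a0 aS t /andP[t0 tS].
have at0 : 0 <= a + t <= T by apply/andP; split; lra.
rewrite -(phicE at0).
have : phic (a + s) @[s --> t^'+] --> phic (a + t).
  apply: (@cvg_comp _ _ _ (fun s => a + s) phic _ (nbhs (a + t))); last exact: phic_continuous.
  apply: cvg_at_right_filter; apply: cvgD; [exact: cvg_cst|exact: cvg_id].
apply: cvg_trans; apply: near_eq_cvg; near=> s.
rewrite phicE//; apply/andP; split.
  by rewrite addr_ge0// (le_trans t0)//; near: s; exact: nbhs_right_ge.
have : s <= S by near: s; exact: nbhs_right_le.
by lra.
Unshelve. all: by end_near. Qed.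

(** [G] collects the interior times at which every coordinate has derivative [g]. A coordinate of a
    path in the orthant that vanishes at such a time is at a minimum, hence the last clause. *)
Lemma path_density : exists (g : 'I_N -> R -> R) (G : set R),
  [/\ measurable G, G `<=` `]0, T[%classic, mu (`[0, T]%classic `\` G) = 0%E,
      forall i, mu.-integrable setT (EFin \o g i) &
   [/\ forall i a b, 0 <= a -> a <= b -> b <= T ->
        (phi b ord0 i - phi a ord0 i)%:E = (\int[mu]_(x in `[a, b]) (g i x)%:E)%E,
      forall t, G t -> is_derive t 1 phi (\row_i g i t) &
      forall t, G t -> forall i, phi t ord0 i = 0 -> g i t = 0]].
Proof.
have /choice[g gP] i := ac_fundamental T0 (ac_coord i).
have : {ae mu, forall t, forall i, 0 < t < T -> derivable (fun t => phic t ord0 i) t 1 /\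
    derive1 (fun t => phic t ord0 i) t = g i t}.
  apply: filter_forall.
  by move=> i; case: (gP i).
move=> [A [mA A0 subA]].
have notA t : ~ A t -> forall i, 0 < t < T -> derivable (fun t => phic t ord0 i) t 1 /\
    derive1 (fun t => phic t ord0 i) t = g i t.
  by move=> nA; apply: contrapT => H; apply: nA; exact: subA.
have near_eq t : 0 < t < T -> {near t, phic =1 phi}.
  move=> /andP[t0 tT]; near=> s; apply: phicE; apply/andP; split.
    by rewrite ltW//; near: s; exact: lt_nbhsr.
  by rewrite ltW//; near: s; exact: lt_nbhsl.
have der t : 0 < t < T -> ~ A t -> is_derive t 1 phi (\row_i g i t).
  move=> tT nA.
  have dc : derivable phic t 1.
    by apply/derivable_mxP => j i; rewrite (ord1 j); case: (notA t nA i tT).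
  have dp := near_eq_derivable (near_eq t tT) dc.
  apply: DeriveDef => //.
  have <- : 'D_1 phic t = 'D_1 phi t by apply: near_eq_derive; exact: near_eq.
  rewrite (derive_mx dc).
  apply/matrixP => j i; rewrite !mxE (ord1 j) -derive1E.
  by case: (notA t nA i tT).
exists g, (`]0, T[%classic `\` A); split.
- by apply: measurableD; [exact: measurable_itv|exact: mA].
- by move=> t [].
- apply/eqP; rewrite eq_le measure_ge0 andbT.
  have mAU : measurable (A `|` [set 0; T]) by apply: measurableU => //; apply: measurableU.
  apply: (@le_trans _ _ (mu (A `|` [set 0; T]))).
    have mD : measurable (`[0, T]%classic `\` (`]0, T[%classic `\` A)).
      by apply: measurableD; [exact: measurable_itv|apply: measurableD; [exact: measurable_itv|exact: mA]].
    apply: le_measure; [exact/mem_set|exact/mem_set|].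
    move=> t [/=]; rewrite in_itv/= => /andP[t0 tT] nt.
    have [|nA] := pselect (A t); first by left.
    right; apply: contrapT => t0T; apply: nt; split => //.
    rewrite in_itv/= !lt_neqAle t0 tT !andbT; apply/andP; split.
      by apply/eqP => e; apply: t0T; left.
    by apply/eqP => e; apply: t0T; right.
  rewrite (le_trans (measureU2 _ _ _))//; first by apply: measurableU.
  rewrite [X in (X + _)%E]A0 add0e (le_trans (measureU2 _ _ _))//.
  by rewrite [X in (X + _)%E](lebesgue_measure_set1 0) add0e [X in (X <= _)%E](lebesgue_measure_set1 T).
- by move=> i; case: (gP i).
split.
- move=> i a b a0 ab bT; have [_ + _] := gP i => /(_ a b a0 ab bT).
  by rewrite !phicE//; apply/andP; split; lra.
- by move=> t [/= + nA]; rewrite in_itv/= => tT; exact: der.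
- move=> t [/= + nA] i pt; rewrite in_itv/= => tT.
  have [d1 <-] := notA t nA i tT.
  have /andP[t0 tT'] := tT.
  apply: derive_at_zero_min => //.
    by rewrite phicE// !ltW.
  by apply: (@filterE _ (nbhs (t : R))) => s; apply: oT; exact: (clamp_itv (ltW T0)).
Unshelve. all: by end_near. Qed.
End path.

(** * Compact sets in the cells of a grid *)

Section selection_section.
Variable R : realType.
Notation mu := (@lebesgue_measure R).

Lemma ge0_integral_itv_cat (a b c : R) (f : R -> \bar R) : a <= b -> b <= c ->
  measurable_fun `[a, c] f -> (forall t, t \in `[a, c] -> (0 <= f t)%E) ->
  (\int[mu]_(x in `[a, c]) f x =
   \int[mu]_(x in `[a, b]) f x + \int[mu]_(x in `[b, c]) f x)%E.
Proof.
move=> ab bc mf f0.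
have E : `[a, c]%classic = `[a, b]%classic `|` `]b, c]%classic :> set R.
  by apply: itv_bndbnd_setU; rewrite bnd_simp.
rewrite [in LHS]E ge0_integral_setU//=.
- rewrite integral_itv_obnd_cbnd//; apply: measurable_funS mf => // x.
  by rewrite E => h; right.
- by rewrite -E.
- by move=> x h; apply: f0; have : `[a, c]%classic x by rewrite E.
- apply/disj_setPRL => x /=; rewrite !in_itv/= => /andP[h _]; apply/negP.
  by rewrite negb_and orbC -ltNge h.
Qed.

Lemma compact_separated (A B : set R) : compact A -> compact B -> A `&` B = set0 ->
  \forall e \near (0 : R)^'+, forall x y, A x -> B y -> e <= `|x - y|.
Proof.
move=> cA cB AB0.
have oB : open (~` B) by apply: closed_openC; apply: compact_closed.
have FF : Filter ((0 : R)^'+) by exact: _.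
have H := (@compact_near_coveringP _ A).1 cA _ ((0 : R)^'+) (fun e x => forall y, B y -> e <= `|x - y|) FF.
apply: filterS (H _) => [e He x y Ax By|x Ax]; first exact: He.
have /nbhs_ballP[r /= r0 rB] : nbhs x (~` B).
  by apply: open_nbhs_nbhs; split => // Bx; have : (A `&` B) x by []; rewrite AB0.
near=> x' e => y By /=.
have x'x : `|x - x'| < r / 2 by near: x'; apply: (@cvgr_dist_lt _ R^o _ _ _ id x (@cvg_id _ _) (r / 2)); rewrite divr_gt0.
have er : e <= r / 2 by near: e; apply: nbhs_right_le; rewrite divr_gt0.
have xy : r <= `|x - y|.
  by rewrite leNgt; apply/negP => xy; apply: (rB y).
have := ler_distD x' x y; lra.
Unshelve. all: by end_near. Qed.

Definition cell (T : R) (m j : nat) : set R := `[T * j%:R / m%:R, T * j.+1%:R / m%:R].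

Lemma cells_integral (T : R) m n (f : R -> \bar R) : 0 < T -> (n <= m)%N ->
  measurable_fun `[0, T] f -> (forall t, t \in `[0, T] -> (0 <= f t)%E) ->
  (\sum_(j < n) \int[mu]_(x in cell T m j) f x = \int[mu]_(x in `[0%R, (T * n%:R / m%:R)%R]) f x)%E.
Proof.
move=> T0 + mf f0; elim: n => [|n IH] nm.
  by rewrite big_ord0 mulr0 mul0r set_itv1 integral_set1.
have m0 : 0 < m%:R :> R by rewrite ltr0n (leq_trans _ nm).
rewrite big_ord_recr/= IH ?(ltnW nm)// -ge0_integral_itv_cat//.
- by rewrite !mulr_ge0// ?invr_ge0// ltW.
- by rewrite ler_pM2r ?invr_gt0// ler_pM2l// ler_nat.
- apply: measurable_funS mf => // x /=; rewrite !in_itv/= => /andP[-> h]/=.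
  by rewrite (le_trans h)// ler_pdivrMr// ler_pM2l// ler_nat.
- move=> x; rewrite in_itv/= => /andP[x0 h]; apply: f0; rewrite in_itv/= x0/=.
  by rewrite (le_trans h)// ler_pdivrMr// ler_pM2l// ler_nat.
Qed.

Lemma cells_integralT (T : R) m (f : R -> \bar R) : 0 < T -> (0 < m)%N ->
  measurable_fun `[0, T] f -> (forall t, t \in `[0, T] -> (0 <= f t)%E) ->
  (\sum_(j < m) \int[mu]_(x in cell T m j) f x = \int[mu]_(x in `[0%R, T]) f x)%E.
Proof.
by move=> T0 m0 mf f0; rewrite cells_integral// mulfK// pnatr_eq0 -lt0n.
Qed.

Lemma finite_exhaustion (D : set R) (B : nat -> set R) (d : R) : measurable D ->
  (mu D < +oo)%E -> (forall k, measurable (B k)) -> D `<=` \bigcup_k B k -> 0 < d ->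
  exists n, (mu (D `\` \big[setU/set0]_(k < n) B k) < d%:E)%E.
Proof.
move=> mD Dfin mB DB d0.
pose F n := D `\` \big[setU/set0]_(k < n) B k.
have mF n : measurable (F n) by apply: measurableD => //; apply: bigsetU_measurable.
have F0 : \bigcap_n F n = set0.
  rewrite -subset0 => t Ft; have [Dt _] := Ft 0%N I.
  have [k _ Bk] := DB _ Dt; have [_] := Ft k.+1 I; apply.
  by rewrite big_ord_recr/=; right.
have : mu \o F @ \oo --> mu (\bigcap_n F n).
  apply: nonincreasing_cvg_mu => //.
  - by rewrite /F big_ord0 setD0.
  - by rewrite F0.
  - move=> a b ab; apply/subsetPset => t [Dt nt]; split => // h; apply: nt.
    move: h; rewrite -!bigcup_mkord => -[k /= ka Bk]; exists k => //=.
  exact: leq_trans ab.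
rewrite F0 measure0 => cF.
have /(_ [set x | (x < d%:E)%E]) := cF; rewrite /= => H.
have : \forall n \near \oo, (mu (F n) < d%:E)%E.
  apply: H; apply: (open_nbhs_nbhs); split; last by rewrite /= lte_fin.
  exact: open_ereal_lt_ereal.
by move=> [n _ /(_ n (leqnn n))]; exists n.
Qed.

(* Disjoint compact sets lie at positive distance from each other: a cell of a
   fine enough grid meets at most one of finitely many of them. *)
Lemma selection (T : R) (D : set R) (B : nat -> set R) (rho : nat -> R) (F : R -> R) (e : R) :
  0 < T -> measurable D -> D `<=` `[0, T] -> mu (`[0, T]%classic `\` D) = 0%E ->
  (forall k, measurable (B k)) -> D `<=` \bigcup_k B k -> (forall k, 0 < rho k) ->
  mu.-integrable setT (EFin \o F) -> (forall t, 0 <= F t) -> 0 < e ->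
  exists (m : nat) (S : nat -> set R) (q : nat -> nat),
  [/\ (0 < m)%N, forall j, [/\ compact (S j), S j `<=` cell T m j, S j `<=` D `&` B (q j) & T / m%:R < rho (q j)] &
     (\sum_(j < m) \int[mu]_(x in cell T m j `\` S j) (F x)%:E < e%:E)%E].
Proof.
move=> T0 mD DT DT0 mB DB rho0 intF F0 e0.
(* On sets of measure below [d] the integral of [F] is below [e]: only the lost measure matters from
   here on. *)
have [d [d0 Hd]] := integral_normr_continuous intF e0.
have Tfin : (mu `[0%R, T]%classic < +oo)%E by rewrite lebesgue_measure_itv/= lte_fin T0 ltry.
have Dfin : (mu D < +oo)%E.
  by apply: le_lt_trans Tfin; apply: le_measure => //; exact/mem_set.
have d20 : 0 < d / 2 by rewrite divr_gt0.
have [n nd] := finite_exhaustion mD Dfin mB DB d20.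
pose A k := D `&` seqDU B k.
have mA k : measurable (A k).
  apply: measurableI => //; apply: measurableD => //; apply: bigsetU_measurable => //.
have Afin k : (mu (A k) < +oo)%E.
  by apply: le_lt_trans Dfin; apply: le_measure; [apply: mem_set; exact: mA|apply: mem_set; exact: mD|move=> t []].
(* Half of [d] is for what the first [n] sets leave uncovered; the compact approximations share the
   other half. *)
have en0 : 0 < d / 2 / n.+1%:R by rewrite divr_gt0.
have /choice[C HC] k := lebesgue_regularity_inner (mA k) (Afin k) en0.
pose K := \big[setU/set0]_(k < n) C k.
have mC k : measurable (C k) by apply: compact_measurable; case: (HC k).
have mK : measurable K by apply: bigsetU_measurable.
have muK : (mu (`[0%R, T]%classic `\` K) < d%:E)%E.
  have sub : `[0, T]%classic `\` K `<=` (`[0, T]%classic `\` D) `|`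
     ((D `\` \big[setU/set0]_(k < n) B k) `|` \big[setU/set0]_(k < n) (A k `\` C k)).
    move=> t [tT nK]; have [Dt|] := pselect (D t); last by left.
    right; have [Bt|] := pselect ((\big[setU/set0]_(k < n) B k) t); last by left.
    right; move: Bt; rewrite bigsetU_seqDU -bigcup_mkord => -[k /= kn Bk].
    rewrite -(bigcup_mkord n (fun k => A k `\` C k)); exists k => //; split; first by split.
    by move=> Ck; apply: nK; rewrite /K -bigcup_mkord; exists k.
  have mAC : measurable (\big[setU/set0]_(k < n) (A k `\` C k)).
    by apply: bigsetU_measurable => k _; apply: measurableD.
  have mDB : measurable (D `\` \big[setU/set0]_(k < n) B k).
    by apply: measurableD => //; apply: bigsetU_measurable.
  have mTD : measurable (`[0, T]%classic `\` D) by apply: measurableD.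
  apply: (@le_lt_trans _ _ (mu ((`[0%R, T]%classic `\` D) `|`
     ((D `\` \big[setU/set0]_(k < n) B k) `|` \big[setU/set0]_(k < n) (A k `\` C k))))).
    apply: le_measure => //; apply/mem_set; first by apply: measurableD.
    by apply: measurableU => //; apply: measurableU.
  apply: (le_lt_trans (measureU2 _ _ _)) => //; first by apply: measurableU.
  rewrite [X in (X + _)%E]DT0 add0e.
  apply: (le_lt_trans (measureU2 _ _ _)) => //.
  have AC2 : (mu (\big[setU/set0]_(k < n) (A k `\` C k)) <= (d / 2)%:E)%E.
    apply: (@le_trans _ _ (\sum_(k < n) mu (A k `\` C k))%E).
      by apply: (@Boole_inequality _ _ _ mu (fun k => A k `\` C k) n) => k _; apply: measurableD; [exact: mA|exact: mC].
    apply: (@le_trans _ _ (\sum_(k < n) (d / 2 / n.+1%:R)%:E)%E).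
      by apply: lee_sum => k _; case: (HC k) => _ _ /ltW.
    rewrite sumEFin lee_fin sumr_const card_ord -[leLHS]mulr_natr -(mulrA (d / 2)) ler_piMr//; first exact: ltW.
    by rewrite mulrC ler_pdivrMr// mul1r ler_nat.
  rewrite [d]splitr EFinD; apply: lte_leD => //.
  by rewrite ge0_fin_numE// (le_lt_trans AC2)// ltry.
(* [r] is below the mutual distances of the compact sets and below [rho k] for all [k <= n].
   Including [n] covers the index 0, which cells with an empty set receive, also when [n = 0]. *)
have [r r0 [rsep rrho]] : exists2 r : R, 0 < r & (forall k k' : 'I_n, k != k' -> forall x y, C k x -> C k' y -> r <= `|x - y|) /\ (forall k : 'I_n.+1, r < rho k).
  near ((0 : R)^'+) => r; exists r; first by [].
  split.
    near: r; apply: filter_forall => k; apply: filter_forall => k'.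
    have [->|kk'] := eqVneq k k'; first by apply: nearW.
    apply: filterS (@compact_separated (C k) (C k') _ _ _); last 3 first.
    - by case: (HC k).
    - by case: (HC k').
    - rewrite -subset0 => t [Ckt Ck't].
      have [_ /(_ _ Ckt)[_ ta] _] := HC k; have [_ /(_ _ Ck't)[_ tb] _] := HC k'.
      move: kk' => /eqP; apply; apply: val_inj.
      by apply: (@trivIset_seqDU _ B k k' I I); exists t.
    by move=> r H _; exact: H.
  near: r; apply: filter_forall => k; apply: nbhs_right_lt; exact: rho0.
have [m m0 Tm] : exists2 m : nat, (0 < m)%N & T / m%:R < r.
  exists (Num.truncn (T / r)).+1 => //.
  by rewrite ltr_pdivrMr// mulrC -ltr_pdivrMr// truncnS_gt.
have cellne j k k' x y : (k < n)%N -> (k' < n)%N -> cell T m j x -> cell T m j y -> C k x -> C k' y -> k = k'.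
  move=> kn k'n cx cy Cx Cy; apply/eqP; apply: contraPT Tm => kk'; apply/negP; rewrite -leNgt.
  apply: (le_trans (rsep (Ordinal kn) (Ordinal k'n) kk' _ _ Cx Cy)).
  move: cx cy; rewrite /cell/= !in_itv/= -natr1 mulrDr mulr1 mulrDl => /andP[a b] /andP[c' d'].
  by rewrite ler_norml; lra.
(* In a cell that meets [C k], the set [K] reduces to [C k]; a cell that meets none gets the empty
   set. *)
have HS j : exists Sq : set R * nat, [/\ compact Sq.1, Sq.1 `<=` cell T m j,
   Sq.1 `<=` D `&` B Sq.2, T / m%:R < rho Sq.2 & cell T m j `\` Sq.1 = cell T m j `\` K].
  have [[k [kn [x [cx Cx]]]]|none] := pselect (exists k, (k < n)%N /\ exists x, cell T m j x /\ C k x).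
    exists (cell T m j `&` C k, k); split => /=.
    - apply: compact_closedI; first exact: segment_compact.
      by apply: compact_closed; case: (HC k).
    - by move=> t [].
    - by move=> t [_ Ct]; have [_ /(_ _ Ct)[Dt [Bt _]] _] := HC k.
    - exact: (lt_trans Tm (rrho (widen_ord (leqnSn n) (Ordinal kn)))).
    - apply/seteqP; split => t [ct nt]; split => //.
        rewrite /K -bigcup_mkord => -[k' /= k'n Ck't]; apply: nt; split => //.
        by rewrite (cellne j k k' x t).
      by move=> [_ Ct]; apply: nt; rewrite /K -bigcup_mkord; exists k.
  exists (set0, 0%N); split => //=.
  - exact: compact0.
  - exact: (lt_trans Tm (rrho ord0)).
  - apply/seteqP; split => t [ct nt]; split => //.
    by rewrite /K -bigcup_mkord => -[k' /= k'n Ck't]; apply: none; exists k'; split => //; exists t.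
have {}[Sq HSq] := choice HS.
exists m, (fun j => (Sq j).1), (fun j => (Sq j).2); split => //.
  by move=> j; case: (HSq j).
have mF : measurable_fun setT (EFin \o F) by case/integrableP: intF.
have mFK : measurable_fun `[0, T] ((EFin \o F) \_ (~` K)).
  apply: measurable_funTS; apply/(measurable_restrictT _ (measurableC mK)).
  exact: measurable_funTS.
have FK0 t : (0 <= ((EFin \o F) \_ (~` K)) t)%E by apply: erestrict_ge0 => x _; rewrite lee_fin.
rewrite (eq_bigr (fun j : 'I_m => \int[mu]_(x in cell T m j) ((EFin \o F) \_ (~` K)) x)%E); last first.
  move=> j _; rewrite -integral_mkcondr -setDE.
  by case: (HSq j) => _ _ _ _ ->.
rewrite cells_integralT// -integral_mkcondr -setDE.
have mTK : measurable (`[0, T]%classic `\` K) by apply: measurableD.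
have := Hd _ mTK muK; rewrite /Rintegral.
under eq_integral do rewrite ger0_norm//.
have fin : (\int[mu]_(x in `[0%R, T] `\` K) (EFin \o F) x)%E \is a fin_num.
  by apply: integrable_fin_num => //; apply: integrableS intF.
by rewrite -[X in (_ -> X < _)%E](fineK fin) lte_fin.
Unshelve. all: by end_near. Qed.

End selection_section.

(** * Piecewise linear routes *)

Section routes.
Variables (R : realType) (N : nat) (L : {set 'I_N} -> 'rV[R]_N -> \bar R).
Hypothesis L_ge0 : forall (Lambda : {set 'I_N}) (v : 'rV[R]_N), (0 <= L Lambda v)%E.
Notation mu := (@lebesgue_measure R).
Implicit Types (s : nat -> R) (v : nat -> 'rV[R]_N) (Lam : nat -> {set 'I_N}) (psi : R -> 'rV[R]_N).

(** Each open piece lies in a single face, so that the action is a finite sum; the formula on closed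
    pieces includes continuity at the nodes. *)
Definition pl_data m s v Lam psi :=
  [/\ s 0%N = 0, forall k, (k < m)%N -> s k < s k.+1,
      forall k, (k < m)%N -> forall t, s k <= t <= s k.+1 -> psi t = psi (s k) + (t - s k) *: v k &
      forall k, (k < m)%N -> forall t, s k < t < s k.+1 -> face (Lam k) (psi t)].

(** Only an upper bound [c] of the action is recorded, since concatenation adds such bounds. The
    duration [tau] is free because detours lengthen a path. *)
Definition route tau psi c := in_orthant tau psi /\ exists m s v Lam,
  [/\ pl_data m s v Lam psi, s m = tau &
      (\sum_(k < m) (s k.+1 - s k)%:E * L (Lam k) (v k) <= c%:E)%E].

Lemma nodes_le m s i j : (forall k, (k < m)%N -> s k < s k.+1) ->
  (i <= j <= m)%N -> s i <= s j.
Proof.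
move=> sP /andP[]; elim: j => [|j IH]; first by rewrite leqn0 => /eqP ->.
rewrite leq_eqVlt => /predU1P[->//|ij jm].
by rewrite (le_trans (IH ij (ltnW jm)))// ltW// sP.
Qed.

Lemma pl_data_prefix m n s v Lam psi : (n <= m)%N -> pl_data m s v Lam psi -> pl_data n s v Lam psi.
Proof.
by move=> nm [s0 sP lin fP]; split => // k kn; [apply: sP|apply: lin|apply: fP]; exact: leq_trans nm.
Qed.

Lemma pl_data_lip m s v Lam psi : pl_data m s v Lam psi -> forall t u,
  0 <= t -> t <= u -> u <= s m -> `|psi u - psi t| <= (\sum_(k < m) `|v k|) * (u - t).
Proof.
elim: m => [|m IH] D t u t0 tu um.
  have [s0 _ _ _] := D; have -> : u = t by rewrite s0 in um; lra.
  by rewrite !subrr normr0 mulr0.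
have {}IH := IH (pl_data_prefix (leqnSn m) D).
have [s0 sP lin fP] := D.
have S0 : 0 <= \sum_(k < m) `|v k| by apply: sumr_ge0.
rewrite big_ord_recr/= mulrDl.
have piece t' u' : s m <= t' -> t' <= u' -> u' <= s m.+1 -> `|psi u' - psi t'| = `|v m| * (u' - t').
  move=> mt tu' um'; rewrite (lin m (ltnSn m) u') ?(lin m (ltnSn m) t'); last 2 first.
  - by rewrite mt (le_trans tu').
  - by rewrite (le_trans mt).
  rewrite opprD addrACA subrr add0r -scalerBl normrZ mulrC ger0_norm ?opprB ?addrA ?subrK//.
  by lra.
have [umm|mu'] := leP u (s m).
  by rewrite (le_trans (IH t u t0 tu umm))// lerDl mulr_ge0// subr_ge0.
have [mt|tm] := leP (s m) t.
  by rewrite piece// lerDr mulr_ge0// subr_ge0.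
have := IH t (s m) t0 (ltW tm) (lexx _); have := piece (s m) u (lexx _) (ltW mu') um.
move=> h1 h2; have := ler_distD (psi (s m)) (psi u) (psi t); rewrite h1 => h3.
apply: (le_trans h3); rewrite addrC; apply: lerD.
  by apply: (le_trans h2); apply: ler_wpM2l => //; lra.
by apply: ler_wpM2l => //; lra.
Qed.

Lemma pl_data_continuous m s v Lam psi : pl_data m s v Lam psi ->
  {within `[0, s m], continuous psi}.
Proof.
move=> D; have := pl_data_lip D; set K := \sum_(k < m) _ => lip.
have K0 : 0 <= K by apply: sumr_ge0.
have sm0 : 0 <= s m.
  by have [s0 sP _ _] := D; rewrite -s0; apply: (nodes_le sP); rewrite leqnn.
apply: (@subspace_eq_continuous _ _ _ (fun t => psi (clamp (s m) t))).
  by move=> t /set_mem /=; rewrite in_itv/= => tT; rewrite clamp_id.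
apply: continuous_subspaceT => x; apply/cvgrPdist_lt => e e0.
near=> y.
have xy : `|x - y| < e / (K + 1).
  by near: y; apply: (@cvgr_dist_lt _ R^o _ _ _ id x (@cvg_id _ _)); rewrite divr_gt0// ltr_wpDl.
have aux a b : a <= b -> `|psi (clamp (s m) b) - psi (clamp (s m) a)| <= K * (b - a).
  move=> ab; have /andP[a0 aT] := clamp_itv sm0 a; have /andP[b0 bT] := clamp_itv sm0 b.
  have ab' := clamp_nd (s m) ab; apply: (le_trans (lip _ _ a0 ab' bT)).
  by apply: ler_wpM2l => //; exact: clamp_lip.
have : `|psi (clamp (s m) x) - psi (clamp (s m) y)| <= K * `|x - y|.
  have [xy'|yx] := leP x y.
    by rewrite distrC [in leRHS]distrC [in leRHS]ger0_norm ?subr_ge0//; exact: aux.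
  by rewrite [in leRHS]gtr0_norm ?subr_gt0//; apply: aux; exact: ltW.
move=> h; apply: (le_lt_trans h); apply: (@le_lt_trans _ _ ((K + 1) * `|x - y|)).
  by rewrite ler_wpM2r// lerDl.
by rewrite mulrC -ltr_pdivlMr// ltr_wpDl.
Unshelve. all: by end_near. Qed.

Lemma route_pl T psi c : route T psi c -> piecewise_linear T psi.
Proof.
move=> [_ [m [s [v [Lam [D <- _]]]]]]; split; first exact: pl_data_continuous D.
exists m, s; case: D => s0 sP lin _; split => // k km.
exists (psi (s k) - s k *: v k), (v k) => t /andP[st ts].
by rewrite (lin k km t) ?ltW// scalerBl addrAC addrA.
Qed.

Lemma route_orthant T psi c : route T psi c -> in_orthant T psi. Proof. by case. Qed.

Lemma route0 x : orthant x -> route 0 (cst x) 0.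
Proof.
move=> ox; split; first by move=> t _.
by exists 0%N, (fun=> 0), (fun=> 0), (fun=> finset.set0); split => //; rewrite big_ord0.
Qed.

Definition snoc tau psi (w : 'rV[R]_N) t := if t <= tau then psi t else psi tau + (t - tau) *: w.

Lemma route_snoc tau psi c sigma (Lambda : {set 'I_N}) w c' : 0 <= tau -> route tau psi c -> 0 < sigma ->
  orthant (psi tau + sigma *: w) ->
  (forall t, 0 < t < sigma -> face Lambda (psi tau + t *: w)) ->
  (sigma%:E * L Lambda w <= c'%:E)%E ->
  route (tau + sigma) (snoc tau psi w) (c + c').
Proof.
move=> tau0 [oT [m [s [v [Lam [D stau cost]]]]]] sg0 oe fw cw.
have [s0 sP lin fP] := D.
split.
  move=> t /andP[t0 ts]; rewrite /snoc; case: leP => [tt|tt]; first by apply: oT; rewrite t0.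
  have [->|ts'] := eqVneq t (tau + sigma); first by rewrite addrAC subrr add0r.
  have [] // := fw (t - tau); apply/andP; split; first by lra.
  by have : t < tau + sigma by [rewrite lt_neqAle ts' ts]; lra.
pose upd (T : Type) (f : nat -> T) (x : T) n k := if k == n then x else f k.
exists m.+1, (upd _ s (tau + sigma) m.+1), (upd _ v w m), (upd _ Lam Lambda m).
have ne k : (k < m)%N -> (k == m.+1) = false /\ (k.+1 == m.+1) = false /\ (k == m) = false.
  by move=> km; rewrite eqSS !ltn_eqF// ltnS ltnW.
have mm : (m == m.+1) = false by rewrite ltn_eqF.
split.
- split => [|k|k|k]; rewrite /upd //= ltnS leq_eqVlt.
  + move=> /predU1P[->|km]; first by rewrite mm eqxx stau ltrDl.
    by have [-> [-> _]] := ne k km; exact: sP.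
  + move=> /predU1P[->|km] t.
      rewrite mm !eqxx stau => /andP[h1 h2]; rewrite /snoc lexx; case: leP => // tt.
      have -> : t = tau by apply/le_anti/andP; split.
      by rewrite subrr scale0r addr0.
    have [-> [-> ->]] := ne k km => /[dup] /andP[h1 h2] h.
    have skt : s k.+1 <= tau by rewrite -stau; apply: (nodes_le sP); rewrite km leqnn.
    rewrite /snoc (le_trans h2 skt) (le_trans (ltW (sP k km)) skt).
    exact: lin.
  + move=> /predU1P[->|km] t.
      rewrite mm !eqxx stau => /andP[h1 h2]; rewrite /snoc leNgt h1/=.
      by apply: fw; lra.
    have [-> [-> ->]] := ne k km => /[dup] /andP[h1 h2] h.
    have skt : s k.+1 <= tau by rewrite -stau; apply: (nodes_le sP); rewrite km leqnn.
    by rewrite /snoc (le_trans (ltW h2) skt); exact: fP.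
- by rewrite /upd eqxx.
- rewrite big_ord_recr [leRHS]EFinD/=; apply: leeD.
    rewrite (eq_bigr (fun k : 'I_m => (s k.+1 - s k)%:E * L (Lam k) (v k))%E)//.
    by move=> k _; rewrite /upd; have [-> [-> ->]] := ne k (ltn_ord k).
  by rewrite /upd mm !eqxx stau addrAC subrr add0r.
Qed.

(** Pieces after [T] are dropped and the one containing [T] is cut; as [L] is nonnegative, the cost
    does not increase. *)
Lemma route_truncate tau psi c T : 0 <= T -> T <= tau -> route tau psi c -> route T psi c.
Proof.
move=> T0 Tt [oT [m [s [v [Lam [D stau cost]]]]]]; split.
  by move=> t /andP[t0 tT]; apply: oT; rewrite t0 (le_trans tT).
rewrite -stau in Tt; clear stau oT.
elim: m D Tt cost => [|m IH] D Tt cost.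
  exists 0%N, s, v, Lam; split => //; have [s0 _ _ _] := D.
  by rewrite s0 in Tt *; lra.
have [Tm|mT] := leP T (s m).
  apply: IH => //; first exact: pl_data_prefix D.
  apply: le_trans cost; rewrite big_ord_recr/= leeDl// mule_ge0// lee_fin subr_ge0 ltW//.
  by case: D => _ + _ _; apply.
have [s0 sP lin fP] := D.
pose s' k := if k == m.+1 then T else s k.
have ne k : (k < m)%N -> (k == m.+1) = false /\ (k.+1 == m.+1) = false.
  by move=> km; rewrite eqSS !ltn_eqF// ltnS ltnW.
have mm : (m == m.+1) = false by rewrite ltn_eqF.
exists m.+1, s', v, Lam; split.
- split => [|k|k|k]; rewrite /s' //= ltnS leq_eqVlt.
  + move=> /predU1P[->|km]; first by rewrite mm eqxx.
    by have [-> ->] := ne k km; apply: sP; exact: ltnW.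
  + move=> /predU1P[->|km] t.
      by rewrite mm eqxx => /andP[h1 h2]; apply: lin => //; rewrite h1 (le_trans h2).
    by have [-> ->] := ne k km; apply: lin; exact: ltnW.
  + move=> /predU1P[->|km] t.
      by rewrite mm eqxx => /andP[h1 h2]; apply: fP => //; rewrite h1 (lt_le_trans h2).
    by have [-> ->] := ne k km; apply: fP; exact: ltnW.
- by rewrite /s' eqxx.
- apply: le_trans cost; apply: lee_sum => k _; apply: lee_wpmul2r => //.
  rewrite lee_fin /s'; have := ltn_ord k; rewrite ltnS leq_eqVlt => /predU1P[->|km].
    by rewrite mm eqxx lerB.
  by have [-> ->] := ne k km.
Qed.

Let integrand psi t := L (pos_coords (psi t)) (derive1 psi t).

Lemma pl_data_integrand m s v Lam psi k t : pl_data m s v Lam psi -> (k < m)%N ->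
  s k < t < s k.+1 -> integrand psi t = L (Lam k) (v k).
Proof.
move=> [s0 sP lin fP] km st; have /andP[t1 t2] := st.
rewrite /integrand; have [_ ->] := fP k km t st.
congr (L _ _); rewrite derive1E.
have -> : 'D_1 psi t = 'D_1 (fun u => psi (s k) + (u - s k) *: v k) t.
  apply: near_eq_derive; near=> u; apply: lin => //; apply/andP; split; apply: ltW.
    by near: u; exact: lt_nbhsr.
  by near: u; exact: lt_nbhsl.
apply: cvg_lim => //; apply: cvg_near_cst; near=> h.
have h0 : h != 0 by near: h; exact: nbhs_dnbhs_neq.
rewrite /= opprD addrACA subrr add0r -scalerBl [h%:A]mulr1 opprB addrA subrK addrK scalerA mulVf// scale1r//.
Unshelve. all: by end_near. Qed.

Lemma pl_data_action m s v Lam psi : pl_data m s v Lam psi ->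
  action L (s m) psi = (\sum_(k < m) (s k.+1 - s k)%:E * L (Lam k) (v k))%E.
Proof.
(* Measurability is carried along the induction, as splitting the integral requires it. *)
move=> D; suff [_ //] : measurable_fun `[0, s m] (integrand psi) /\
    action L (s m) psi = (\sum_(k < m) (s k.+1 - s k)%:E * L (Lam k) (v k))%E.
elim: m D => [|m IH] D.
  have [s0 _ _ _] := D; rewrite s0 /action set_itv1 big_ord0; split; first exact: measurable_fun_set1.
  by rewrite integral_set1.
have [s0 sP lin fP] := D.
have [mI aI] := IH (pl_data_prefix (leqnSn m) D).
have sm0 : 0 <= s m by rewrite -s0; apply: (nodes_le sP); rewrite leqnSn.
have smm := sP m (ltnSn m).
have Eopen : {in `]s m, s m.+1[, cst (L (Lam m) (v m)) =1 integrand psi}.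
  by move=> t; rewrite in_itv/= => st; rewrite (pl_data_integrand D (ltnSn m) st).
have mopen : measurable_fun `]s m, s m.+1[ (integrand psi).
  apply: (eq_measurable_fun (cst (L (Lam m) (v m)))); last exact: measurable_cst.
  by move=> t /set_mem /Eopen.
have E2 : `]s m, s m.+1]%classic = `]s m, s m.+1[%classic `|` `[s m.+1, s m.+1]%classic :> set R.
  by apply: itv_bndbnd_setU; rewrite bnd_simp.
have moc : measurable_fun `]s m, s m.+1] (integrand psi).
  rewrite E2; apply/measurable_funU => //; split => //.
  rewrite set_itv1; exact: measurable_fun_set1.
have E1 : `[0, s m.+1]%classic = `[0, s m]%classic `|` `]s m, s m.+1]%classic :> set R.
  by apply: itv_bndbnd_setU; rewrite bnd_simp// ltW.
have mall : measurable_fun `[0, s m.+1] (integrand psi).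
  by rewrite E1; apply/measurable_funU.
split => //.
rewrite /action (@ge0_integral_itv_cat _ _ (s m))//; last exact: ltW smm.
rewrite big_ord_recr/=; congr (_ + _)%E; first exact: aI.
rewrite -integral_itv_obnd_cbnd// -integral_itv_bndo_bndc//.
rewrite (eq_integral (cst (L (Lam m) (v m)))); last first.
  by move=> t /set_mem /Eopen.
rewrite integral_cst//= lebesgue_measure_itv/= lte_fin smm -EFinB muleC//.
Qed.

Lemma route_action T psi c : route T psi c -> (action L T psi <= c%:E)%E.
Proof. by move=> [_ [m [s [v [Lam [D <- cost]]]]]]; rewrite (pl_data_action D). Qed.

(** An affine function that is positive at [x] and zero at [y] is negative beyond [y]; the point
    halfway from [y] to the end of the interval shows it. *)
Lemma affine_sign (a b p q x y : R) : (forall t, p < t < q -> 0 <= a + t * b) ->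
  p < x < q -> p < y < q -> 0 < a + x * b -> 0 < a + y * b.
Proof.
move=> H /andP[px xq] /andP[py yq] fx; rewrite lt_neqAle H ?py ?yq// andbT eq_sym.
apply/negP => /eqP fy.
have [xy|yx] := ltP x y.
  have : 0 <= a + ((y + q) / 2) * b by apply: H; lra.
  by nra.
have {}yx : y < x.
  by rewrite lt_neqAle yx andbT; apply/eqP => e; rewrite e in fy; lra.
have : 0 <= a + ((y + p) / 2) * b by apply: H; lra.
by nra.
Qed.

(** Continuity extends the affine formulas from open to closed pieces. By [affine_sign] the positive
    coordinates do not change inside a piece, so that the face at its midpoint is the face of the
    whole piece. *)
Lemma route_of_piecewise_linear T psi c : 0 < T -> in_orthant T psi -> piecewise_linear T psi ->
  (action L T psi <= c%:E)%E -> route T psi c.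
Proof.
move=> T0 oT [cpsi [m [s [s0 sT sP lin]]]] cost; split => //.
have /choice[av avP] : forall k, exists av : 'rV[R]_N * 'rV[R]_N, (k < m)%N ->
    forall t, s k < t < s k.+1 -> psi t = av.1 + t *: av.2.
  move=> k; have [km|] := boolP (k < m)%N; last by exists (0, 0).
  by have [a [v H]] := lin k km; exists (a, v) => _; exact: H.
have sle i j : (i <= j <= m)%N -> s i <= s j by exact: nodes_le.
have Tk k : (k < m)%N -> 0 <= s k /\ s k.+1 <= T.
  move=> km; rewrite -s0 -sT; split; apply: (nodes_le sP); first by rewrite leq0n ltnW.
  by rewrite km leqnn.
have /(continuous_within_itvP _ T0)[cin c0 cT] := cpsi.
have cl k : (k < m)%N -> psi x @[x --> (s k)^'+] --> psi (s k).
  move=> km; have [k0 kT] := Tk k km; have kk := sP k km.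
  have [<-//|ne] := eqVneq 0 (s k).
  apply: cvg_at_right_filter; apply: cin; rewrite in_itv/= lt_neqAle ne k0/=.
  exact: lt_le_trans kT.
have cr k : (k < m)%N -> psi x @[x --> (s k.+1)^'-] --> psi (s k.+1).
  move=> km; have [k0 kT] := Tk k km; have kk := sP k km.
  have [->//|ne] := eqVneq (s k.+1) T.
  apply: cvg_at_left_filter; apply: cin; rewrite in_itv/= (le_lt_trans k0 kk)/=.
  by rewrite lt_neqAle ne kT.
have caff (a w : 'rV[R]_N) (x : R) : a + t *: w @[t --> x] --> a + x *: w.
  by apply: cvgD; [exact: cvg_cst|apply: cvgZr_tmp; exact: cvg_id].
have closed k t : (k < m)%N -> s k <= t <= s k.+1 -> psi t = (av k).1 + t *: (av k).2.
  move=> km /andP[t1 t2]; have kk := sP k km.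
  have [->|n1] := eqVneq t (s k).
    apply: (cvg_unique (F := psi x @[x --> (s k)^'+]) _ (cl k km)) => //.
    have := cvg_at_right_filter (caff (av k).1 (av k).2 (s k)).
    apply: cvg_trans; apply: near_eq_cvg; near=> x; rewrite (avP k km)//; apply/andP; split => //.
  have [->|n2] := eqVneq t (s k.+1).
    apply: (cvg_unique (F := psi x @[x --> (s k.+1)^'-]) _ (cr k km)) => //.
    have := cvg_at_left_filter (caff (av k).1 (av k).2 (s k.+1)).
    apply: cvg_trans; apply: near_eq_cvg; near=> x; rewrite (avP k km)//; apply/andP; split => //.
  by apply: avP => //; rewrite !lt_neqAle t1 t2 n2 eq_sym n1.
pose mid k := (s k + s k.+1) / 2.
have D : pl_data m s (fun k => (av k).2) (fun k => pos_coords (psi (mid k))) psi.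
  split => // k km t.
    move=> tk; rewrite (closed k) ?(closed k (s k))//; last by rewrite lexx ltW// sP.
    by rewrite -addrA -scalerDl [s k + _]addrC subrK.
  move=> tk; have [k0 kT] := Tk k km; have kk := sP k km; have /andP[t1 t2] := tk.
  have midk : s k < mid k < s k.+1 by rewrite /mid; lra.
  split; first by apply: oT; lra.
  have key i x y : s k < x < s k.+1 -> s k < y < s k.+1 -> 0 < psi x ord0 i -> 0 < psi y ord0 i.
    move=> xk yk; rewrite !(avP k km)// !mxE; apply: affine_sign xk yk => z zk.
    have : 0 <= psi z ord0 i by have /andP[z1 z2] := zk; apply: oT; lra.
    by rewrite (avP k km)// !mxE.
  apply/setP => i; rewrite !finset.inE; apply/idP/idP; exact: key.
exists m, s, (fun k => (av k).2), (fun k => pos_coords (psi (mid k))); split => //.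
by rewrite -(pl_data_action D) sT.
Unshelve. all: by end_near. Qed.

End routes.

(** * Convexity and cheap moves *)

Section convex.
Variables (R : realType) (N : nat) (f : 'rV[R]_N -> \bar R).
Hypotheses (f_convex : convex_ereal f) (f_ge0 : forall v, (0 <= f v)%E).

Lemma convex_le (u v : 'rV[R]_N) (a K : R) : 0 <= a -> a <= 1 ->
  (f u <= K%:E)%E -> (f v <= K%:E)%E -> (f (a *: u + (1 - a) *: v)%R <= K%:E)%E.
Proof.
move=> a0 a1 fu fv; apply: (le_trans (f_convex u v a0 a1)).
apply: (@le_trans _ _ (a%:E * K%:E + (1 - a)%:E * K%:E)%E).
  by apply: leeD; apply: lee_wpmul2l => //; rewrite lee_fin ?subr_ge0.
by rewrite -!EFinM -EFinD lee_fin -mulrDl addrC subrK mul1r.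
Qed.

(* Induction on the number of coordinates allowed to be nonzero: halving
   decouples one coordinate from the preceding ones. *)
Lemma convex_small_ball : (\forall v \near (0 : 'rV[R]_N), (f v < +oo)%E) ->
  exists r K : R, [/\ 0 < r, r <= 1, 0 <= K & forall v, `|v| <= r -> (f v <= K%:E)%E].
Proof.
move=> /nbhs_ballP[e /= e0 He].
have fin v : `|v| < e -> (f v <= (fine (f v))%:E)%E.
  move=> ve; have : (f v < +oo)%E by apply: He; rewrite -ball_normE/= sub0r normrN.
  by move=> h; rewrite fineK// ge0_fin_numE.
have main j : (j <= N)%N -> exists r K : R, [/\ 0 < r, r <= 1, 0 <= K &
    forall v : 'rV[R]_N, (forall i : 'I_N, (j <= i)%N -> v ord0 i = 0) -> `|v| <= r -> (f v <= K%:E)%E].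
  elim: j => [_|j IH jN].
    exists 1, (fine (f 0)); split => //; first by rewrite fine_ge0.
    move=> v v0 _; have -> : v = 0 by apply/rowP => i; rewrite v0// mxE.
    by apply: fin; rewrite normr0.
  have [r [K [r0 r1 K0 HK]]] := IH (ltnW jN).
  pose i0 := Ordinal jN; pose rho := e / 2; have rho0 : 0 < rho by rewrite divr_gt0.
  pose u : 'rV[R]_N := delta_mx ord0 i0.
  have nu a : `|a *: u| <= `|a|.
    apply: norm_le_coord => // i; rewrite !mxE eqxx/=.
    by case: (i == i0); rewrite ?mulr1// mulr0 normr0.
  (* By convexity, bounds at the two ends of a segment of the current axis hold all along it. *)
  pose M := Num.max (fine (f (rho *: u))) (fine (f (- rho *: u))).
  have M1 : (f (rho *: u) <= M%:E)%E.
    apply: (@le_trans _ _ (fine (f (rho *: u)))%:E); last by rewrite lee_fin le_max lexx.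
    by apply: fin; rewrite (le_lt_trans (nu _))// gtr0_norm// /rho; lra.
  have M2 : (f (- rho *: u) <= M%:E)%E.
    apply: (@le_trans _ _ (fine (f (- rho *: u)))%:E); last by rewrite lee_fin le_max lexx orbT.
    by apply: fin; rewrite (le_lt_trans (nu _))// normrN gtr0_norm// /rho; lra.
  have axis a : `|a| <= rho -> (f (a *: u) <= M%:E)%E.
    move=> ar; have -> : a *: u = ((1 + a / rho) / 2) *: (rho *: u) + (1 - (1 + a / rho) / 2) *: (- rho *: u).
      rewrite !scalerA -scalerDl; congr (_ *: _).
      by field; rewrite gt_eqF.
    have /andP[a1 a2] : -1 <= a / rho <= 1.
      by rewrite -ler_norml normrM normfV (gtr0_norm rho0) ler_pdivrMr// mul1r.
    by apply: convex_le => //; lra.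
  (* Halved, because both components of [v] are doubled in the decomposition below. *)
  exists (Num.min r rho / 2), (Num.max K M); split.
  - by rewrite divr_gt0// lt_min r0.
  - have : Num.min r rho <= r by rewrite ge_min lexx.
    by have : 0 < Num.min r rho by [rewrite lt_min r0 rho0]; lra.
  - by rewrite le_max K0.
  move=> v v0 vr.
  have vr1 : `|v| <= r / 2 by apply: (le_trans vr); rewrite ler_pM2r// ge_min lexx.
  have vr2 : `|v| <= rho / 2 by apply: (le_trans vr); rewrite ler_pM2r// ge_min lexx orbT.
  pose c := v ord0 i0; pose v' := v - c *: u.
  have v'E i : v' ord0 i = if i == i0 then 0 else v ord0 i.
    rewrite !mxE eqxx/=; case: eqVneq => [->|_]; last by rewrite mulr0 subr0.
    by rewrite mulr1 subrr.
  have cr : `|c| <= `|v| by exact: coord_le_norm.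
  (* [v] is the midpoint of twice its part along the preceding coordinates and twice its part along
     the current axis. *)
  have -> : v = 2^-1 *: (2 *: v') + (1 - 2^-1) *: ((2 * c) *: u).
    rewrite !scalerA mulVf// scale1r mulrA (_ : (1 - 2^-1) * 2 = 1 :> R); last by field.
    by rewrite mul1r /v' subrK.
  apply: convex_le; rewrite ?invr_ge0// ?invf_le1//; first by rewrite ler1n.
    apply: (@le_trans _ _ K%:E); last by rewrite lee_fin le_max lexx.
    apply: HK => [i ji|].
      rewrite mxE v'E; case: eqVneq => [_|ne]; first by rewrite mulr0.
      rewrite v0 ?mulr0// ltn_neqAle ji andbT; apply: contra ne => /eqP e1.
      exact/eqP/val_inj.
    rewrite normrZ ger0_norm// -ler_pdivlMl// mulrC.
    apply: norm_le_coord; first by rewrite divr_ge0// ltW.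
    move=> i; rewrite v'E; case: eqVneq => _; first by rewrite normr0 divr_ge0// ltW.
    exact: le_trans (coord_le_norm _ _) vr1.
  apply: (@le_trans _ _ M%:E); last by rewrite lee_fin le_max lexx orbT.
  by apply: axis; rewrite normrM ger0_norm//; lra.
have [r [K [r0 r1 K0 HK]]] := main N (leqnn N).
exists r, K; split => // v vr; apply: HK => // i.
by rewrite leqNgt ltn_ord.
Qed.

End convex.

Section connect.
Variables (R : realType) (N : nat) (L : {set 'I_N} -> 'rV[R]_N -> \bar R).
Implicit Types (psi : R -> 'rV[R]_N) (x y w : 'rV[R]_N).

Lemma route_ge0 tau psi c : route L tau psi c -> 0 <= tau.
Proof.
move=> [_ [m [s [v [Lam [[s0 sP _ _] <- _]]]]]].
by rewrite -s0; apply: (nodes_le sP); rewrite leq0n leqnn.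
Qed.

Lemma route_le tau psi c c' : c <= c' -> route L tau psi c -> route L tau psi c'.
Proof.
move=> cc [ot [m [s [v [Lam [D e cost]]]]]]; split => //; exists m, s, v, Lam; split => //.
by apply: (le_trans cost); rewrite lee_fin.
Qed.

Definition extends tau psi psi' := forall t, t <= tau -> psi' t = psi t.

Lemma route_segment tau psi c sigma (Lambda : {set 'I_N}) w c' : route L tau psi c -> 0 < sigma ->
  orthant (psi tau + sigma *: w) ->
  (forall t, 0 < t < sigma -> face Lambda (psi tau + t *: w)) ->
  (sigma%:E * L Lambda w <= c'%:E)%E ->
  exists psi', [/\ route L (tau + sigma) psi' (c + c'), extends tau psi psi',
    psi' (tau + sigma) = psi tau + sigma *: w &
    forall t, tau <= t <= tau + sigma -> `|psi' t - psi tau| <= sigma * `|w|].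
Proof.
move=> rt s0 oe fw cost; exists (snoc tau psi w); split.
- exact: (route_snoc (route_ge0 rt) rt s0 oe fw cost).
- by move=> t tt; rewrite /snoc tt.
- by rewrite /snoc gerDl leNgt s0/= addrAC subrr add0r.
- move=> t /andP[t1 t2]; rewrite /snoc; case: (leP t tau) => [tt|tt].
    have -> : t = tau by apply/le_anti/andP; split.
    by rewrite subrr normr0 mulr_ge0// ltW.
  rewrite addrAC subrr add0r normrZ ler_wpM2r// ger0_norm ?subr_ge0//.
  by rewrite lerBlDl.
Qed.

Variables (r K : R).
Hypotheses (r0 : 0 < r) (r1 : r <= 1).
Hypothesis rK : forall v, `|v| <= r -> (L [set: 'I_N]%SET v <= K%:E)%E.

Lemma face_setT x : (forall i, 0 < x ord0 i) -> face [set: 'I_N]%SET x.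
Proof.
by move=> H; apply: faceP => [i _|i]; [exact: H|rewrite finset.inE].
Qed.

(* A detour through the interior of the orthant, along which only
   [L setT] matters. *)
Lemma route_connect tau psi c h y : route L tau psi c -> 0 < h -> orthant y ->
  `|y - psi tau| <= r * h / 2 ->
  exists psi', [/\ route L (tau + 2 * h) psi' (c + 2 * h * K), extends tau psi psi',
    psi' (tau + 2 * h) = y &
    forall t, tau <= t <= tau + 2 * h -> `|psi' t - psi tau| <= 2 * h].
Proof.
move=> rt h0 oy yr; set x := psi tau in yr *.
have tau0 := route_ge0 rt.
have ox : orthant x by apply: (route_orthant rt); rewrite tau0 lexx.
(* Moving along the diagonal at speed at most [r / 2] for a time [h] makes all coordinates positive.
   The remaining displacement is at most [r * h / 2 + r * h / 2], which a speed at most [r] covers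
   in another time [h]. *)
pose w1 : 'rV[R]_N := const_mx (r / 2).
have r20 : 0 < r / 2 by rewrite divr_gt0.
have nw1 : `|w1| <= r / 2.
  by apply: norm_le_coord; [exact: ltW|move=> i; rewrite mxE gtr0_norm].
have r21 : r / 2 <= 1 by rewrite ler_pdivrMr// mul1r (le_trans r1)// ler1n.
have w11 : `|w1| <= 1 by apply: (le_trans nw1).
have h2 : h * 1 <= 2 * h by lra.
have pos1 t : 0 < t -> forall i, 0 < (x + t *: w1) ord0 i.
  by move=> t0 i; rewrite !mxE ltr_wpDl ?mulr_gt0//; exact: ox.
have [|||psi1 [rt1 ex1 end1 d1]] := @route_segment tau psi c h [set: 'I_N]%SET w1 (h * K) rt h0.
- by move=> i; apply: ltW; exact: pos1.
- by move=> t /andP[t0 _]; apply: face_setT; exact: pos1.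
- rewrite EFinM; apply: lee_wpmul2l; first by rewrite lee_fin ltW.
  by apply: rK; apply: (le_trans nw1); lra.
set m := x + h *: w1 in end1.
pose w2 := h^-1 *: (y - m).
have nym : `|y - m| <= r * h.
  rewrite /m opprD addrA; apply: (le_trans (ler_normB _ _)).
  rewrite normrZ gtr0_norm//; have : h * `|w1| <= h * (r / 2) by rewrite ler_pM2l.
  by move: yr; lra.
have nw2 : `|w2| <= r by rewrite /w2 normrZ gtr0_norm ?invr_gt0// ler_pdivrMl// mulrC.
have em : m + h *: w2 = y by rewrite /w2 scalerA mulfV ?gt_eqF// scale1r addrC subrK.
have [|||psi2 [rt2 ex2 end2 d2]] := @route_segment (tau + h) psi1 (c + h * K) h [set: 'I_N]%SET w2 (h * K) rt1 h0.
- by rewrite end1 em.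
- move=> t /andP[t0 th]; apply: face_setT => i; rewrite end1.
  have m0 : 0 < m ord0 i by exact: pos1.
  have y0 := oy i.
  have -> : (m + t *: w2) ord0 i = (1 - t / h) * m ord0 i + (t / h) * y ord0 i.
    have gen (a b : 'rV[R]_N) : (a + t *: (h^-1 *: (b - a))) ord0 i = (1 - t / h) * a ord0 i + (t / h) * b ord0 i.
      by rewrite !mxE; field; rewrite gt_eqF.
    exact: gen.
  apply: ltr_wpDr; first by rewrite mulr_ge0// divr_ge0// ltW.
  by rewrite mulr_gt0// subr_gt0 ltr_pdivrMr// mul1r.
- by rewrite EFinM; apply: lee_wpmul2l; [rewrite lee_fin ltW|exact: rK].
have tE : tau + 2 * h = tau + h + h by lra.
exists psi2; rewrite tE; split.
- by apply: route_le rt2; lra.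
- by move=> t tt; rewrite ex2 ?ex1//; lra.
- by rewrite end2 end1 em.
move=> t /andP[t1 t2].
have [th|th] := leP t (tau + h).
  rewrite ex2//; apply: (le_trans (d1 _ _)); first by rewrite t1 th.
  by apply: le_trans h2; rewrite ler_pM2l.
have D2 : `|psi2 t - m| <= h * r.
  rewrite -end1; apply: (le_trans (d2 _ _)); first by rewrite t2 ltW.
  by rewrite ler_pM2l.
have D1 : `|m - x| <= h * (r / 2).
  by rewrite /m addrAC subrr add0r normrZ gtr0_norm// ler_pM2l.
apply: (le_trans (ler_distD m _ _)); have -> : 2 * h = h * 1 + h * 1 by ring.
apply: lerD; first by apply: (le_trans D2); rewrite ler_pM2l.
by apply: (le_trans D1); rewrite ler_pM2l.
Qed.

End connect.

Section rate.
Variables (R : realType) (N : nat) (L : {set 'I_N} -> 'rV[R]_N -> \bar R).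

Let rate_in T phi delta := ereal_inf [set action L T psi | psi in [set psi : R -> 'rV[R]_N |
         [/\ in_orthant T psi, piecewise_linear T psi &
             (skorohod_dist T phi psi < delta%:E)%E]]].

Lemma rate_funE T phi : rate_fun L T phi = ereal_sup [set rate_in T phi x | x in [set x | 0 < x]].
Proof.
apply: lim_right0_ni => x y x0 xy; apply: le_ereal_inf_tmp => _ [psi [ot p dist] <-].
apply: ereal_inf_lbound; exists psi => //; split => //.
by apply: (lt_le_trans dist); rewrite lee_fin.
Qed.

Lemma rate_fun_le T phi c : (forall delta, 0 < delta -> exists psi,
   [/\ in_orthant T psi, piecewise_linear T psi,
       (skorohod_dist T phi psi < delta%:E)%E & (action L T psi <= c)%E]) ->
  (rate_fun L T phi <= c)%E.
Proof.
move=> H; rewrite rate_funE; apply: ge_ereal_sup => _ [delta /= d0 <-].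
have [psi [ot p dist cost]] := H _ d0.
by apply: le_trans cost; apply: ereal_inf_lbound; exists psi.
Qed.

Lemma rate_fun_witness T phi c delta eta : (rate_fun L T phi <= c%:E)%E -> 0 < delta -> 0 < eta ->
  exists psi, [/\ in_orthant T psi, piecewise_linear T psi,
       (skorohod_dist T phi psi < delta%:E)%E & (action L T psi <= (c + eta)%:E)%E].
Proof.
rewrite rate_funE => H d0 e0.
have : (rate_in T phi delta < (c + eta)%:E)%E.
  apply: (@le_lt_trans _ _ c%:E); last by rewrite lte_fin ltrDl.
  by apply: le_trans H; apply: ereal_sup_ubound; exists delta.
by move=> /ereal_inf_lt[_ [psi [ot p dist] <-]] /ltW h; exists psi.
Qed.

End rate.

(** * The lower bound by the rate function *)

Section lower.
Variables (R : realType) (N : nat) (d : measure_display).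
Variables (Omega : measurableType d) (E : set 'rV[R]_N).
Variables (P : 'rV[R]_N -> probability Omega R).
Variables (k : R -> R.-pker (borel_rV R N) ~> (borel_rV R N)).
Variables (X : 'rV[R]_N -> R -> Omega -> 'rV[R]_N).
Hypothesis mp : markov_process E P k X.
Variable (L : {set 'I_N} -> 'rV[R]_N -> \bar R).
Hypothesis L_ge0 : forall (Lambda : {set 'I_N}) (v : 'rV[R]_N), (0 <= L Lambda v)%E.
Hypothesis A1 : segment_lower_bound E P X L.
Notation LB := (lower_bound E P X).
Implicit Types (phi psi chi : R -> 'rV[R]_N).

Lemma lower_bound0 psi : LB 0 psi 0.
Proof.
move=> c' c0 delta d0; exists delta => //; near=> n; move=> z [Ez zd].
have n0 : (0 < n)%N by near: n; exists 1%N.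
have -> : stube X 0 psi delta n z = setT.
  rewrite -subTset => w _ t /andP[t0 t1]; have -> : t = 0 by apply/le_anti/andP; split.
  rewrite /scaled_process mulr0 (mp_init mp); last exact: scaled_spaceP.
  by rewrite scalerA mulVf ?scale1r ?ltW// pnatr_eq0 -lt0n.
have -> : mu_ext (P (n%:R *: z)) setT = 1%E.
  exact: etrans (measurable_mu_extE (P (n%:R *: z)) measurableT) (probability_setT _).
rewrite lee_fin -expR0 ler_expR oppr_le0.
by rewrite mulr_ge0// ltW.
Unshelve. all: by end_near. Qed.

Lemma pl_data_rcont m s v Lam psi a S : @pl_data R N m s v Lam psi -> 0 <= a -> a + S <= s m ->
  rcont S (fun t => psi (a + t)).
Proof.
move=> D a0 aS t /andP[t0 tS]; have := pl_data_lip D; set K := \sum_(j < m) _ => lip.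
have K0 : 0 <= K by apply: sumr_ge0.
have K1 : 0 < K + 1 by rewrite ltr_wpDl.
apply/cvgrPdist_lt => e e0; near=> u.
have tu : t <= u by near: u; exact: nbhs_right_ge.
have uS : u <= S by near: u; exact: nbhs_right_le.
have ut : u < t + e / (K + 1).
  by near: u; apply: nbhs_right_lt; rewrite ltrDl divr_gt0.
rewrite distrC; apply: (@le_lt_trans _ _ (K * ((a + u) - (a + t)))).
  apply: lip; [exact: addr_ge0|by rewrite lerD2l|].
  by apply: le_trans aS; rewrite lerD2l.
have ut' : u - t < e / (K + 1) by rewrite ltrBlDl.
have -> : a + u - (a + t) = u - t by ring.
apply: (@le_lt_trans _ _ ((K + 1) * (u - t))); first by rewrite ler_wpM2r ?subr_ge0// lerDl.
by rewrite mulrC -ltr_pdivlMr.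
Unshelve. all: by end_near. Qed.

Lemma route_rcont T psi c : route L T psi c -> rcont T psi.
Proof.
move=> [_ [m [s [v [Lam [D <- _]]]]]].
have := @pl_data_rcont m s v Lam psi 0 (s m) D (lexx _); rewrite add0r => /(_ (lexx _)).
by rewrite (_ : (fun t => psi (0 + t)) = psi)//; apply/funext => t; rewrite add0r.
Qed.

Lemma rcont_eq S phi psi : (forall t, 0 <= t < S -> phi t = psi t) -> rcont S phi -> rcont S psi.
Proof.
move=> fg rf t /[dup] tS /andP[t0 t1]; rewrite -fg//; have := rf t tS.
apply: cvg_trans; apply: near_eq_cvg; near=> u; rewrite fg//; apply/andP; split.
  by apply: (le_trans t0); near: u; exact: nbhs_right_ge.
by near: u; exact: nbhs_right_lt.
Unshelve. all: by end_near. Qed.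

Lemma route_lower_bound T psi c : route L T psi c -> LB T psi c.
Proof.
move=> [oT [m [s [v [Lam [D e cost]]]]]]; have [s0 sP lin fP] := D.
rewrite -{}e in oT *.
have sm_ge j : (j <= m)%N -> 0 <= s j.
  by move=> jm; rewrite -s0; apply: (nodes_le sP); rewrite leq0n.
(* [lower_bound] takes real rates: each term is finite, because the nonnegative terms have a sum at
   most [c]. *)
pose C j := fine ((s j.+1 - s j)%:E * L (Lam j) (v j))%E.
have term0 j : (j < m)%N -> (0 <= (s j.+1 - s j)%:E * L (Lam j) (v j))%E.
  by move=> jm; apply: mule_ge0 => //; rewrite lee_fin subr_ge0 ltW// sP.
have CE j : (j < m)%N -> ((s j.+1 - s j)%:E * L (Lam j) (v j) = (C j)%:E)%E.
  move=> jm; rewrite /C fineK// ge0_fin_numE ?term0//.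
  apply: le_lt_trans (ltry c); apply: le_trans cost.
  rewrite (bigD1 (Ordinal jm))//= leeDl//; apply: sume_ge0 => i _; exact: term0.
have Cc : \sum_(j < m) C j <= c.
  by rewrite -lee_fin -sumEFin; apply: le_trans cost; apply: lee_sum => j _; rewrite CE.
apply: (lower_bound_le Cc).
suff main j : (j <= m)%N -> LB (s j) psi (\sum_(i < j) C i) by apply: main.
elim: j => [_|j IH jm]; first by rewrite s0 big_ord0; exact: lower_bound0.
have sj := sP j jm; have sj0 := sm_ge j (ltnW jm).
have sjm : s j.+1 <= s m by apply: (nodes_le sP); rewrite jm leqnn.
have E1 : s j.+1 = s j + (s j.+1 - s j) by rewrite addrC subrK.
have e0 : psi (s j) = psi (s j + 0) by rewrite addr0.
rewrite big_ord_recr/= E1.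
have dj : 0 < s j.+1 - s j by rewrite subr_gt0.
apply: (lower_bound_concat mp) => //; [exact: ltW| | |exact: IH (ltnW jm)|].
- have := @pl_data_rcont m s v Lam psi 0 (s j) D (lexx _).
  rewrite add0r => /(_ (le_trans (ltW sj) sjm)).
  by rewrite (_ : (fun t => psi (0 + t)) = psi)//; apply/funext => t; rewrite add0r.
- by apply: (pl_data_rcont D) => //; rewrite -E1.
- have inpiece t : 0 <= t <= s j.+1 - s j -> s j <= s j + t <= s j.+1.
    by move=> /andP[t0 t1]; rewrite lerDl t0 addrC -lerBrDr.
  apply: (lower_bound_linear A1 (Lambda := Lam j) (v := v j)) => //.
  + move=> t tj; apply: oT; have /andP[t1 t2] := inpiece t tj.
    by rewrite (le_trans sj0)// (le_trans t2).
  + move=> t tj; rewrite -e0 (lin j jm) ?inpiece//.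
    by rewrite addrAC subrr add0r.
  + move=> t /andP[t0 t1]; apply: (fP j jm).
    by rewrite ltrDl t0 addrC -ltrBrDr.
  + by rewrite CE.
Qed.

Variables (r K : R).
Hypotheses (r0 : 0 < r) (r1 : r <= 1) (K0 : 0 <= K).
Hypothesis rK : forall v : 'rV[R]_N, `|v| <= r -> (L [set: 'I_N]%SET v <= K%:E)%E.
Variables (T : R) (phi : R -> 'rV[R]_N).
Hypotheses (T0 : 0 < T) (oT : in_orthant T phi) (acT : absolutely_continuous T phi).

(** A time change is onto [[0, T]] by the intermediate value theorem and close to the identity, so
    that uniform continuity of [phi] turns Skorohod closeness into uniform closeness. *)
Lemma skorohod_close e : 0 < e ->
  exists2 delta, 0 < delta & forall psi, (skorohod_dist T phi psi < delta%:E)%E ->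
    forall t, 0 <= t <= T -> `|psi t - phi t| <= e.
Proof.
move=> e0; have e20 : 0 < e / 2 by rewrite divr_gt0.
have [d1 d10 H] := phi_uniform acT e20.
exists (Num.min d1 (e / 2)); first by rewrite lt_min d10.
move=> psi /ereal_inf_lt[_ [lam [lam0 lamT mlam clam] <-]]; rewrite gt_max => /andP[h1 h2] t tT.
have [u uT <-] : exists2 u, u \in `[0, T] & lam u = t.
  apply: IVT => //; first exact: ltW.
  by rewrite lam0 lamT min_l ?max_r// ltW.
rewrite in_itv/= in uT.
have lu : 0 <= lam u <= T.
  have /andP[u0 uT'] := uT.
  have i0 : (0 : R) \in `[0, T] by rewrite in_itv/= lexx ltW.
  have iT : T \in `[0, T] by rewrite in_itv/= lexx ltW.
  have iu : u \in `[0, T] by rewrite in_itv.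
  apply/andP; split.
    move: u0; rewrite le_eqVlt => /predU1P[<-|u0]; first by rewrite lam0.
    by rewrite -[leLHS]lam0 ltW// mlam.
  move: uT'; rewrite le_eqVlt => /predU1P[->|u1]; first by rewrite lamT.
  by rewrite -[leRHS]lamT ltW// mlam.
have dl : `|lam u - u| < d1.
  rewrite -lte_fin; apply: (@le_lt_trans _ _ (sup_dist T lam id)).
    by apply: ereal_sup_ubound; exists u => //=; rewrite in_itv.
  by apply: (lt_le_trans h1); rewrite lee_fin ge_min lexx.
have dp : `|phi u - psi (lam u)| < e / 2.
  rewrite -lte_fin; apply: (@le_lt_trans _ _ (sup_dist T phi (psi \o lam))).
    by apply: ereal_sup_ubound; exists u => //=; rewrite in_itv.
  by apply: (lt_le_trans h2); rewrite lee_fin ge_min lexx orbT.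
have dphi := H _ _ lu uT dl.
apply: (le_trans (ler_distD (phi u) _ _)); rewrite [e]splitr.
by apply: lerD; rewrite distrC ltW.
Qed.

(** The move to the starting point of [psi] takes a time [2 * h], so that [psi] is then followed
    with this delay; uniform continuity of [phi] absorbs the delay, and the part after [T] is
    discarded. *)
Lemma lower_bound_rate c : (rate_fun L T phi <= c%:E)%E -> LB T phi c.
Proof.
move=> Ic; suff main eta : 0 < eta -> LB T phi (c + eta).
  move=> c' cc'; have e0 : 0 < (c' - c) / 2 by rewrite divr_gt0// subr_gt0.
  by apply: (main _ e0); lra.
move=> eta0; apply: lower_bound_close => e e0.
have e20 : 0 < e / 2 by rewrite divr_gt0.
have [dl dl0 Hdl] := phi_uniform acT e20.
have eta20 : 0 < eta / 2 by rewrite divr_gt0.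
(* The three bounds serve the delay [2 * h], the distance at most [2 * h] travelled by the move, and
   its cost [2 * h * K]. *)
pose h := Num.min (dl / 4) (Num.min (e / 8) (eta / (4 * (K + 1)))).
have K1 : 0 < K + 1 by rewrite ltr_wpDl.
have h0 : 0 < h by rewrite !lt_min !divr_gt0//= mulr_gt0.
have h1 : h <= dl / 4 by rewrite ge_min lexx.
have h2 : h <= e / 8 by rewrite /h !ge_min lexx orbT.
have h3 : 2 * h * K <= eta / 2.
  have : h <= eta / (4 * (K + 1)) by rewrite /h !ge_min lexx !orbT.
  rewrite ler_pdivlMr ?mulr_gt0// => hK; have : 0 <= h by exact: ltW.
  by nra.
(* [r * h / 2] is the range of [route_connect]. *)
pose gap := Num.min (r * h / 2) (e / 8).
have gap0 : 0 < gap by rewrite lt_min !divr_gt0// mulr_gt0.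
have [delta d0 Hd] := skorohod_close gap0.
have [psi [opsi plpsi dist cost]] := rate_fun_witness Ic d0 eta20.
have close := Hd psi dist.
have rpsi : route L T psi (c + eta / 2) by exact: route_of_piecewise_linear.
have ophi0 : orthant (phi 0) by apply: oT; rewrite lexx ltW.
have opsi0 : orthant (psi 0) by apply: opsi; rewrite lexx ltW.
have close0 : `|psi 0 - phi 0| <= r * h / 2.
  by apply: (le_trans (close 0 _)); [rewrite lexx ltW|rewrite ge_min lexx].
have [con [rcon ex0 endcon dcon]] := route_connect r0 r1 rK (route0 L ophi0) h0 opsi0 close0.
rewrite !add0r in rcon endcon dcon.
pose chi t := if t < 2 * h then con t else psi (t - 2 * h).
have chi2 t : 0 <= t -> chi (2 * h + t) = psi t.
  by move=> t0; rewrite /chi ltNge lerDl t0/= addrAC subrr add0r.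
have chi1 t : 0 <= t <= 2 * h -> con t = chi t.
  rewrite /chi => /andP[t0]; rewrite le_eqVlt => /predU1P[->|->//].
  by rewrite ltxx subrr endcon.
have hh0 : 0 <= 2 * h by rewrite mulr_ge0// ltW.
have chi0 : chi 0 = phi 0 by rewrite -chi1 ?lexx// ex0.
exists chi; split => //.
- apply: (@lower_bound_sub _ _ _ _ _ _ _ (2 * h + T)); first by rewrite lerDr.
  apply: (@lower_bound_le _ _ _ _ _ _ _ _ _ (2 * h * K + (c + eta / 2))); first by lra.
  apply: (lower_bound_concat mp) => //; first exact: ltW.
  + by apply: rcont_eq (route_rcont rcon) => t /andP[t0 th]; rewrite chi1// t0 ltW.
  + by apply: rcont_eq (route_rcont rpsi) => t /andP[t0 _]; rewrite chi2.
  + exact: (lower_bound_eq hh0 chi1 (route_lower_bound rcon)).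
  + apply: (lower_bound_eq (ltW T0) _ (route_lower_bound rpsi)) => t /andP[t0 tT].
    by rewrite chi2.
move=> t /andP[t0 tT]; have [th|ht] := leP t (2 * h).
  rewrite -chi1 ?t0//; apply: (le_trans (ler_distD (phi 0) _ _)).
  have a1 : `|con t - phi 0| <= e / 2.
    apply: (le_trans (dcon t _)); first by rewrite t0.
    by lra.
  have a2 : `|phi 0 - phi t| < e / 2.
    apply: Hdl; [by rewrite lexx ltW|by rewrite t0|].
    by rewrite sub0r normrN ger0_norm//; lra.
  by rewrite [e]splitr lerD// ltW.
pose u := t - 2 * h.
have u0 : 0 <= u by rewrite subr_ge0 ltW.
have uT : 0 <= u <= T by rewrite u0/= /u lerBlDr (le_trans tT)// lerDl.
have -> : chi t = psi u by rewrite -chi2// /u addrC subrK.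
apply: (le_trans (ler_distD (phi u) _ _)).
have a1 : `|psi u - phi u| <= e / 2.
  by apply: (le_trans (close u uT)); rewrite ge_min; apply/orP; right; lra.
have a2 : `|phi u - phi t| < e / 2.
  apply: Hdl; [exact: uT|by rewrite t0|].
  by rewrite distrC /u opprB addrC subrK ger0_norm//; lra.
by rewrite [e]splitr lerD// ltW.
Qed.

End lower.

(** * Upper bound along an absolutely continuous path *)

Import HBNNSimple.

Section tools.
Variables (R : realType) (N : nat).
Notation mu := (@lebesgue_measure R).

Lemma compact_endpoints (S : set R) : compact S -> S !=set0 ->
  exists s s', [/\ S s, S s' & forall t, S t -> s <= t <= s'].
Proof.
move=> cS S0.
have cid : {within S, continuous (id : R -> R)} by apply: continuous_subspaceT => x; exact: cvg_id.
have [s /set_mem Ss smin] := compact_EVT_min S0 cS cid.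
have [s' /set_mem Ss' smax] := compact_EVT_max S0 cS cid.
exists s, s'; split => // t St; apply/andP; split; [apply: smin|apply: smax]; exact/mem_set.
Qed.

Lemma is_derive_slope (f : R -> 'rV[R]_N) (t : R) (v : 'rV[R]_N) (e : R) : is_derive t 1 f v -> 0 < e ->
  exists2 delta, 0 < delta & forall u, `|u| < delta -> `|f (t + u) - f t - u *: v| <= e * `|u|.
Proof.
move=> [df dfv] e0.
have cf : h^-1 *: (f (h + t) - f t) @[h --> 0^'] --> v.
  rewrite -dfv; have := df; rewrite /derivable => /cvg_ex[l cl].
  rewrite /derive (cvg_lim _ cl)//; move: cl.
  by under eq_fun do rewrite [_%:A]mulr1.
have /nbhs_ballP[dl /= dl0 H] : \forall h \near 0^', `|v - h^-1 *: (f (h + t) - f t)| < e.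
  by move/cvgrPdist_lt : cf => /(_ _ e0).
exists dl => // u ud; have [->|u0] := eqVneq u 0.
  by rewrite addr0 subrr scale0r subr0 !normr0 mulr0.
have bu : ball 0 dl u by rewrite -ball_normE/= sub0r normrN.
have /ltW := H u bu u0.
have -> : f (t + u) - f t - u *: v = - (u *: (v - u^-1 *: (f (u + t) - f t))).
  by rewrite scalerBr scalerA mulfV// scale1r opprB [u + t]addrC.
by rewrite normrN normrZ mulrC => h; rewrite ler_pM2r// normr_gt0.
Qed.

Lemma rat_vector_near (v : 'rV[R]_N) e : 0 < e ->
  exists w : 'rV[rat]_N, `|map_mx ratr w - v| <= e.
Proof.
move=> e0; have /choice[q qP] (i : 'I_N) : exists q : rat, ratr q \in `]v ord0 i - e, v ord0 i + e[.
  by apply: rat_in_itvoo; lra.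
exists (\row_i q i); apply: norm_le_coord; first exact: ltW.
move=> i; rewrite !mxE; have := qP i; rewrite in_itv/= => /andP[h1 h2].
by rewrite ler_norml; apply/andP; split; lra.
Qed.

Lemma inv_nat_lt (e : R) : 0 < e -> exists m : nat, m.+1%:R^-1 < e.
Proof.
move=> e0; exists (Num.truncn e^-1).
by rewrite -[ltRHS]invrK ltf_pV2 ?posrE ?invr_gt0// truncnS_gt.
Qed.

End tools.

Section cell_section.
Variables (R : realType) (N : nat) (d : measure_display).
Variables (Omega : measurableType d) (E : set 'rV[R]_N).
Variables (P : 'rV[R]_N -> probability Omega R).
Variables (k : R -> R.-pker (borel_rV R N) ~> (borel_rV R N)).
Variables (X : 'rV[R]_N -> R -> Omega -> 'rV[R]_N).
Hypothesis mp : markov_process E P k X.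
Hypothesis E_dense : dense_states E.
Variable (L : {set 'I_N} -> 'rV[R]_N -> \bar R).
Hypothesis L_ge0 : forall (Lambda : {set 'I_N}) (v : 'rV[R]_N), (0 <= L Lambda v)%E.
Hypothesis A1 : segment_lower_bound E P X L.
Hypothesis A3 : face_upper_bound E P X L.
Notation UB := (upper_bound E P).
Notation mu := (@lebesgue_measure R).
Variables (T : R) (phi : R -> 'rV[R]_N).
Hypotheses (T0 : 0 < T) (oT : in_orthant T phi) (acT : absolutely_continuous T phi).
Implicit Types (Lambda : {set 'I_N}) (w : 'rV[R]_N).

(** Outside the stretch between the extreme points of [S], probabilities are bounded by 1. On it,
    the coordinates are at least [kappa] at the start and [phi] oscillates by at most [kappa / 2],
    which leaves the margin [kappa / 2] for [upper_bound_face]. *)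
Lemma upper_bound_cell a b S Lambda w r kappa c : 0 <= a -> a <= b -> b <= T ->
  compact S -> S `<=` `[a, b] -> 0 < kappa ->
  (forall t, S t -> face Lambda (phi t)) ->
  (forall t i, S t -> i \in Lambda -> kappa <= phi t ord0 i) ->
  (forall s t, s \in `[a, b] -> t \in `[a, b] -> `|phi s - phi t| <= kappa / 2) ->
  (forall t u, S t -> 0 <= u -> t + u <= b -> `|phi (t + u) - phi t - u *: w| <= r * u) ->
  (forall v : 'rV[R]_N, (forall i, i \notin Lambda -> v ord0 i = 0) -> `|v - w| <= r ->
     (c%:E <= L Lambda v)%E) ->
  UB (stube X (b - a) (fun t => phi (a + t))) (phi a) (c * fine (mu S)).
Proof.
move=> a0 ab bT cS Sab k0 fS kS ucont slope cL.
have mS := compact_measurable cS.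
(* For [c <= 0] the trivial bound is enough; below, [c > 0] allows passing from [s' - s] to the
   smaller measure of [S]. *)
have [c0|c0] := leP c 0.
  apply: upper_bound_le (upper_bound0 _ _ _ _).
  by rewrite mulr_le0_ge0// fine_ge0.
have [muS0|muS0] := eqVneq (mu S) 0%E.
  by rewrite muS0/= mulr0; exact: upper_bound0.
have S0 : S !=set0 by apply/set0P/eqP => e; move: muS0; rewrite e measure0 eqxx.
have [s [s' [Ss Ss' sS]]] := compact_endpoints cS S0.
have /andP[as_ sb] : a <= s <= b by have := Sab _ Ss; rewrite /= in_itv.
have /andP[as' s'b] : a <= s' <= b by have := Sab _ Ss'; rewrite /= in_itv.
have ss' : s <= s' by have /andP[] := sS _ Ss'.
have muS : (mu S <= (s' - s)%:E)%E.
  apply: (@le_trans _ _ (mu `[s, s'])).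
    apply: le_measure; [exact/mem_set|apply: mem_set; exact: measurable_itv|].
    by move=> t /sS; rewrite /= in_itv.
  by rewrite lebesgue_measure_itv/= lte_fin; case: ltP => // _; rewrite lee_fin subr_ge0.
have lts : s < s'.
  rewrite lt_neqAle ss' andbT; apply/eqP => e; move: muS; rewrite e subrr => h.
  by move: muS0; rewrite eq_le h measure_ge0.
have muSf : fine (mu S) <= s' - s.
  rewrite -lee_fin fineK//.
  by rewrite ge0_fin_numE ?measure_ge0// (le_lt_trans muS)// ltry.
have ds : 0 < s' - s by rewrite subr_gt0.
apply: (@upper_bound_sub _ _ _ _ _ _ _ (s' - a)); first by rewrite lerB.
apply: (@upper_bound_le _ _ _ _ _ _ _ _ (0 + c * (s' - s))).
  by rewrite add0r ler_pM2l.
have e1 : s' - a = (s - a) + (s' - s) by ring.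
have fE : (fun t => phi (a + (s - a + t))) = (fun t => phi (s + t)).
  by apply/funext => t; congr phi; ring.
pose psi t := phi (a + t).
have -> : phi a = psi 0 by rewrite /psi addr0.
rewrite e1 -/psi; apply: (upper_bound_concat mp).
- by rewrite subr_ge0.
- exact: ltW.
- by apply: (rcont_phi T0 acT) => //; rewrite addrC subrK (le_trans sb).
- by rewrite /psi fE; apply: (rcont_phi T0 acT); [exact: le_trans as_|rewrite addrC subrK (le_trans s'b)].
- exact: upper_bound0.
rewrite /psi fE (_ : phi (a + (s - a)) = phi (s + 0)); last by congr phi; ring.
have ess : s + (s' - s) = s' by ring.
apply: (@upper_bound_face _ _ _ _ _ _ _ _ mp _ A3 Lambda _ (fun t => phi (s + t)) (kappa / 2)) => //=.
- by rewrite divr_gt0.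
- by rewrite addr0; exact: fS.
- by rewrite ess; exact: fS.
- move=> i t iL /andP[t0 t1].
  have := coord_le_norm (phi s - phi (s + t)) i; rewrite !mxE => h.
  have h2 : `|phi s - phi (s + t)| <= kappa / 2.
    apply: ucont; rewrite in_itv/=; first by rewrite as_.
    by apply/andP; split; lra.
  have h3 := kS s i Ss iL; have := le_trans h h2; rewrite ler_norml => /andP[_].
  by move: h3; lra.
- rewrite addr0 ess mulrC EFinM; apply: lee_wpmul2l; first by rewrite lee_fin ltW.
  apply: cL.
    move=> i iL; have h1 := face_coord0 (fS _ Ss) iL; have h2 := face_coord0 (fS _ Ss') iL.
    by rewrite !mxE h1 h2 subrr mulr0.
  have := slope s (s' - s) Ss (ltW ds); rewrite ess => /(_ s'b) h.
  have -> : (s' - s)^-1 *: (phi s' - phi s) - w = (s' - s)^-1 *: (phi s' - phi s - (s' - s) *: w).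
    by rewrite [RHS]scalerBr scalerA mulVf ?scale1r// gt_eqF.
  by rewrite normrZ gtr0_norm ?invr_gt0// ler_pdivrMl// mulrC.
Qed.

Let rad (m : nat) : R := m.+1%:R^-1.
Let rad_gt0 m : 0 < rad m. Proof. by rewrite invr_gt0. Qed.

(* The index set of the countable cover: face, rational velocity, its
   precision, rational lower bound of the rate function near that velocity,
   lower bound of the positive coordinates, time scale of the slopes. *)
Let idx : countType := ({set 'I_N} * 'rV[rat]_N * nat * rat * nat * nat)%type.
Let face_of (i : idx) := i.1.1.1.1.1.
Let vel_of (i : idx) : 'rV[R]_N := map_mx ratr i.1.1.1.1.2.
Let prec_of (i : idx) : R := rad i.1.1.1.2.
Let cost_of (i : idx) : R := ratr i.1.1.2.
Let pos_of (i : idx) : R := rad i.1.2.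
Let scale_of (i : idx) : R := rad i.2.

(** Forward slopes are enough, as only the slope from the least to the greatest point of a compact
    subset is used. For each [u] the condition is closed in [t], whence measurability. *)
Let slope_set (i : idx) : set R := [set t |
  [/\ forall j, j \in face_of i -> pos_of i <= phic T phi t ord0 j,
      forall j, j \notin face_of i -> phic T phi t ord0 j = 0 &
      forall u, 0 <= u <= scale_of i ->
        `|phic T phi (t + u) - phic T phi t - u *: vel_of i| <= prec_of i * u]].

Let slope_set_measurable i : measurable (slope_set i).
Proof.
have cc := phic_coord_continuous T0 acT.
have cp := phic_continuous T0 acT.
apply: closed_measurable.
have -> : slope_set i = \bigcap_(j in [set j | j \in face_of i]) [set t | pos_of i <= phic T phi t ord0 j] `&`
    (\bigcap_(j in [set j | j \notin face_of i]) [set t | phic T phi t ord0 j = 0] `&`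
     \bigcap_(u in [set u | 0 <= u <= scale_of i])
       [set t | `|phic T phi (t + u) - phic T phi t - u *: vel_of i| <= prec_of i * u]).
  by apply/seteqP; split => t [h1]; [move=> h2 h3|move=> [h2 h3]]; do ?split.
apply: closedI; last apply: closedI.
- apply: closed_bigI => j _.
  by apply: (continuous_closedP _).1 (@closed_ge _ (pos_of i)); exact: cc.
- apply: closed_bigI => j _.
  by apply: (continuous_closedP _).1 (@closed_eq _ 0); exact: cc.
- apply: closed_bigI => u _.
  apply: (continuous_closedP (fun t => `|phic T phi (t + u) - phic T phi t - u *: vel_of i|)).1 (@closed_le _ (prec_of i * u)).
  move=> t; apply: cvg_norm; apply: cvgB; last exact: cvg_cst.
  apply: cvgB; last exact: cp.
  apply: (cvg_comp (fun s => s + u) (phic T phi) (G := nbhs (t + u))); last exact: cp.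
  by apply: cvgD; [exact: cvg_id|exact: cvg_cst].
Qed.

(** Lower semicontinuity provides such an index near every velocity of the path, with a cost as
    close to the rate as desired. *)
Let admissible (i : idx) := forall v : 'rV[R]_N,
  (forall j, j \notin face_of i -> v ord0 j = 0) -> `|v - vel_of i| <= prec_of i ->
  ((cost_of i)%:E <= L (face_of i) v)%E.

Let slope_set_cover t v Lambda (x : R) : 0 < t < T -> is_derive t 1 phi v ->
  face Lambda (phi t) -> (forall j, j \notin Lambda -> v ord0 j = 0) ->
  (x%:E <= L Lambda v)%E -> forall eta, 0 < eta ->
  exists i, [/\ admissible i, slope_set i t & x <= cost_of i + eta].
Proof.
move=> /andP[t0 tT] der fL v0 xL eta eta0.
have t0T : 0 <= t <= T by rewrite !ltW.
have xe : x - eta < x by rewrite ltrBlDr ltrDl.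
have [kq] := rat_in_itvoo xe; rewrite in_itv/= => /andP[k1 k2].
have [r0 r00 Hr0] : exists2 r, 0 < r & forall v' : 'rV[R]_N, (forall i, i \notin Lambda -> v' ord0 i = 0) ->
    `|v' - v| <= r -> ((ratr kq)%:E <= L Lambda v')%E.
  apply: (L_lsc mp E_dense A1 A3 v0).
  by apply: lt_le_trans xL; rewrite lte_fin.
(* Half of the precision pays for a rational velocity, half for the slopes. As the precision is
   below [r0 / 2], the ball of that radius around the rational velocity stays within [r0] of [v]. *)
have r20 : 0 < r0 / 2 by rewrite divr_gt0.
have [mr mrr] := inv_nat_lt r20; rewrite -/(rad mr) in mrr.
have rm2 : 0 < rad mr / 2 by rewrite divr_gt0.
have [w wv] := rat_vector_near v rm2.
have [m0 Hm0] : exists m0, forall j, j \in Lambda -> rad m0 <= phi t ord0 j.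
  pose x0 := \big[Num.min/1]_(j in Lambda) phi t ord0 j.
  have x00 : 0 < x0 by apply/bigmin_gtP; split => // j jL; rewrite (face_coord _ fL).
  have [m0 Hm0] := inv_nat_lt x00; exists m0 => j jL.
  by apply: (le_trans (ltW Hm0)); exact: bigmin_le_cond.
have [dl dl0 Hdl] := is_derive_slope der rm2.
have sc0 : 0 < Num.min dl (T - t) by rewrite lt_min dl0 subr_gt0.
have [m1] := inv_nat_lt sc0; rewrite -/(rad m1) lt_min => /andP[m1d m1t].
exists (Lambda, w, mr, kq, m0, m1); split.
- move=> v' v'0 v'w; apply: Hr0 => //.
  apply: (le_trans (ler_distD (map_mx ratr w) _ _)).
  apply: (@le_trans _ _ (rad mr + rad mr / 2)); first exact: lerD.
  by lra.
- rewrite /slope_set /face_of /pos_of /vel_of /prec_of /scale_of/=; split.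
  + by move=> j jL; rewrite phicE//; exact: Hm0.
  + by move=> j jL; rewrite phicE//; exact: face_coord0 jL.
  + move=> u /andP[u0 um].
    have tuT : 0 <= t + u <= T by apply/andP; split; lra.
    rewrite !phicE//.
    have ud : `|u| < dl by rewrite ger0_norm//; apply: le_lt_trans um m1d.
    have := Hdl u ud; rewrite ger0_norm// => h1.
    have -> : phi (t + u) - phi t - u *: map_mx ratr w =
        (phi (t + u) - phi t - u *: v) - u *: (map_mx ratr w - v).
      by rewrite scalerBr opprB addrA subrK.
    apply: (le_trans (ler_normB _ _)); rewrite normrZ ger0_norm//.
    have -> : rad mr * u = rad mr / 2 * u + u * (rad mr / 2) by field.
    by apply: lerD => //; apply: ler_wpM2l.
- by rewrite /cost_of/=; move: k1; rewrite ltrBlDr => /ltW.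
Qed.

(** The bounds of the cells add up to the sum of [kap j] times the measure of [S j]. It is compared
    with the integral of a simple function [h]: on the sets [B n] the cost is at least [h - eta],
    and the part outside the sets [S j] contributes less than [eta]. *)
Lemma upper_bound_action c : (c%:E < action L T phi)%E -> UB (stube X T phi) (phi 0) c.
Proof.
move=> cA; have [g [G [mG GT muG ig [ftc der zer]]]] := path_density T0 oT acT.
pose f t := L (pos_coords (phi t)) (derive1 phi t).
move: cA; rewrite /action ge0_integralE; last by move=> *; exact: L_ge0.
move=> /ereal_sup_gt[_ [h /= hf <-] ch].
have h0 t : 0 <= h t by [].
have hout t : ~ `[0, T]%classic t -> h t = 0.
  move=> nt; apply/eqP; rewrite eq_le h0 andbT; have := hf t.
  by rewrite /patch ifF ?lee_fin//; apply/negbTE/negP => /set_mem.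
have Tfin : (mu `[0%R, T]%classic < +oo)%E by rewrite lebesgue_measure_itv/= lte_fin T0 ltry.
have mh : measurable_fun setT h by exact: measurable_funP.
have ihT : mu.-integrable `[0, T] (EFin \o h).
  apply: measurable_bounded_integrable => //; first exact: measurable_funTS.
  have [M [Mr HM]] := simple_bounded h.
  by exists M; split => // x Mx y _; exact: HM.
have hres : (EFin \o h) \_ `[0, T] = EFin \o h.
  apply/funext => t; rewrite /patch; case: ifPn => // /negP nt.
  by rewrite /= hout// => tT; apply: nt; exact/mem_set.
have ih : mu.-integrable setT (EFin \o h).
  by rewrite -hres; apply/(integrable_mkcond (EFin \o h) (measurable_itv _)).
pose I := (\int[mu]_(x in `[0%R, T]) (h x)%:E)%E.
have Ifin : I \is a fin_num by exact: integrable_fin_num ihT.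
have cI : (c%:E < I)%E.
  rewrite /I integral_mkcond -/(EFin \o h) hres.
  by rewrite integralT_nnsfun.
(* The losses are at most [eta * T] on the sets [S j] and [eta] off them, less than [fine I - c] in
   all. *)
pose eta := (fine I - c) / (T + 2).
have T2 : 0 < T + 2 by rewrite addr_gt0.
have cI' : c < fine I by rewrite -lte_fin fineK.
have eta0 : 0 < eta by rewrite divr_gt0// subr_gt0.
pose B n : set R := [set t | exists2 i : idx, (choice.unpickle n : option idx) = Some i & [/\ admissible i, slope_set i t & h t <= cost_of i + eta]].
have mB n : measurable (B n).
  have [[i [ei ok]]|none] := pselect (exists i : idx, choice.unpickle n = Some i /\ admissible i).
    have -> : B n = slope_set i `&` h @^-1` [set x | x <= cost_of i + eta].
      apply/seteqP; split => t; first by move=> [j]; rewrite ei => -[<-] [].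
      by move=> [h1 h2]; exists i.
    apply: measurableI => //; rewrite -[X in measurable X]setTI; apply: mh => //.
    by rewrite -set_itvNyc; exact: measurable_itv.
  have -> : B n = set0 by rewrite -subset0 => t [i ei [ok _ _]]; apply: none; exists i.
  exact: measurable0.
have cover : G `<=` \bigcup_n B n.
  move=> t Gt; have := GT _ Gt; rewrite /= in_itv/= => tT.
  have fL : face (pos_coords (phi t)) (phi t).
    by split => //; apply: oT; have /andP[/ltW-> /ltW->] := tT.
  have [||i [ok sl hc]] := @slope_set_cover t (\row_i g i t) _ (h t) tT (der t Gt) fL _ _ _ eta0.
  - move=> j jL; rewrite mxE zer//; exact: face_coord0 jL.
  - have := hf t; rewrite /patch mem_set; last by rewrite /= in_itv/=; have /andP[/ltW-> /ltW->] := tT.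
    suff -> : \row_i g i t = derive1 phi t by [].
    by rewrite derive1E; have /@derive_val -> := der t Gt.
  by exists (choice.pickle i) => //; exists i => //; rewrite choice.pickleK.
(* On a cell shorter than [rho n] the slopes are controlled up to its end, and [phi] varies by less
   than half of the lower bound of its positive coordinates. *)
have /choice[rho rhoP] n : exists rho, 0 < rho /\ forall i : idx, choice.unpickle n = Some i -> rho <= scale_of i /\
    forall s t, 0 <= s <= T -> 0 <= t <= T -> `|s - t| < rho -> `|phi s - phi t| < pos_of i / 2.
  case: (choice.unpickle n : option idx) => [i|]; last by exists 1.
  have p0 : 0 < pos_of i / 2 by rewrite divr_gt0// rad_gt0.
  have [dl dl0 Hdl] := phi_uniform acT p0.
  exists (Num.min (scale_of i) dl); split; first by rewrite lt_min rad_gt0.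
  move=> j [<-]; split; first by rewrite ge_min lexx.
  by move=> s t sT tT st; apply: Hdl => //; apply: lt_le_trans st _; rewrite ge_min lexx orbT.
have GT' : G `<=` `[0, T].
  by move=> t /GT /=; rewrite !in_itv/= => /andP[/ltW-> /ltW->].
have [m [S [q [m0 HS Hsum]]]] := selection T0 mG GT' muG mB cover (fun n => (rhoP n).1) ih h0 eta0.
pose kap j : R := if (choice.unpickle (q j) : option idx) is Some i then cost_of i else 0.
pose tj j := T * j%:R / m%:R.
have mpos : 0 < m%:R :> R by rewrite ltr0n.
have tjS j : tj j.+1 = tj j + T / m%:R by rewrite /tj -natr1 mulrDr mulr1 mulrDl.
have tj0 j : 0 <= tj j by rewrite !mulr_ge0// ?invr_ge0 ltW.
have tjT j : (j <= m)%N -> tj j <= T by move=> jm; rewrite ler_pdivrMr// ler_pM2l// ler_nat.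
have Tm0 : 0 < T / m%:R by rewrite divr_gt0.
have cellUB j : (j < m)%N -> UB (stube X (T / m%:R) (fun t => phi (tj j + t))) (phi (tj j)) (kap j * fine (mu (S j))).
  move=> jm; have [cS Scell SB Trho] := HS j.
  have [e|/set0P [t0 St0]] := eqVneq (S j) set0.
    by rewrite e measure0 mulr0; exact: upper_bound0.
  have [_ [i ei [ok _ _]]] := SB _ St0.
  have all t : S j t -> slope_set i t by move=> /SB [_ [i' ei' [_]]]; move: ei'; rewrite ei => -[<-].
  have [_ /(_ i ei)[scale_i uc_i]] := rhoP (q j).
  have e1 : T / m%:R = tj j.+1 - tj j by rewrite tjS addrAC subrr add0r.
  have in0T t : t \in `[tj j, tj j.+1] -> 0 <= t <= T.
    rewrite in_itv/= => /andP[h1 h2]; rewrite (le_trans (tj0 j))//=.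
    exact: (le_trans h2 (tjT _ jm)).
  have phicS t : S j t -> phic T phi t = phi t.
    by move=> St; apply: phicE; apply: in0T; exact: Scell.
  rewrite /kap ei e1.
  apply: (@upper_bound_cell (tj j) (tj j.+1) (S j) (face_of i) (vel_of i) (prec_of i) (pos_of i)) => //.
  - by rewrite tjS lerDl ltW.
  - exact: tjT.
  - exact: rad_gt0.
  - move=> t St; have [p1 p2 _] := all t St; rewrite -(phicS t St).
    apply: faceP => // l lL; apply: lt_le_trans (p1 l lL); exact: rad_gt0.
  - by move=> t l St lL; have [p1 _ _] := all t St; rewrite -(phicS t St); exact: p1.
  - move=> s t sI tI; apply: ltW; apply: uc_i; [exact: in0T|exact: in0T|].
    apply: le_lt_trans Trho; rewrite e1; move: sI tI; rewrite !in_itv/= => /andP[p1 p2] /andP[p3 p4].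
    by rewrite ler_norml; apply/andP; split; lra.
  - move=> t u St u0 tu; have [_ _ p3] := all t St.
    have /andP[t1 t2] : tj j <= t <= tj j.+1 by have := Scell _ St; rewrite /cell/= in_itv.
    have um : u <= scale_of i by apply: le_trans scale_i; apply: le_trans (ltW Trho); rewrite e1; lra.
    have := p3 u; rewrite u0 um => /(_ isT); rewrite (phicS t St) phicE//.
    by apply: in0T; rewrite in_itv/= tu (le_trans t1)// lerDl.
have main j : (j <= m)%N -> UB (stube X (tj j) phi) (phi 0) (\sum_(i < j) kap i * fine (mu (S i))).
  elim: j => [_|j IH jm]; first by rewrite big_ord0; exact: upper_bound0.
  rewrite big_ord_recr/= tjS; apply: (upper_bound_concat mp) => //.
  - exact: ltW.
  - have := rcont_phi T0 acT (lexx 0) (_ : 0 + tj j <= T); rewrite add0r => /(_ (tjT _ (ltnW jm))).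
    by rewrite (_ : (fun t => phi (0 + t)) = phi)//; apply/funext => t; rewrite add0r.
  - by apply: (rcont_phi T0 acT) => //; rewrite -tjS; exact: tjT.
  - exact: IH (ltnW jm).
  - exact: cellUB.
have := main m (leqnn m); rewrite /tj mulfK ?gt_eqF//; apply: upper_bound_le.
have mS j : measurable (S j) by apply: compact_measurable; case: (HS j).
have mcell j : measurable (cell T m j) by exact: measurable_itv.
have mucell j : mu (cell T m j) = (T / m%:R)%:E.
  rewrite lebesgue_measure_itv/= lte_fin -/(tj j) -/(tj j.+1) tjS ltrDl Tm0 -EFinB.
  by rewrite addrAC subrr add0r.
have muS j : (mu (S j) <= (T / m%:R)%:E)%E.
  rewrite -(mucell j); apply: le_measure; [apply: mem_set; exact: mS|apply: mem_set; exact: mcell|].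
  by case: (HS j).
have muSfin j : mu (S j) \is a fin_num.
  by rewrite ge0_fin_numE ?measure_ge0// (le_lt_trans (muS j))// ltry.
have cellI j : (\int[mu]_(x in cell T m j) (h x)%:E <=
    (kap j * fine (mu (S j)) + eta * (T / m%:R))%:E + \int[mu]_(x in cell T m j `\` S j) (h x)%:E)%E.
  have Scell : S j `<=` cell T m j by case: (HS j).
  have mhE (D : set R) : measurable_fun D (fun x => (h x)%:E).
    by apply/measurable_EFinP; exact: measurable_funTS.
  rewrite -{1}(setDUK Scell) ge0_integral_setU; last first.
  - by apply/disj_setPRL => x [].
  - by move=> x _; rewrite lee_fin.
  - exact: mhE.
  - by apply: measurableD; [exact: mcell|exact: mS].
  - exact: mS.
  apply: leeD => //.
  apply: (@le_trans _ _ (\int[mu]_(x in S j) (cst (kap j + eta)%:E x))%E).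
    have hk x : S j x -> h x <= kap j + eta.
      have [_ _ SB _] := HS j.
      by move=> /SB[_ [i ei [_ _ hx]]]; rewrite /kap ei.
    apply: ge0_le_integral.
    - exact: mS.
    - by move=> x _; rewrite lee_fin.
    - exact: mhE.
    - exact: measurable_cst.
    - by move=> x Sx; rewrite lee_fin hk.
  rewrite [X in (X <= _)%E](integral_cst mu (mS j) (kap j + eta)%:E) [X in (_ * X <= _)%E](esym (fineK (muSfin j))) -EFinM lee_fin mulrDl lerD2l ler_pM2l//.
  by rewrite -lee_fin fineK.
have Isum : (I <= (\sum_(j < m) (kap j * fine (mu (S j)) + eta * (T / m%:R)) + eta)%:E)%E.
  rewrite /I -(cells_integralT T0 m0); last 2 first.
  - by apply/measurable_EFinP; exact: measurable_funTS.
  - by move=> t _; rewrite lee_fin.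
  rewrite EFinD -sumEFin; apply: (@le_trans _ _ (\sum_(j < m) ((kap j * fine (mu (S j)) + eta * (T / m%:R))%:E + \int[mu]_(x in cell T m j `\` S j) (h x)%:E))%E).
    by apply: lee_sum => j _; exact: cellI.
  by rewrite big_split/=; apply: leeD => //; exact: ltW.
have := Isum; rewrite -(fineK Ifin) lee_fin big_split/=.
have -> : \sum_(j < m) eta * (T / m%:R) = eta * T.
  rewrite sumr_const card_ord -[LHS]mulr_natr -[LHS]mulrA mulfVK ?gt_eqF//.
move=> Ifin2.
have etaE : eta * (T + 2) = fine I - c by rewrite /eta mulfVK// gt_eqF.
by move: Ifin2 etaE eta0; rewrite mulrDr; lra.
Qed.

(** The slopes pass to the limit as [u] tends to 0. Hence an admissible index bounds the rate from
    below at every point of its slope set where the path is differentiable. *)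
Lemma slope_set_velocity i t v : 0 < t < T -> is_derive t 1 phi v -> slope_set i t ->
  `|v - vel_of i| <= prec_of i.
Proof.
move=> /andP[t0 tT] der [_ _ sl]; apply/ler_addgt0Pr => e e0.
have [dl dl0 Hdl] := is_derive_slope der e0.
pose u := Num.min (Num.min (dl / 2) (T - t)) (scale_of i).
have u0 : 0 < u by rewrite !lt_min rad_gt0 subr_gt0 tT divr_gt0.
have us : u <= scale_of i by rewrite ge_min lexx orbT.
have uT : u <= T - t by rewrite /u !ge_min lexx orbT.
have ud : u <= dl / 2 by rewrite /u !ge_min lexx.
have h1 : `|phi (t + u) - phi t - u *: v| <= e * `|u|.
  by apply: Hdl; rewrite gtr0_norm//; lra.
have h2 := sl u; rewrite (ltW u0) us in h2; have {}h2 := h2 isT.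
rewrite !phicE in h2; [|by rewrite !ltW|by apply/andP; split; lra].
rewrite -(ler_pM2l u0) -[X in X * `|_|](gtr0_norm u0) -normrZ.
have -> : u *: (v - vel_of i) = (phi (t + u) - phi t - u *: vel_of i) - (phi (t + u) - phi t - u *: v).
  have gen (A x y : 'rV[R]_N) : y - x = (A - x) - (A - y) by rewrite opprB [RHS]addrC subrKA.
  by rewrite scalerBr; exact: gen.
apply: (le_trans (ler_normB _ _)); rewrite mulrDr; apply: lerD; first by rewrite mulrC.
by rewrite mulrC -[X in e * X](gtr0_norm u0).
Qed.

(** Within [G], the set where the rate exceeds [c] is a countable union of slope sets:
    semicontinuity covers it by those of admissible indices with [cost_of i > c], and
    [slope_set_velocity] shows that it contains them. *)
Lemma rate_measurable (g : 'I_N -> R -> R) (G : set R) : measurable G -> G `<=` `]0, T[ ->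
  (forall t, G t -> is_derive t 1 phi (\row_i g i t)) ->
  (forall t, G t -> forall i, phi t ord0 i = 0 -> g i t = 0) ->
  measurable_fun G (fun t => L (pos_coords (phi t)) (\row_i g i t)).
Proof.
move=> mG GT der zer mG'; apply: (measurability _ (ErealGenOInfty.measurableE R)) => // _ [_ [c ->] <-].
have inT t : G t -> 0 < t < T by move=> /GT; rewrite /= in_itv.
have fL t : G t -> face (pos_coords (phi t)) (phi t).
  by move=> /inT /andP[t0 tT]; split => //; apply: oT; rewrite !ltW.
have v0 t : G t -> forall j, j \notin pos_coords (phi t) -> (\row_i g i t : 'rV[R]_N) ord0 j = 0.
  by move=> Gt j jL; rewrite mxE zer//; exact: face_coord0 (fL t Gt) jL.
pose B n : set R := [set t | exists2 i : idx, (choice.unpickle n : option idx) = Some i &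
  [/\ admissible i, c < cost_of i & slope_set i t]].
have -> : G `&` (fun t => L (pos_coords (phi t)) (\row_i g i t)) @^-1` `]c%:E, +oo[ = G `&` \bigcup_n B n.
  apply/seteqP; split => t [Gt].
    rewrite /= in_itv/= andbT => cL.
    have [x cx xL] : exists2 x, c < x & (x%:E <= L (pos_coords (phi t)) (\row_i g i t))%E.
      move: cL; case: (L _ _) => [l| |]//; first by rewrite lte_fin => cl; exists l.
      by exists (c + 1); rewrite ?leey// ltrDl.
    have xc0 : 0 < (x - c) / 2 by rewrite divr_gt0// subr_gt0.
    have [i [ok sl xi]] := slope_set_cover (inT t Gt) (der t Gt) (fL t Gt) (v0 t Gt) xL xc0.
    split => //; exists (choice.pickle i) => //; exists i; first by rewrite choice.pickleK.
    by split => //; lra.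
  move=> [n _ [i _ [ok ci sl]]]; split => //; rewrite /= in_itv/= andbT.
  apply: (@lt_le_trans _ _ (cost_of i)%:E); first by rewrite lte_fin.
  have /andP[t0 tT] := inT t Gt.
  have fi : face_of i = pos_coords (phi t).
    have [h1 h2 _] := sl; have pt : phic T phi t = phi t by apply: phicE; rewrite !ltW.
    have [_ <-//] : face (face_of i) (phi t).
    rewrite -pt; apply: faceP => // l lL; apply: lt_le_trans (h1 l lL); exact: rad_gt0.
  rewrite -fi; apply: ok; first by rewrite fi; exact: v0.
  exact: slope_set_velocity (inT t Gt) (der t Gt) sl.
apply: measurableI => //; apply: bigcup_measurable => n _.
have [[i [ei ok ci]]|none] := pselect (exists i : idx, [/\ (choice.unpickle n : option idx) = Some i, admissible i & c < cost_of i]).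
  suff -> : B n = slope_set i by exact: slope_set_measurable.
  by apply/seteqP; split => [t [j]|t sl]; [rewrite ei => -[<-] []|exists i].
suff -> : B n = set0 by exact: measurable0.
by rewrite -subset0 => t [i ei [ok ci _]]; apply: none; exists i.
Qed.

End cell_section.

(** * Routes following an absolutely continuous path *)

Section visit.
Variables (R : realType) (N : nat) (L : {set 'I_N} -> 'rV[R]_N -> \bar R).
Variables (r K : R).
Hypotheses (r0 : 0 < r) (r1 : r <= 1).
Hypothesis rK : forall v : 'rV[R]_N, `|v| <= r -> (L [set: 'I_N]%SET v <= K%:E)%E.

(** [route_connect] timed by the distance: [h = 2 / r * e]. *)
Lemma route_connect' tau psi c e z : route L tau psi c -> 0 < e -> orthant z ->
  `|z - psi tau| <= e ->
  exists psi', [/\ route L (tau + 4 / r * e) psi' (c + 4 / r * e * K), extends tau psi psi',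
    psi' (tau + 4 / r * e) = z &
    forall t, tau <= t <= tau + 4 / r * e -> `|psi' t - psi tau| <= 4 / r * e].
Proof.
move=> rt e0 oz ze.
have h0 : 0 < 2 / r * e by rewrite mulr_gt0// divr_gt0.
have hE : 2 * (2 / r * e) = 4 / r * e by field; rewrite gt_eqF.
have ze' : `|z - psi tau| <= r * (2 / r * e) / 2.
  by have -> : r * (2 / r * e) / 2 = e by field; rewrite gt_eqF.
by have := route_connect r0 r1 rK rt h0 oz ze'; rewrite hE.
Qed.

(** Two detours of duration [4 / r * e], one to [y] and one from the end of the segment to [z],
    account for [8 / r * e]. The segment stays in the face, because its length is below the lower
    bound [kappa] of the positive coordinates. *)
Lemma route_visit tau psi c e l (Lambda : {set 'I_N}) w C kappa y z :
  route L tau psi c -> 0 < e -> 0 < l -> face Lambda y -> orthant z ->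
  `|y - psi tau| <= e -> `|z - (y + l *: w)| <= e ->
  (forall i, i \notin Lambda -> w ord0 i = 0) ->
  (forall i, i \in Lambda -> kappa <= y ord0 i) -> l * `|w| < kappa ->
  (l%:E * L Lambda w <= C%:E)%E ->
  exists psi', let sigma := 8 / r * e + l in
   [/\ route L (tau + sigma) psi' (c + (8 / r * e * K + C)), extends tau psi psi',
    psi' (tau + sigma) = z &
    forall t, tau <= t <= tau + sigma -> `|psi' t - psi tau| <= 8 / r * e + l * `|w|].
Proof.
move=> rt e0 l0 fy oz ye ze w0 ky lw cost.
have oy : orthant y by case: fy.
have [psi1 [rt1 ex1 end1 d1]] := route_connect' rt e0 oy ye.
set h := 4 / r * e in rt1 end1 d1.
have h0 : 0 < h by rewrite mulr_gt0// divr_gt0.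
have hE : 8 / r * e = h + h by rewrite /h; field; rewrite gt_eqF.
have inface t : 0 <= t <= l -> face Lambda (y + t *: w).
  move=> /andP[t0 tl]; apply: faceP => i iL; rewrite !mxE.
    have yk := ky i iL; have wi := coord_le_norm w i.
    have : t * `|w ord0 i| <= l * `|w| by apply: ler_pM.
    have : - (t * `|w ord0 i|) <= t * w ord0 i.
      by rewrite -mulrN ler_wpM2l// lerNl; apply: le_trans (ler_norm _) _; rewrite normrN.
    by move: yk lw; lra.
  by rewrite w0// (face_coord0 fy iL) mulr0 addr0.
have [|||psi2 [rt2 ex2 end2 d2]] := @route_segment _ _ _ (tau + h) psi1 (c + h * K) l Lambda w C rt1 l0.
- by rewrite end1; have [] : face Lambda (y + l *: w) by apply: inface; rewrite lexx ltW.
- by move=> t /andP[t0 tl]; rewrite end1; apply: inface; rewrite !ltW.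
- exact: cost.
have ze2 : `|z - psi2 (tau + h + l)| <= e by rewrite end2 end1.
have [psi3 [rt3 ex3 end3 d3]] := route_connect' rt2 e0 oz ze2.
rewrite -/h in rt3 end3 d3.
have tE : tau + (8 / r * e + l) = tau + h + l + h by rewrite hE; ring.
exists psi3; rewrite /= tE hE; split => //.
- apply: route_le rt3; have -> : c + h * K + C + h * K = c + ((h + h) * K + C) by ring.
  exact: lexx.
- by move=> t tt; rewrite ex3 ?ex2 ?ex1//; lra.
move=> t /andP[t1 t2].
have lw0 : 0 <= l * `|w| by rewrite mulr_ge0// ltW.
have yh : `|y - psi tau| <= h.
  by rewrite -end1; apply: d1; rewrite lexx andbT lerDl ltW.
have [th|th] := leP t (tau + h).
  rewrite ex3 ?ex2//; last by lra.
  by apply: (le_trans (d1 t _)); [rewrite t1|lra].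
have [tl|tl] := leP t (tau + h + l).
  rewrite ex3//; have := d2 t; rewrite (ltW th) tl => /(_ isT); rewrite end1 => h2.
  by apply: (le_trans (ler_distD y _ _)); lra.
have := d3 t; rewrite (ltW tl) t2 => /(_ isT) h3.
have h2 : `|psi2 (tau + h + l) - y| <= l * `|w|.
  by rewrite -end1; apply: d2; rewrite lexx andbT lerDl ltW.
apply: (le_trans (ler_distD (psi2 (tau + h + l)) _ _)).
by have := ler_distD y (psi2 (tau + h + l)) (psi tau); lra.
Qed.

End visit.

(** * Deviation from a constant velocity *)

Section density.
Variables (R : realType) (N : nat) (T : R) (phi : R -> 'rV[R]_N) (g : 'I_N -> R -> R).
Notation mu := (@lebesgue_measure R).
Hypotheses (T0 : 0 < T) (ig : forall i, mu.-integrable setT (EFin \o g i)).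
Hypothesis ftc : forall i a b, 0 <= a -> a <= b -> b <= T ->
  (phi b ord0 i - phi a ord0 i)%:E = (\int[mu]_(x in `[a, b]) (g i x)%:E)%E.

(** One integrable weight for two errors: the indicator counts the time lost outside [S], the sum
    bounds the displacement there. *)
Definition speed (t : R) : R := \1_(`[0, T]) t + \sum_i `|g i t|.

Lemma speed_ge0 t : 0 <= speed t.
Proof. by rewrite /speed addr_ge0// sumr_ge0. Qed.

Lemma le_speed i t : `|g i t| <= speed t.
Proof.
rewrite /speed (bigD1 i)//= addrCA lerDl addr_ge0// sumr_ge0//.
Qed.

Lemma speed_ge1 t : 0 <= t <= T -> 1 <= speed t.
Proof.
move=> tT; rewrite /speed indicE mem_set/= ?in_itv//= lerDl sumr_ge0//.
Qed.

Lemma speed_integrable : mu.-integrable setT (EFin \o speed).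
Proof.
have -> : EFin \o speed = (EFin \o \1_(`[0, T])) \+ (fun t => \sum_i (`|g i t|)%:E)%E.
  by apply/funext => t; rewrite /= /speed EFinD sumEFin.
apply: integrableD; first exact: measurableT.
  exact: integrable_indic_itv.
apply: integrable_sum => [|i _]; first exact: measurableT.
exact: (integrable_norm (ig i)).
Qed.

(** On [S] the velocity is [w] up to [eta]; off [S] each coordinate of the velocity is bounded by
    the speed. Subintervals are allowed in order to reach the least point of [S] and to leave from
    it. *)
Lemma density_deviation (a b p q eta : R) (S : set R) (w : 'rV[R]_N) : 0 <= a -> a <= p -> p <= q -> q <= b -> b <= T ->
  measurable S -> S `<=` `[a, b] -> 0 <= eta ->
  (forall t i, S t -> `|g i t - w ord0 i| <= eta) ->
  `|phi q - phi p - fine (mu (S `&` `[p, q])) *: w| <=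
    fine (\int[mu]_(x in `[a, b] `\` S) (speed x)%:E)%E + eta * fine (mu S).
Proof.
move=> a0 ap pq qb bT mS Sab eta0 dev.
have mab : measurable `[a, b] by exact: measurable_itv.
have mpq : measurable `[p, q] by exact: measurable_itv.
have muSfin (A : set R) : measurable A -> A `<=` `[a, b] -> mu A \is a fin_num.
  move=> mA Aab; rewrite ge0_fin_numE ?measure_ge0//.
  apply: (@le_lt_trans _ _ (mu `[a, b])); last by rewrite lebesgue_measure_itv/=; case: ifP => _; rewrite -?EFinB ltry.
  by apply: le_measure; [exact/mem_set|exact/mem_set|].
have pqab : `[p, q]%classic `<=` `[a, b]%classic.
  by apply: subset_itv; rewrite bnd_simp.
have mD : measurable (`[a, b]%classic `\` S) by exact: measurableD.
have ispeed (A : set R) : measurable A -> mu.-integrable A (EFin \o speed).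
  by move=> mA; apply: integrableS speed_integrable.
have int0 (A : set R) : (0 <= \int[mu]_(x in A) (speed x)%:E)%E.
  by apply: integral_ge0 => x _; rewrite lee_fin speed_ge0.
apply: norm_le_coord.
  rewrite addr_ge0 ?fine_ge0//.
  by rewrite mulr_ge0// fine_ge0.
move=> i.
have iind : mu.-integrable setT (EFin \o \1_S).
  apply/integrableP; split; first by apply/measurable_EFinP; exact: measurable_indic.
  under eq_integral do rewrite /= ger0_norm//.
  by rewrite integral_indic// setIT -ge0_fin_numE ?measure_ge0//; exact: muSfin.
pose k t := g i t - w ord0 i * \1_S t.
have iZ : mu.-integrable setT (EFin \o (fun x => w ord0 i * \1_S x)).
  rewrite (_ : EFin \o _ = (fun x => (w ord0 i)%:E * (EFin \o \1_S) x)%E).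
    exact: integrableZl.
  by apply/funext => x; rewrite /= EFinM.
have E1 : ((phi q - phi p - fine (mu (S `&` `[p, q])) *: w) ord0 i)%:E = (\int[mu]_(x in `[p, q]) (k x)%:E)%E.
  under eq_integral do rewrite /k EFinB.
  rewrite integralB_EFin//.
  - rewrite -ftc//; last 2 first.
    + exact: le_trans ap.
    + exact: le_trans bT.
    rewrite !mxE EFinB EFinB; congr (_ - _)%E.
    under eq_integral do rewrite EFinM.
    rewrite integralZl//; last first.
      by apply: integrableS iind.
    rewrite integral_indic// mulrC EFinM fineK//.
    apply: muSfin; first by apply: measurableI.
    by move=> t [/Sab].
  - by apply: integrableS (ig i).
  - by apply: integrableS iZ.
have mk : measurable_fun setT k.
  apply: measurable_funB; apply/measurable_EFinP; [by case/integrableP: (ig i)|by case/integrableP: iZ].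
pose bnd t := (((EFin \o speed) \_ (~` S)) t + eta%:E * (\1_S t)%:E)%E.
have msp : measurable_fun setT (EFin \o speed) by case/integrableP: speed_integrable.
have mres : measurable_fun setT ((EFin \o speed) \_ (~` S)).
  apply/(measurable_restrictT _ (measurableC mS)); exact: measurable_funTS.
have mind : measurable_fun setT (fun t => (eta%:E * (\1_S t)%:E)%E).
  apply: emeasurable_funM; first exact: measurable_cst.
  by apply/measurable_EFinP; exact: measurable_indic.
have res0 t : (0 <= ((EFin \o speed) \_ (~` S)) t)%E.
  by apply: erestrict_ge0 => x _; rewrite lee_fin speed_ge0.
have ind0 t : (0 <= eta%:E * (\1_S t)%:E)%E by apply: mule_ge0; rewrite lee_fin.
have mbnd : measurable_fun setT bnd by exact: emeasurable_funD.
have bnd0 t : (0 <= bnd t)%E by exact: adde_ge0.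
have kbnd t : (`|(k t)%:E| <= bnd t)%E.
  rewrite /bnd /k indicE; have [St|St] := pselect (S t).
    rewrite mem_set//= mulr1 mule1 /patch memNset; last by move=> /(_ St).
    by rewrite add0e lee_fin; exact: dev.
  by rewrite memNset//= mulr0 mule0 subr0 adde0 /patch mem_set//= lee_fin le_speed.
rewrite -lee_fin -abse_EFin E1.
apply: (@le_trans _ _ (\int[mu]_(x in `[p, q]) `|(k x)%:E|)%E).
  apply: le_abse_integral; first exact: mpq.
  by apply/measurable_EFinP; exact: measurable_funTS.
apply: (@le_trans _ _ (\int[mu]_(x in `[p, q]) bnd x)%E).
  apply: ge0_le_integral => //.
  - apply: measurableT_comp => //; by apply/measurable_EFinP; exact: measurable_funTS.
  - exact: measurable_funTS.
apply: (@le_trans _ _ (\int[mu]_(x in `[a, b]) bnd x)%E).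
  by apply: ge0_subset_integral => //; exact: measurable_funTS.
rewrite /bnd ge0_integralD//; last 2 first.
- exact: measurable_funTS.
- exact: measurable_funTS.
rewrite -integral_mkcondr -setDE EFinD fineK; last first.
  by apply: integrable_fin_num => //; exact: ispeed.
rewrite leeD2l// ge0_integralZl_EFin//; last first.
  by apply/measurable_EFinP; exact: measurable_indic.
rewrite integral_indic// EFinM fineK ?muSfin// (setIidl Sab).
exact: lexx.
Qed.

End density.

Section iterate.
Variables (R : realType) (N : nat) (L : {set 'I_N} -> 'rV[R]_N -> \bar R).
Variables (r K : R).
Hypotheses (r0 : 0 < r) (r1 : r <= 1) (K0 : 0 <= K).
Hypothesis rK : forall v : 'rV[R]_N, `|v| <= r -> (L [set: 'I_N]%SET v <= K%:E)%E.

(** Both sides are suprema over the simple functions below, for arbitrary nonnegative functions. *)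
Lemma ge0_le_integral_gen (D : set R) (f1 f2 : R -> \bar R) :
  (forall x, D x -> (0 <= f1 x)%E) -> (forall x, D x -> (f1 x <= f2 x)%E) ->
  (\int[@lebesgue_measure R]_(x in D) f1 x <= \int[@lebesgue_measure R]_(x in D) f2 x)%E.
Proof.
move=> f10 f12; have f20 x : D x -> (0 <= f2 x)%E by move=> Dx; rewrite (le_trans (f10 x Dx))// f12.
rewrite !ge0_integralE//; apply: ge_ereal_sup => _ [h /= hf <-].
apply: ereal_sup_ubound; exists h => //= x; apply: (le_trans (hf x)).
by rewrite /patch; case: ifPn => // /set_mem Dx; exact: f12.
Qed.

(** The lower bound on [sigma] prevents the route from being ahead of [phi], so that it can finally
    be cut at [T]. Here [e] measures the detours, [C] the cost on the face and [theta] the distance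
    travelled there. *)
Definition continuable (phi : R -> 'rV[R]_N) (a b e C theta : R) :=
  forall tau psi c, route L tau psi c -> psi tau = phi a ->
  exists psi' sigma, [/\ route L (tau + sigma) psi' (c + (8 / r * e * K + C)),
    extends tau psi psi', psi' (tau + sigma) = phi b,
    b - a <= sigma <= 8 / r * e + (b - a) &
    forall t, tau <= t <= tau + sigma -> `|psi' t - psi tau| <= 8 / r * e + theta].

Lemma route_iterate phi (t e C : nat -> R) theta mesh m : orthant (phi 0) -> t 0%N = 0 ->
  0 <= theta -> 0 <= mesh -> (forall j, (j < m)%N -> 0 <= e j) ->
  (forall j, (j < m)%N -> t j.+1 - t j <= mesh) ->
  (forall j, (j < m)%N -> continuable phi (t j) (t j.+1) (e j) (C j) theta) ->
  exists tau psi, let X := 8 / r * \sum_(j < m) e j in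
  [/\ route L tau psi (X * K + \sum_(j < m) C j), psi 0 = phi 0, t m <= tau &
    forall u, 0 <= u <= tau -> exists j, [/\ (j <= m)%N, `|u - t j| <= X + mesh &
      `|psi u - phi (t j)| <= X + theta]].
Proof.
move=> o0 t0 th0 me0 e0 tm step.
(* The induction also needs the final position and a two-sided bound on the total delay. *)
suff [tau [psi [rt p0 _ /andP[tt _] tr]]] : exists tau psi, let X := 8 / r * \sum_(j < m) e j in
  [/\ route L tau psi (X * K + \sum_(j < m) C j), psi 0 = phi 0, psi tau = phi (t m), t m <= tau <= t m + X &
    forall u, 0 <= u <= tau -> exists j, [/\ (j <= m)%N, `|u - t j| <= X + mesh &
      `|psi u - phi (t j)| <= X + theta]] by exists tau, psi.
elim: m e0 tm step => [|m IH] e0 tm step.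
  exists 0, (cst (phi 0)); rewrite /= !big_ord0 t0 mulr0 mul0r !addr0 lexx; split => //.
    exact: route0.
  move=> u /andP[u0 u1]; have -> : u = 0 by apply/le_anti/andP.
  by exists 0%N; rewrite t0 !subrr !normr0 !add0r.
have [] := IH; [by move=> j jm; apply: e0; exact: ltnW|by move=> j jm; apply: tm; exact: ltnW|
  by move=> j jm; apply: step; exact: ltnW|].
move=> tau [psi [rt p0 pt /andP[t1 t2] tr]].
have [psi' [sigma [rt' ex end' /andP[s1 s2] d]]] := step m (ltnSn m) tau psi _ rt pt.
have em := e0 m (ltnSn m); have tmm := tm m (ltnSn m).
have c8 : 0 < 8 / r by rewrite divr_gt0.
set X := 8 / r * \sum_(j < m) e j in rt rt' t2 tr *.
have X0 : 0 <= X.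
  by rewrite mulr_ge0 ?(ltW c8)// sumr_ge0// => j _; apply: e0; rewrite ltnS ltnW.
have Xe : 8 / r * \sum_(j < m.+1) e j = X + 8 / r * e m by rewrite big_ord_recr/= mulrDr.
have xe0 : 0 <= 8 / r * e m by rewrite mulr_ge0// ltW.
have tau0 := route_ge0 rt.
exists (tau + sigma), psi'; rewrite /= Xe; split.
- apply: route_le rt'; rewrite big_ord_recr/=; set sC := \sum_(j < m) C j.
  have -> : (X + 8 / r * e m) * K + (sC + C m) = X * K + sC + (8 / r * e m * K + C m) by ring.
  exact: lexx.
- by rewrite ex.
- exact: end'.
- by apply/andP; split; lra.
move=> u /andP[u0 u1]; have [ut|ut] := leP u tau.
  have [j [jm h1 h2]] := tr u (introT andP (conj u0 ut)).
  by exists j; rewrite (leqW jm) ex//; split => //; lra.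
exists m; rewrite leqnSn; split => //.
  by rewrite ler_norml; apply/andP; split; lra.
by have := d u; rewrite (ltW ut) u1 pt => /(_ isT); lra.
Qed.

Variables (T : R) (phi : R -> 'rV[R]_N) (g : 'I_N -> R -> R).
Notation mu := (@lebesgue_measure R).
Hypotheses (T0 : 0 < T) (oT : in_orthant T phi) (ig : forall i, mu.-integrable setT (EFin \o g i)).
Hypothesis ftc : forall i a b, 0 <= a -> a <= b -> b <= T ->
  (phi b ord0 i - phi a ord0 i)%:E = (\int[mu]_(x in `[a, b]) (g i x)%:E)%E.

(** The deviation bound [e] controls both detours: from [phi a] to the value at the least point of
    [S], and from the end of a stretch of duration [|S|] at velocity [w] to [phi b]. *)
Lemma cell_continuable a b (S : set R) (Lambda : {set 'I_N}) (w : 'rV[R]_N) kappa theta C eta :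
  0 <= a -> a < b -> b <= T -> compact S -> S `<=` `[a, b] -> 0 < eta -> 0 <= theta -> 0 <= C ->
  (forall t, S t -> face Lambda (phi t)) ->
  (forall t i, S t -> i \in Lambda -> kappa <= phi t ord0 i) ->
  (forall t i, S t -> `|g i t - w ord0 i| <= eta) ->
  (S !=set0 -> forall i, i \notin Lambda -> w ord0 i = 0) ->
  (b - a) * `|w| < kappa -> (b - a) * `|w| <= theta ->
  ((fine (mu S))%:E * L Lambda w <= C%:E)%E ->
  continuable phi a b (fine (\int[mu]_(x in `[a, b] `\` S) (speed T g x)%:E)%E + eta * fine (mu S)) C theta.
Proof.
move=> a0 ab bT cS Sab eta0 th0 C0 fS kS dev w0 wk wt cost tau psi c rt pt.
have mS : measurable S by exact: compact_measurable.
set l := fine (mu S) in cost *; set beta := fine _.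
have l0 : 0 <= l by rewrite fine_ge0.
have isp := speed_integrable T ig.
have mD : measurable (`[a, b]%classic `\` S) by apply: measurableD; [exact: measurable_itv|].
have isD : mu.-integrable (`[a, b]%classic `\` S) (EFin \o speed T g) by apply: integrableS isp.
have beta0 : 0 <= beta.
  by apply/fine_ge0/integral_ge0 => x _; rewrite lee_fin speed_ge0.
have muab : mu `[a, b]%classic = (b - a)%:E by rewrite lebesgue_measure_itv/= lte_fin ab.
have muS : (mu S <= (b - a)%:E)%E.
  rewrite -muab; apply: le_measure; [apply: mem_set; exact: mS|apply: mem_set; exact: measurable_itv|exact: Sab].
have muSfin : mu S \is a fin_num by rewrite ge0_fin_numE ?measure_ge0// (le_lt_trans muS)// ltry.
have lab : l <= b - a by rewrite -lee_fin /l fineK.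
(* The speed being at least 1, [beta] dominates the time outside [S]; detours last at least as long,
   so that the route is not early. *)
have babl : b - a <= beta + l.
  have El : l%:E = mu S by rewrite /l fineK.
  have Eb : beta%:E = (\int[mu]_(x in `[a, b] `\` S) (speed T g x)%:E)%E.
    by rewrite /beta fineK//; exact: integrable_fin_num.
  rewrite -lee_fin -muab EFinD El Eb.
  rewrite -[X in mu X](setDUK Sab); apply: (le_trans (measureU2 _ _ _)) => //.
  rewrite [leRHS]addeC leeD2l//.
  apply: (@le_trans _ _ (\int[mu]_(x in `[a, b] `\` S) (cst 1%E x))%E).
    by rewrite integral_cst// mul1e.
  apply: ge0_le_integral => //.
  - by case/integrableP: isD.
  - move=> x [xab _]; rewrite lee_fin; apply: speed_ge1; move: xab; rewrite /= in_itv/= => /andP[h1 h2].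
    by rewrite (le_trans a0 h1) (le_trans h2).
set e := beta + eta * l.
have c8 : 8 <= 8 / r by rewrite ler_pdivlMr// ler_piMr.
have c48 : 4 / r + 4 / r = 8 / r by field; rewrite gt_eqF.
have e0 : 0 < e.
  rewrite /e; have [l0'|l0'] := eqVneq l 0; first by rewrite l0' mulr0 addr0; lra.
  by rewrite ltr_wpDl// mulr_gt0// lt_neqAle eq_sym l0'.
have e8 : 8 * e <= 8 / r * e by rewrite ler_wpM2r// ltW.
have ob : orthant (phi b) by apply: oT; rewrite bT andbT (le_trans a0)// ltW.
have deviate p q : a <= p -> p <= q -> q <= b ->
    `|phi q - phi p - fine (mu (S `&` `[p, q])) *: w| <= e.
  by move=> ap pq qb; apply: (density_deviation ig ftc a0 ap pq qb bT mS Sab (ltW eta0)) => t i; exact: dev.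
(* When [S] is null there is no stretch on the face: a single detour leads from [phi a] to
   [phi b]. *)
have [l0'|l0'] := eqVneq l 0.
  have ze : `|phi b - psi tau| <= e.
    have := deviate a b (lexx a) (ltW ab) (lexx b).
    by rewrite (setIidl Sab) -/l l0' scale0r subr0 pt.
  have [psi' [rt' ex end' d]] := route_connect' r0 r1 rK rt e0 ob ze.
  have e4 : 4 / r * e + 4 / r * e = 8 / r * e by rewrite -mulrDl c48.
  have ebeta : e = beta by rewrite /e l0' mulr0 addr0.
  exists psi', (4 / r * e); split => //.
  - apply: route_le rt'; rewrite lerD2l; apply: (@le_trans _ _ (8 / r * e * K)); last by rewrite lerDl.
    by rewrite ler_wpM2r//; lra.
  - by apply/andP; split; lra.
  - by move=> t tt; apply: (le_trans (d t tt)); lra.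
have lpos : 0 < l by rewrite lt_neqAle eq_sym l0'.
have S0 : S !=set0 by apply/set0P/eqP => E; move: l0'; rewrite /l E measure0 eqxx.
have [s [s' [Ss _ sS]]] := compact_endpoints cS S0.
have /andP[as_ sb] : a <= s <= b by have := Sab _ Ss; rewrite /= in_itv.
have Ssb : S `<=` `[s, b].
  move=> t St; have := Sab _ St; rewrite /= !in_itv/= => /andP[_ ->].
  by have /andP[-> _] := sS _ St.
have y1 : `|phi s - psi tau| <= e.
  have := deviate a s (lexx a) as_ sb; rewrite pt.
  (* Before its least point [S] has measure zero, so that no drift is subtracted. *)
  have -> : S `&` `[a, s] = [set s].
    apply/seteqP; split => t; last by move=> ->; split => //; rewrite /= in_itv/= as_ lexx.
    move=> [St]; rewrite /= in_itv/= => /andP[_ ts]; apply/le_anti/andP; split => //.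
    by have /andP[] := sS _ St.
  by rewrite lebesgue_measure_set1/= scale0r subr0.
have z1 : `|phi b - (phi s + l *: w)| <= e.
  have := deviate s b as_ sb (lexx b).
  by rewrite (setIidl Ssb) -/l opprD addrA.
have lw : l * `|w| <= (b - a) * `|w| by rewrite ler_wpM2r.
have [psi' [rt' ex end' d]] := route_visit r0 r1 rK rt e0 lpos (fS _ Ss) ob y1 z1 (w0 S0)
   (fun i iL => kS s i Ss iL) (le_lt_trans lw wk) cost.
exists psi', (8 / r * e + l); split => //.
- apply/andP; split; last by rewrite lerD2l.
  apply: (le_trans babl); rewrite lerD2r; apply: le_trans e8.
  have : 0 <= eta * l by rewrite mulr_ge0// ltW.
  by rewrite /e; lra.
- by move=> t tt; apply: (le_trans (d t tt)); rewrite lerD2l (le_trans lw).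
Qed.

End iterate.

(** * The rate function is at most the action *)

Section rate_action.
Variables (R : realType) (N : nat) (d : measure_display).
Variables (Omega : measurableType d) (E : set 'rV[R]_N).
Variables (P : 'rV[R]_N -> probability Omega R).
Variables (k : R -> R.-pker (borel_rV R N) ~> (borel_rV R N)).
Variables (X : 'rV[R]_N -> R -> Omega -> 'rV[R]_N).
Hypothesis mp : markov_process E P k X.
Hypothesis E_dense : dense_states E.
Variable (L : {set 'I_N} -> 'rV[R]_N -> \bar R).
Hypothesis L_ge0 : forall (Lambda : {set 'I_N}) (v : 'rV[R]_N), (0 <= L Lambda v)%E.
Hypothesis A1 : segment_lower_bound E P X L.
Hypothesis A3 : face_upper_bound E P X L.
Variables (r K : R).
Hypotheses (r0 : 0 < r) (r1 : r <= 1) (K0 : 0 <= K).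
Hypothesis rK : forall v : 'rV[R]_N, `|v| <= r -> (L [set: 'I_N]%SET v <= K%:E)%E.
Variables (T : R) (phi : R -> 'rV[R]_N).
Hypotheses (T0 : 0 < T) (oT : in_orthant T phi) (acT : absolutely_continuous T phi).
Notation mu := (@lebesgue_measure R).

Let rad (m : nat) : R := m.+1%:R^-1.
Let rad_gt0 m : 0 < rad m. Proof. by rewrite invr_gt0. Qed.

(* Face, lower bound of the positive coordinates, rational velocity, level of
   the rate. *)
Let idx : countType := ({set 'I_N} * nat * 'rV[rat]_N * nat)%type.
Let face_of (i : idx) := i.1.1.1.
Let pos_of (i : idx) : R := rad i.1.1.2.
Let vel_of (i : idx) : 'rV[R]_N := map_mx ratr i.1.2.
Let level_of (i : idx) : R := i.2%:R.

(** Faces, boxes of side [eta] around rational velocities and slices of height [eta] of the rate are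
    countably many, and on each combination the velocity and the rate oscillate by at most [eta]. *)
Lemma rate_cover (g : 'I_N -> R -> R) (D : set R) (f : R -> \bar R) (eta : R) :
  measurable D -> D `<=` `]0, T[ -> (forall i, measurable_fun setT (g i)) ->
  measurable_fun D f -> (forall t, D t -> (0 <= f t)%E) -> (forall t, D t -> f t \is a fin_num) -> 0 < eta ->
  exists B : nat -> set R, [/\ forall n, measurable (B n), D `<=` \bigcup_n B n &
    forall n, exists (Lambda : {set 'I_N}) (kappa M : R), [/\ 0 < kappa, 0 <= M &
      forall t, B n t -> [/\ face Lambda (phi t),
        forall i, i \in Lambda -> kappa <= phi t ord0 i,
        `|\row_i g i t : 'rV[R]_N| <= M,
        forall s i, B n s -> `|g i t - g i s| <= eta &
        forall s, B n s -> (f s <= f t + eta%:E)%E]]].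
Proof.
move=> mD DT mg mf f0 ffin eta0; have e20 : 0 < eta / 2 by rewrite divr_gt0.
have inT t : D t -> 0 <= t <= T by move=> /DT; rewrite /= in_itv/= => /andP[t0 tT]; rewrite !ltW.
have cc := phic_coord_continuous T0 acT.
pose C (i : idx) : set R := [set t |
  (forall j, j \in face_of i -> pos_of i <= phic T phi t ord0 j) /\
  (forall j, j \notin face_of i -> phic T phi t ord0 j = 0)].
have mC i : measurable (C i).
  apply: closed_measurable.
  have -> : C i = \bigcap_(j in [set j | j \in face_of i]) [set t | pos_of i <= phic T phi t ord0 j] `&`
      \bigcap_(j in [set j | j \notin face_of i]) [set t | phic T phi t ord0 j = 0].
    by apply/seteqP; split => t [h1 h2].
  apply: closedI; apply: closed_bigI => j _.
    by apply: (continuous_closedP _).1 (@closed_ge _ (pos_of i)); exact: cc.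
  by apply: (continuous_closedP _).1 (@closed_eq _ 0); exact: cc.
pose V (i : idx) : set R := \bigcap_(j in [set: 'I_N]) (g j @^-1` `[vel_of i ord0 j - eta / 2, vel_of i ord0 j + eta / 2]).
have mV i : measurable (V i).
  apply: fin_bigcap_measurable => // j _.
  rewrite -[X in measurable X]setTI; apply: mg => //; exact: measurable_itv.
pose F (i : idx) : set R := D `&` f @^-1` `[(level_of i * eta)%:E, ((level_of i + 1) * eta)%:E].
have mF i : measurable (F i) by apply: mf => //; exact: emeasurable_itv.
pose B n : set R := [set t | exists2 i : idx, (choice.unpickle n : option idx) = Some i & [/\ C i t, V i t & F i t]].
exists B; split.
- move=> n; case E1 : (choice.unpickle n : option idx) => [i|].
    have -> : B n = C i `&` (V i `&` F i).
      apply/seteqP; split => t; first by move=> [j]; rewrite E1 => -[<-] [].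
      by move=> [h1 [h2 h3]]; exists i.
    by apply: measurableI => //; apply: measurableI.
  have -> : B n = set0 by rewrite -subset0 => t [i]; rewrite E1.
  exact: measurable0.
- move=> t Dt.
  have fL : face (pos_coords (phi t)) (phi t) by split => //; apply: oT; exact: inT.
  have [m0 Hm0] : exists m0, forall j, j \in pos_coords (phi t) -> rad m0 <= phi t ord0 j.
    pose x0 := \big[Num.min/1]_(j in pos_coords (phi t)) phi t ord0 j.
    have x00 : 0 < x0 by apply/bigmin_gtP; split => // j jL; rewrite (face_coord _ fL).
    have [m0 Hm0] := inv_nat_lt x00; exists m0 => j jL.
    by apply: (le_trans (ltW Hm0)); exact: bigmin_le_cond.
  have [w wv] := rat_vector_near (\row_i g i t) e20.
  pose x := fine (f t); have x0 : 0 <= x by rewrite fine_ge0// f0.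
  pose i : idx := (pos_coords (phi t), m0, w, Num.truncn (x / eta)).
  exists (choice.pickle i) => //; exists i; first by rewrite choice.pickleK.
  split.
  + by split => j jL; rewrite phicE ?inT//; [exact: Hm0|exact: face_coord0 fL jL].
  + move=> j _; rewrite /= in_itv/=; have := coord_le_norm (map_mx ratr w - \row_i g i t) j.
    rewrite !mxE => h; have := le_trans h wv; rewrite ler_norml => /andP[h1 h2].
    by apply/andP; split; lra.
  + split => //; rewrite /= in_itv/= -(fineK (ffin t Dt)) -/x !lee_fin /level_of/=.
    have xe0 : 0 <= x / eta by rewrite divr_ge0// ltW.
    have /andP[h1 h2] := truncn_itv xe0.
    rewrite -ler_pdivlMr// h1/=.
    by rewrite -ler_pdivrMr// natr1 ltW.
move=> n; case E1 : (choice.unpickle n : option idx) => [i|]; last first.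
  exists finset.set0, 1, 0; split => // t [i]; by rewrite E1.
have BE t : B n t -> [/\ C i t, V i t & F i t] by move=> [j]; rewrite E1 => -[<-].
exists (face_of i), (pos_of i), (`|vel_of i| + eta); split; [exact: rad_gt0|by rewrite addr_ge0// ltW|].
move=> t /BE[[c1 c2] v [Dt f1]].
have pt : phic T phi t = phi t by apply: phicE; exact: inT.
split.
- rewrite -pt; apply: faceP => // l lL; apply: lt_le_trans (c1 l lL); exact: rad_gt0.
- by move=> j jL; rewrite -pt; exact: c1.
- apply: norm_le_coord; first by rewrite addr_ge0// ltW.
  move=> j; rewrite mxE; have := v j I; rewrite /= in_itv/= => /andP[h1 h2].
  have := coord_le_norm (vel_of i) j; rewrite !ler_norml => /andP[h3 h4].
  by apply/andP; split; lra.
- move=> s j /BE[_ /(_ j I)/= + _]; have := v j I; rewrite /= !in_itv/= => /andP[h1 h2] /andP[h3 h4].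
  by rewrite ler_norml; apply/andP; split; lra.
- move=> s /BE[_ _ [Ds]]; move: f1; rewrite /= !in_itv/= => /andP[h1 h2] /andP[h3 h4].
  apply: (le_trans h4); rewrite mulrDl mul1r EFinD; exact: leeD2r.
Qed.

Lemma rate_fun_approx delta gamma A : (action L T phi <= A%:E)%E -> 0 < delta -> 0 < gamma ->
  exists psi, route L T psi (A + gamma) /\ forall t, 0 <= t <= T -> `|phi t - psi t| <= delta.
Proof.
move=> AA d0 g0.
have [g [G [mG GT muG ig [ftc der zer]]]] := path_density T0 oT acT.
pose f t := L (pos_coords (phi t)) (\row_i g i t).
have mf : measurable_fun G f := rate_measurable mp E_dense A1 A3 T0 oT acT mG GT der zer.
have mgi i : measurable_fun setT (g i) by apply/measurable_EFinP; case/integrableP: (ig i).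
have f0 t : (0 <= f t)%E by exact: L_ge0.
pose u := f \_ G.
have u0 t : (0 <= u t)%E by apply: erestrict_ge0.
have mu_ : measurable_fun setT u by apply/(measurable_restrictT _ mG).
have uA : (\int[mu]_(x in `[0%R, T]) u x <= A%:E)%E.
  apply: le_trans AA; apply: ge0_le_integral_gen => // t _.
  rewrite /u /patch; case: ifPn => [/set_mem Gt|_]; last exact: L_ge0.
  by rewrite /f derive1E; have /@derive_val -> := der t Gt.
have iu : mu.-integrable `[0%R, T] u.
  apply/integrableP; split; first exact: measurable_funTS.
  under eq_integral do rewrite gee0_abs//.
  exact: le_lt_trans uA (ltry _).
(* A finite action makes the rate finite almost everywhere, as slicing it into levels requires. *)
pose D := G `&` [set t | (f t < +oo)%E].
have mD : measurable D by exact: emeasurable_fun_infty_o.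
have ffin t : D t -> f t \is a fin_num by move=> [_ ft]; rewrite ge0_fin_numE.
have DG : D `<=` G by move=> t [].
have DT0 : D `<=` `]0, T[ by move=> t /DG /GT.
have DT : D `<=` `[0, T].
  by move=> t /DT0; rewrite /= !in_itv/= => /andP[/ltW-> /ltW->].
have muD : mu (`[0, T]%classic `\` D) = 0%E.
  have [Z [mZ Z0 subZ]] : {ae mu, forall t, `[0, T]%classic t -> u t \is a fin_num}.
    by apply: integrable_ae => //; exact: measurable_itv.
  apply/eqP; rewrite eq_le measure_ge0 andbT.
  have mTG : measurable (`[0, T]%classic `\` G) by apply: measurableD; [exact: measurable_itv|].
  apply: (@le_trans _ _ (mu ((`[0, T]%classic `\` G) `|` Z))).
    apply: le_measure.
    - by apply: mem_set; apply: measurableD; [exact: measurable_itv|exact: mD].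
    - by apply: mem_set; apply: measurableU.
    move=> t [tT nD]; have [Gt|] := pselect (G t); last by left.
    right; apply: subZ => h; apply: nD; split => //.
    have := h tT; rewrite /u /patch mem_set// => ft.
    by rewrite /= ltey_eq ft.
  apply: (le_trans (measureU2 _ _ _)) => //.
  by rewrite [X in (X + _)%E]muG add0e [X in (X <= _)%E]Z0.
have [dl dl0 Hdl] := phi_uniform acT (divr_gt0 d0 (ltr0n R 4) : 0 < delta / 4).
(* [X0] bounds the total delay: it has to be small for the uniform continuity of [phi], for the
   distance [delta], and for the cost [K] per unit of time of the detours. *)
pose X0 := Num.min (Num.min (dl / 4) (delta / 8)) (gamma / (2 * (K + 1))).
have K1 : 0 < K + 1 by rewrite ltr_wpDl.
have X00 : 0 < X0 by rewrite !lt_min !divr_gt0//= mulr_gt0.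
have T1 : 0 < 1 + T by rewrite addr_gt0.
(* The numbers [e j] will sum to at most [eta * (1 + T)]: [eta] from outside the sets [S j] and
   [eta * T] from inside. *)
pose eta := Num.min (r * X0 / (8 * (1 + T))) (gamma / (2 * T)).
have eta0 : 0 < eta by rewrite lt_min !divr_gt0// !mulr_gt0.
pose Xs := 8 / r * (eta * (1 + T)).
have XsX0 : Xs <= X0.
  have : eta <= r * X0 / (8 * (1 + T)) by rewrite ge_min lexx.
  rewrite ler_pdivlMr ?mulr_gt0// => h; rewrite /Xs mulrAC ler_pdivrMr//.
  by move: h; lra.
have Xdl : Xs <= dl / 4 by apply: (le_trans XsX0); rewrite /X0 !ge_min lexx.
have Xdelta : Xs <= delta / 8 by apply: (le_trans XsX0); rewrite /X0 !ge_min lexx !orbT.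
have XK : Xs * K <= gamma / 2.
  have : Xs <= gamma / (2 * (K + 1)) by apply: (le_trans XsX0); rewrite /X0 ge_min lexx orbT.
  rewrite ler_pdivlMr ?mulr_gt0// => h; have Xs0 : 0 <= Xs by rewrite /Xs mulr_ge0// ?divr_ge0// ?mulr_ge0// ltW.
  by move: h Xs0; nra.
have etaT : eta * T <= gamma / 2.
  have : eta <= gamma / (2 * T) by rewrite ge_min lexx orbT.
  by rewrite ler_pdivlMr ?mulr_gt0//; lra.
have theta0 : 0 < delta / 8 by rewrite divr_gt0.
have [B [mB DB HB]] := rate_cover mD DT0 mgi (measurable_funS mG DG mf) (fun t _ => f0 t) ffin eta0.
have /choice[prm prmP] n : exists p : {set 'I_N} * R * R, [/\ 0 < p.1.2, 0 <= p.2 &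
      forall t, B n t -> [/\ face p.1.1 (phi t),
        forall i, i \in p.1.1 -> p.1.2 <= phi t ord0 i,
        `|\row_i g i t : 'rV[R]_N| <= p.2,
        forall s i, B n s -> `|g i t - g i s| <= eta &
        forall s, B n s -> (f s <= f t + eta%:E)%E]].
  by have [Lambda [kappa [M H]]] := HB n; exists (Lambda, kappa, M).
(* In a cell shorter than this, a motion within the speed bound of [B n] covers less than the margin
   of the positive coordinates, and less than [delta / 8]. *)
pose rho n := Num.min (dl / 4) (Num.min (prm n).1.2 (delta / 8) / ((prm n).2 + 1)).
have rho0 n : 0 < rho n.
  have [k0 M0 _] := prmP n.
  by rewrite lt_min divr_gt0//= divr_gt0 ?lt_min ?k0//= ltr_wpDl.
have isp := speed_integrable T ig.
have [m [S [q [m0 HS Hsum]]]] := selection T0 mD DT muD mB DB rho0 isp (speed_ge0 T g) eta0.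
pose tj j := T * j%:R / m%:R.
have mpos : 0 < m%:R :> R by rewrite ltr0n.
have tjS j : tj j.+1 = tj j + T / m%:R by rewrite /tj -natr1 mulrDr mulr1 mulrDl.
have tj0 j : 0 <= tj j by rewrite !mulr_ge0// ?invr_ge0 ltW.
have tjT j : (j <= m)%N -> tj j <= T by move=> jm; rewrite ler_pdivrMr// ler_pM2l// ler_nat.
have tjm : tj m = T by rewrite /tj mulfK// gt_eqF.
have Tm0 : 0 < T / m%:R by rewrite divr_gt0.
have dtj j : tj j.+1 - tj j = T / m%:R by rewrite tjS addrAC subrr add0r.
have mS j : measurable (S j) by apply: compact_measurable; case: (HS j).
have Scell j : S j `<=` cell T m j by case: (HS j).
have mcell j : measurable (cell T m j) by exact: measurable_itv.
have mucell j : mu (cell T m j) = (T / m%:R)%:E.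
  by rewrite lebesgue_measure_itv/= lte_fin -/(tj j) -/(tj j.+1) tjS ltrDl Tm0 -EFinB -tjS dtj.
have muS j : (mu (S j) <= (T / m%:R)%:E)%E.
  rewrite -(mucell j); apply: le_measure; [apply: mem_set; exact: mS|apply: mem_set; exact: mcell|exact: Scell].
have muSfin j : mu (S j) \is a fin_num.
  by rewrite ge0_fin_numE ?measure_ge0// (le_lt_trans (muS j))// ltry.
have SD j : S j `<=` D by move=> t St; have [_ _ /(_ t St)[]] := HS j.
have SB j : S j `<=` B (q j) by move=> t St; have [_ _ /(_ t St)[]] := HS j.
have iuS j : mu.-integrable (S j) u.
  apply: integrableS iu; [exact: measurable_itv|exact: mS|exact: subset_trans (SD j) DT].
have intufin j : (\int[mu]_(x in S j) u x)%E \is a fin_num.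
  by apply: integrable_fin_num; [exact: mS|exact: iuS].
have mcellS j : measurable (cell T m j `\` S j) by apply: measurableD; [exact: mcell|exact: mS].
have intsfin j : (\int[mu]_(x in cell T m j `\` S j) (speed T g x)%:E)%E \is a fin_num.
  apply: integrable_fin_num; first exact: mcellS.
  by apply: integrableS isp => //; exact: mcellS.
have sumT : \sum_(j < m) fine (mu (S j)) <= T.
  apply: (@le_trans _ _ (\sum_(j < m) T / m%:R)).
    by apply: ler_sum => j _; rewrite -lee_fin fineK.
  by rewrite sumr_const card_ord -[leLHS]mulr_natr mulfVK ?gt_eqF.
pose e j := fine (\int[mu]_(x in cell T m j `\` S j) (speed T g x)%:E)%E + eta * fine (mu (S j)).
pose C j := fine (\int[mu]_(x in S j) u x)%E + eta * fine (mu (S j)).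
have C_ge0 j : 0 <= C j.
  rewrite addr_ge0 ?fine_ge0 ?integral_ge0//.
  by rewrite mulr_ge0 ?fine_ge0// ltW.
have step j : (j < m)%N -> continuable L r K phi (tj j) (tj j.+1) (e j) (C j) (delta / 8).
  move=> jm; have [cS _ _ Trho] := HS j.
  have ab : tj j < tj j.+1 by rewrite tjS ltrDl.
  (* An empty [S j] provides no face and no velocity; dummy values satisfy the conditions. *)
  have [Sj0|/set0P[t0 St0]] := eqVneq (S j) set0.
    apply: (cell_continuable r0 r1 K0 rK oT ig ftc (tj0 j) ab (tjT _ jm) cS (Scell j) eta0 (ltW theta0) (C_ge0 j) (Lambda := finset.set0) (w := 0) (kappa := 1)).
    - by rewrite Sj0.
    - by rewrite Sj0.
    - by rewrite Sj0.
    - by move=> [t]; rewrite Sj0.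
    - by rewrite normr0 mulr0.
    - by rewrite normr0 mulr0 ltW.
    - by rewrite Sj0 measure0 mul0e lee_fin.
  have [k0 M0 prmB] := prmP (q j).
  have [fL0 _ wM _ fcomp] := prmB _ (SB j _ St0).
  have [_ posL] := fL0.
  have M1 : 0 < (prm (q j)).2 + 1 by rewrite ltr_wpDl.
  have Tw : (tj j.+1 - tj j) * `|\row_i g i t0 : 'rV[R]_N| < Num.min (prm (q j)).1.2 (delta / 8).
    rewrite dtj; apply: (@le_lt_trans _ _ (T / m%:R * (prm (q j)).2)).
      by rewrite ler_wpM2l// ltW.
    apply: (@le_lt_trans _ _ (T / m%:R * ((prm (q j)).2 + 1))).
      by rewrite ler_wpM2l ?lerDl// ltW.
    rewrite -ltr_pdivlMr//; apply: (lt_le_trans Trho).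
    by rewrite /rho ge_min lexx orbT.
  apply: (cell_continuable r0 r1 K0 rK oT ig ftc (tj0 j) ab (tjT _ jm) cS (Scell j) eta0 (ltW theta0) (C_ge0 j) (Lambda := (prm (q j)).1.1) (w := \row_i g i t0) (kappa := (prm (q j)).1.2)).
  - by move=> t /SB /prmB[].
  - by move=> t i /SB /prmB[_ h _ _ _]; exact: h.
  - by move=> t i /SB /prmB[_ _ _ h _]; rewrite mxE; apply: h; exact: SB.
  - move=> _ i iL; rewrite mxE; apply: zer; first exact/DG/SD/St0.
    exact: face_coord0 fL0 iL.
  - by apply: (lt_le_trans Tw); rewrite ge_min lexx.
  - by apply: ltW; apply: (lt_le_trans Tw); rewrite ge_min lexx orbT.
  (* The rate at [t0] exceeds the rate elsewhere on [S j] by at most [eta]: integrating over [S j]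
     bounds the cost of the stretch by [C j]. *)
  - rewrite fineK// -posL -/(f t0) muleC.
    have -> : (f t0 * mu (S j) = \int[mu]_(x in S j) (cst (f t0) x))%E by exact: (esym (integral_cst mu (mS j) _)).
    rewrite /C EFinD EFinM !fineK//.
    have -> : (\int[mu]_(x in S j) u x + eta%:E * mu (S j) = \int[mu]_(x in S j) (u x + (cst eta%:E) x))%E.
      rewrite ge0_integralD//.
      + by congr (_ + _)%E; exact: (esym (integral_cst mu (mS j) _)).
      + exact: mS.
      + exact: measurable_funTS.
      + by move=> x _; rewrite lee_fin ltW.
    apply: ge0_le_integral => //; first exact: mS.
    + by move=> x _; exact: f0.
    + apply: emeasurable_funD; last exact: measurable_cst.
      exact: measurable_funTS.
    + move=> x Sx; rewrite /u /patch mem_set; last exact/DG/SD/Sx.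
      have [_ _ _ _ h] := prmB _ (SB j _ Sx); apply: h; exact: SB.
have sume : \sum_(j < m) e j <= eta * (1 + T).
  rewrite big_split/= -mulr_sumr mulrDr mulr1; apply: lerD; last first.
    by apply: ler_wpM2l => //; exact: ltW.
  rewrite -lee_fin -sumEFin; apply: le_trans (ltW Hsum).
  by apply: lee_sum => j _; rewrite fineK.
have sumC : \sum_(j < m) C j <= A + eta * T.
  rewrite big_split/= -mulr_sumr; apply: lerD; last first.
    by apply: ler_wpM2l => //; exact: ltW.
  rewrite -lee_fin -sumEFin; apply: le_trans uA.
  rewrite -(cells_integralT T0 m0)//; last exact: measurable_funTS.
  apply: lee_sum => j _; rewrite fineK//.
  apply: ge0_subset_integral => //; [exact: mS|exact: mcell|exact: measurable_funTS].
have o0 : orthant (phi 0) by apply: oT; rewrite lexx ltW.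
have tj00 : tj 0%N = 0 by rewrite /tj mulr0 mul0r.
have e_ge0 j : (j < m)%N -> 0 <= e j.
  move=> _; rewrite addr_ge0 ?fine_ge0 ?integral_ge0//; last by rewrite mulr_ge0 ?fine_ge0// ltW.
  by move=> x _; rewrite lee_fin speed_ge0.
have mesh j : (j < m)%N -> tj j.+1 - tj j <= dl / 4.
  move=> jm; rewrite dtj; have [_ _ _ /ltW h] := HS j; apply: (le_trans h).
  by rewrite /rho ge_min lexx.
have [tau [psi [rt p0 tmtau tr]]] := route_iterate r0 o0 tj00 (ltW theta0) (ltW (divr_gt0 dl0 (ltr0n R 4))) e_ge0 mesh step.
rewrite tjm in tmtau.
have Xle : 8 / r * \sum_(j < m) e j <= Xs by rewrite /Xs ler_wpM2l// divr_ge0// ltW.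
exists psi; split.
  apply: route_le (route_truncate L_ge0 (ltW T0) tmtau rt).
  have : 8 / r * (\sum_(j < m) e j) * K <= Xs * K by rewrite ler_wpM2r.
  by move: sumC XK etaT; lra.
move=> t /andP[t0 tT].
have [j [jm h1 h2]] := tr t (introT andP (conj t0 (le_trans tT tmtau))).
have h3 : `|phi t - phi (tj j)| < delta / 4.
  apply: Hdl; [by rewrite t0|by rewrite tj0 tjT|].
  by apply: (le_lt_trans h1); lra.
apply: (le_trans (ler_distD (phi (tj j)) _ _)); rewrite [X in _ + X]distrC.
by lra.
Qed.

Lemma rate_fun_le_action : (rate_fun L T phi <= action L T phi)%E.
Proof.
have A0 : (0 <= action L T phi)%E by apply: integral_ge0 => t _; exact: L_ge0.
case EA : (action L T phi) => [A| |]; [|exact: leey|by rewrite EA in A0].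
apply/lee_addgt0Pr => gamma g0; apply: rate_fun_le => delta d0.
have AA : (action L T phi <= A%:E)%E by rewrite EA.
have d20 : 0 < delta / 2 by rewrite divr_gt0.
have [psi [rt close]] := rate_fun_approx AA d20 g0.
exists psi; split; [exact: route_orthant rt|exact: route_pl rt| |].
  apply: (@le_lt_trans _ _ (delta / 2)%:E); last by rewrite lte_fin; lra.
  (* The identity time change bounds the Skorohod distance by the uniform one. *)
  apply: (@le_trans _ _ (maxe (sup_dist T id id) (sup_dist T phi (psi \o id)))).
    apply: ereal_inf_lbound; exists id => //; split => //.
    by apply: continuous_subspaceT => x; exact: cvg_id.
  rewrite ge_max; apply/andP; split; apply: ge_ereal_sup => _ [t /= tT <-].
    by rewrite subrr normr0 lee_fin ltW.
  by rewrite lee_fin; apply: close; move: tT; rewrite in_itv.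
by rewrite -EFinD; exact: route_action rt.
Qed.

End rate_action.

(** Upper bounds are available at real rates only; an infinite action is reached through all real
    [c]. *)
Lemma lee_approx_lt (R : realType) (x y : \bar R) : (0 <= x)%E ->
  (forall c : R, (c%:E < x)%E -> (c%:E <= y)%E) -> (x <= y)%E.
Proof.
case: x => [x _ H| _ H|]//.
  apply/lee_addgt0Pr => e e0; rewrite -leeBlDr// -EFinB.
  by apply: H; rewrite lte_fin ltrBlDr ltrDl.
by rewrite leye_eq; apply/eqP/eqyP => A _; apply: H; rewrite ltry.
Qed.

Theorem theorem1 (R : realType) (N : nat) (N_ge1 : (1 <= N)%N)
    (d : measure_display) (Omega : measurableType d) (E : set 'rV[R]_N)
    (P : 'rV[R]_N -> probability Omega R)
    (k : R -> R.-pker (borel_rV R N) ~> (borel_rV R N))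
    (X : 'rV[R]_N -> R -> Omega -> 'rV[R]_N)
    (X_markov : markov_process E P k X)
    (E_dense : forall x : 'rV[R]_N, orthant x ->
       exists2 u : nat -> 'rV[R]_N,
         (forall n, (1 <= n)%N -> scaled_space E n (u n)) & u @ \oo --> x)
    (L : {set 'I_N} -> 'rV[R]_N -> \bar R)
    (L_ge0 : forall (Lambda : {set 'I_N}) (v : 'rV[R]_N), (0 <= L Lambda v)%E)
    (L_convex : forall Lambda : {set 'I_N}, convex_ereal (L Lambda))
    (A1 : forall (Lambda : {set 'I_N}) (T : R), 0 < T ->
       forall (phi : R -> 'rV[R]_N) (v : 'rV[R]_N),
         in_orthant T phi ->
         (forall t, 0 <= t <= T -> phi t = phi 0 + t *: v) ->
         (forall t, 0 < t < T -> face Lambda (phi t)) ->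
         (lower_fun E P X T phi >= - (T%:E * L Lambda v))%E)
    (A2 : \forall v \near (0 : 'rV[R]_N), (L [set: 'I_N]%SET v < +oo)%E)
    (A3 : forall (Lambda : {set 'I_N}) (T : R), 0 < T ->
       forall x y : 'rV[R]_N, face Lambda x -> face Lambda y ->
         (upper_transition E P X Lambda T x y
            <= - (T%:E * L Lambda (T^-1 *: (y - x))))%E) :
  forall T : R, 0 < T ->
  forall phi : R -> 'rV[R]_N,
    in_orthant T phi -> absolutely_continuous T phi ->
    [/\ rate_fun L T phi = action L T phi,
        action L T phi = (- upper_fun E P X T phi)%E &
        (- upper_fun E P X T phi)%E = (- lower_fun E P X T phi)%E].

Proof.
move=> T T0 phi oT acT.
have [r [K [r0 r1 K0 rK]]] := convex_small_ball (L_convex [set: 'I_N]%SET) (L_ge0 [set: 'I_N]%SET) A2.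
have o0 : orthant (phi 0) by apply: oT; rewrite lexx ltW.
have a0 : (0 <= action L T phi)%E by apply: integral_ge0 => t _; exact: L_ge0.
have Ia : (rate_fun L T phi <= action L T phi)%E.
  exact: (rate_fun_le_action X_markov E_dense L_ge0 A1 A3 r0 r1 K0 rK T0 oT acT).
have aW : (action L T phi <= - upper_fun E P X T phi)%E.
  apply: lee_approx_lt => // c cA; rewrite leeNr -EFinN; apply: upper_fun_le.
  exact: (upper_bound_action X_markov E_dense L_ge0 A1 A3 T0 oT acT).
have Ww : (- upper_fun E P X T phi <= - lower_fun E P X T phi)%E.
  by rewrite leeN2; apply: lower_fun_le_upper_fun; exact: E_dense.
have wI : (- lower_fun E P X T phi <= rate_fun L T phi)%E.
  have LBI c : (rate_fun L T phi <= c%:E)%E -> (- lower_fun E P X T phi <= c%:E)%E.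
    move=> Ic; rewrite leeNl; apply: lower_fun_bound.
    exact: (lower_bound_rate X_markov L_ge0 A1 r0 r1 K0 rK T0 oT acT Ic).
  (* A rate function equal to [-oo] would put [- w] below [-1], although [- w] is at least the
     nonnegative action. *)
  case E1 : (rate_fun L T phi) LBI => [c| |] LBI; [exact: LBI|exact: leey|].
  have : (0%E <= - lower_fun E P X T phi)%E by exact: le_trans (le_trans a0 aW) Ww.
  by move=> h; have := le_trans h (LBI (-1) (leNye _)); rewrite lee_fin ler0N1.
have e1 : rate_fun L T phi = action L T phi.
  by apply/le_anti; rewrite Ia (le_trans aW)// (le_trans Ww).
split => //.
- by apply/le_anti; rewrite aW -e1 (le_trans Ww).
- by apply/le_anti; rewrite Ww (le_trans wI)// e1.
Qed.
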